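(* Let $v=v_n\ge 0$ be a sequence of nonnegative integers such that the limit $\alpha=\lim_{n\to\infty}v/n$ exists in $[0,+\infty]$. Let $\mathcal{D}$ be the chiral Dirac matrix with $\tau=0$ and let $\sigma_1,\dots,\sigma_n$ be its eigenvalues with positive real part. Then: (i) (large deviations) for any $t>1$, $$\lim_{n\to\infty}\frac1n\log\mathbb{P}\Bigl(\bigl(\tfrac{n}{n+v}\bigr)^{1/4}\max_{1\le i\le n}\Re\sigma_i\ge t\Bigr)=-J_\alpha(t),$$ where $$J_\alpha(t)=-2(1+\log t^2)+\frac{4(1+\alpha)t^4}{\alpha+\sqrt{\alpha^2+4(1+\alpha)t^4}}-\alpha\log\frac{\alpha+\sqrt{\alpha^2+4t^4(1+\alpha)}}{2(1+\alpha)};$$ (ii) (moderate deviations) for any positive sequence $d_n$ with $\sqrt{\log n/n}\ll d_n\ll1$ and any $t>0$, $$\lim_{n\to\infty}\frac{1}{n d_n^2}\log\mathbb{P}\Bigl(\bigl(\tfrac{n}{n+v}\bigr)^{1/4}\max_{1\le i\le n}\Re\sigma_i\ge 1+t d_n\Bigr)=-\frac{8(1+\alpha)}{2+\alpha}\,t^2.$$ When $\alpha=+\infty$, $J_\alpha(t)$ and $\frac{8(1+\alpha)}{2+\alpha}$ are understood as the limits of these expressions as $\alpha\to+\infty$.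
   Context: For integers $n\ge1$ and $v\ge0$, let $P$ and $Q$ be independent $(n+v)\times n$ random matrices with i.i.d. centered complex Gaussian entries whose real and imaginary parts are independent, each of variance $1/(4n)$. For $\tau=0$ set $\Phi=P+Q$, $\Psi=P-Q$ and let $\mathcal{D}=\begin{pmatrix}0&\Phi\\ \Psi^*&0\end{pmatrix}$, a $(2n+v)\times(2n+v)$ matrix. Its spectrum consists of $2n$ eigenvalues $\{\pm\sigma_k\}_{k=1}^n$, where $\sigma_k$ is chosen with $\Re\sigma_k>0$, and the eigenvalue $0$ with multiplicity $v$. The joint density of $(\sigma_1,\dots,\sigma_n)$ (in exchangeable order) on $\{z\in\mathbb{C}:\Re z>0\}^n$ is proportional to $$\prod_{1\le j<k\le n}|z_j^2-z_k^2|^2\prod_{j=1}^n|z_j|^{2v+2}K_v(2n|z_j|^2),$$ where $K_v$ is the modified Bessel function of the second kind. The law of $\max_i\Re\sigma_i$ is determined by this density. The notation $a_n\ll b_n$ means $a_n/b_n\to0$ as $n\to\infty$. *)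

(* Defs.v *)
(* MathComp / MathComp-Analysis. *)
From HB Require Import structures.
From mathcomp Require Import all_boot all_order all_algebra all_fingroup.
From mathcomp Require Import complex.
From mathcomp Require Import all_classical all_reals all_analysis.

Set Implicit Arguments.
Unset Strict Implicit.
Unset Printing Implicit Defensive.

Import Order.TTheory GRing.Theory Num.Theory.
Import numFieldNormedType.Exports.

Local Open Scope classical_set_scope.
Local Open Scope ring_scope.
Local Open Scope complex_scope.

Section Gaussian.
Context {R : realType} {d : measure_display} {T : measurableType d}.
Variable Pr : probability T R.

Definition mutually_independent (I : finType) (X : I -> T -> R) : Prop :=
  forall (J : {set I}) (A : I -> set R), (forall i, measurable (A i)) ->
  Pr [set w | forall i, i \in J -> A i (X i w)] =
  (\prod_(i in J) Pr (X i @^-1` A i))%E.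

(* The 4mn real coordinates of a pair of m x n complex matrices: the first
   boolean selects P or Q, the second one the real or the imaginary part. *)
Definition coordinate (m n : nat) (P Q : T -> 'M[R[i]]_(m, n))
    (x : bool * bool * 'I_m * 'I_n) (w : T) : R :=
  let: (inP, isRe, i, j) := x in
  let z := (if inP then P else Q) w i j in
  if isRe then complex.Re z else complex.Im z.

(* The second parameter of [normal_prob] is the standard deviation. *)
Definition gaussian_pair (m n : nat) (P Q : T -> 'M[R[i]]_(m, n)) : Prop :=
  [/\ forall x, measurable_fun [set: T] (coordinate P Q x),
      forall x (A : set R), measurable A ->
        Pr (coordinate P Q x @^-1` A) =
        normal_prob 0 (Num.sqrt (4 * n%:R)^-1) A
    & mutually_independent (coordinate P Q)].

End Gaussian.

Section Dirac.
Context {R : realType}.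

Definition adjoint_mx (m n : nat) (A : 'M[R[i]]_(m, n)) : 'M[R[i]]_(n, m) :=
  map_mx Num.conj A^T.

(* The blocks have sizes n + v and n, whence the total size 2n + v. *)
Definition dirac_mx (n v : nat) (P Q : 'M[R[i]]_(n + v, n)) :
    'M[R[i]]_(n + v + n) :=
  let Phi := P + Q in
  let Psi := P - Q in
  block_mx 0 Phi (adjoint_mx Psi) 0.

(* The spectrum of D, with algebraic multiplicities, is {s_k, - s_k}_k
   together with v times the eigenvalue 0. *)
Definition right_eigenvalues (n v : nat) (D : 'M[R[i]]_(n + v + n))
    (s : 'I_n -> R[i]) : Prop :=
  (forall k, 0 < complex.Re (s k)) /\
  char_poly D =
    'X ^+ v * \prod_(k < n) (('X - (s k)%:P) * ('X - (- s k)%:P)).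

(* The neutral element 0 is immaterial when n > 0 and all Re (s k) > 0. *)
Definition max_Re (n : nat) (s : 'I_n -> R[i]) : R :=
  \big[Num.max/0]_(k < n) complex.Re (s k).

End Dirac.

Section Density.
Context {R : realType}.

Definition cosh (x : R) : R := (expR x + expR (- x)) / 2.

(* K_v (x) for x > 0:
   K_v (x) = int_0^oo exp (- x cosh t) cosh (v t) dt. *)
Definition besselK (v : nat) (x : R) : R :=
  \int[lebesgue_measure]_(t in `[0, +oo[)
    (expR (- x * cosh t) * cosh (v%:R * t)).

Notation plane := (measurableTypeR R * measurableTypeR R)%type.

Definition complex_of_plane (p : plane) : R[i] := p.1 +i* p.2.
Definition plane_of_complex (z : R[i]) : plane :=
  (complex.Re z, complex.Im z).

(* Integral with respect to the Lebesgue measure on C^n = (R^2)^n, written as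
   an iterated integral; only applied to nonnegative measurable functions. *)
Fixpoint integral_Cn (n : nat) : (n.-tuple plane -> \bar R) -> \bar R :=
  match n return (n.-tuple plane -> \bar R) -> \bar R with
  | 0%N => fun f => f [tuple]
  | m.+1 => fun f =>
      (\int[(@lebesgue_measure R \x @lebesgue_measure R)%E]_z
         integral_Cn (fun s : m.-tuple plane => f [tuple of z :: s]))%E
  end.

Definition dirac_density (n v : nat) (p : n.-tuple plane) : R :=
  let z j := complex_of_plane (tnth p j) in
  let norm := @ComplexField.Normc.normc R in
  if [forall j, 0 < complex.Re (z j)] then
    (\prod_(j < n) \prod_(k < n | (j < k)%N) norm (z j ^+ 2 - z k ^+ 2) ^+ 2)
    * \prod_(j < n) (norm (z j) ^+ (2 * v + 2)
                     * besselK v (2 * n%:R * norm (z j) ^+ 2))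
  else 0.

Definition exchangeable_set (n : nat) (B : set (n.-tuple plane)) : Prop :=
  forall (s : 'S_n) p, B p -> B [tuple tnth p (s i) | i < n].

(* "(s_1, ..., s_n), in exchangeable order, has density proportional to
   dirac_density": since an arbitrary enumeration of the s_k is allowed, the
   density only gives the probabilities of permutation-invariant events. *)
Definition has_dirac_density (d : measure_display) (T : measurableType d)
    (Pr : probability T R) (n v : nat) (s : T -> 'I_n -> R[i]) : Prop :=
  exists2 c : R, 0 < c &
  forall B : set (n.-tuple plane), measurable B -> exchangeable_set B ->
  Pr [set w | B [tuple plane_of_complex (s w i) | i < n]] =
  (c%:E * integral_Cn (fun p => (dirac_density v p * \1_B p)%:E))%E.

End Density.

Section Model.
Context {R : realType} {d : measure_display} {T : measurableType d}.
Variable Pr : probability T R.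

(* D has eigenvalues s_k and - s_k with Re s_k > 0 only almost surely.  The
   joint law of the s_k follows from that of P and Q; it is recorded here as
   part of the description of the model. *)
Definition chiral_dirac_model (n v : nat) (P Q : T -> 'M[R[i]]_(n + v, n))
    (s : T -> 'I_n -> R[i]) : Prop :=
  [/\ gaussian_pair Pr P Q,
      forall k, measurable_fun [set: T] (fun w => complex.Re (s w k)) /\
                measurable_fun [set: T] (fun w => complex.Im (s w k)),
      {ae Pr, forall w, right_eigenvalues (dirac_mx (P w) (Q w)) (s w)}
    & has_dirac_density Pr v s].

End Model.

Section Rates.
Context {R : realType}.

Definition much_less (a b : nat -> R) : Prop :=
  (fun n => a n / b n) @ \oo --> (0 : R).

(* A function of alpha in [0, +oo[, extended to +oo by its limit; the value at
   -oo is junk. *)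
Definition extend_to_infinity (F : R -> R) (alpha : \bar R) : R :=
  match alpha with
  | a%:E => F a
  | +oo%E => lim (F a @[a --> +oo])
  | -oo%E => 0
  end.

Definition J_fin (t a : R) : R :=
  let root := Num.sqrt (a ^+ 2 + 4 * (1 + a) * t ^+ 4) in
  - 2 * (1 + ln (t ^+ 2))
  + 4 * (1 + a) * t ^+ 4 / (a + root)
  - a * ln ((a + root) / (2 * (1 + a))).

Definition J (alpha : \bar R) (t : R) : R :=
  extend_to_infinity (J_fin t) alpha.

Definition moderate_rate (alpha : \bar R) : R :=
  extend_to_infinity (fun a => 8 * (1 + a) / (2 + a)) alpha.

Definition scaled_max (n v : nat) (s : 'I_n -> R[i]) : R :=
  (n%:R / (n + v)%:R) `^ (4^-1) * max_Re s.

End Rates.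

(* Main.v *)
(* The density, symmetrised under z_j -> -z_j, is |Vandermonde(z_j^2)|^2 prod
   w(z_j) on C^n with w(z) = |z|^{2v} K_v(2n|z|^2) |z|^2.  Rotating the
   coordinates by independent multiples of pi/n and averaging replaces the
   squared Vandermonde determinant by the permanent of |z_j|^{4k}, 0 <= k < n:
   for events that only involve the moduli, the |z_j| are independent with
   densities proportional to |z|^{4k} w(z).  The moments of these densities
   satisfy n^2 M(k+1) = (k+1) (k+1+v) M(k).

   Hence P(max |z_j| >= y) is at most the sum of the tails of the n densities,
   each bounded by Markov's inequality for |z|^{4s}, and at least the tail for
   k = n-1, bounded below by Chebyshev's inequality under the law tilted by
   |z|^{4s}.  Since n+1 common rotations by multiples of pi/n bring a point of
   large modulus close to the real axis, P(max Re z_j >= x) differs from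
   P(max |z_j| >= x) by a factor at most n+1 and a change of x by the factor
   cos(pi/n).  Both bounds are products over i < s of values at i/n of
   (1 + u) (1 + u n/(n+v)); their logarithms are Riemann sums, and the optimal
   u = s/n solves (1 + u) (1 + u n/(n+v)) = t^4. *)
Require Import Defs.
From mathcomp Require Import all_boot all_order all_algebra all_fingroup.
From mathcomp Require Import complex ring lra.
From mathcomp Require Import all_classical all_reals all_analysis measurable_realfun.

Set Implicit Arguments.
Unset Strict Implicit.
Unset Printing Implicit Defensive.

Import Order.TTheory GRing.Theory Num.Theory.
Import numFieldNormedType.Exports.

Local Open Scope classical_set_scope.
Local Open Scope ring_scope.
Local Open Scope complex_scope.

(** * Lebesgue measure on the plane and on C^n *)

Section PlaneMeasure.
Context {R : realType}.
Local Notation mu := (@lebesgue_measure R).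
Local Notation plane := (measurableTypeR R * measurableTypeR R)%type.
Local Notation mu2 := ((@lebesgue_measure R) \x (@lebesgue_measure R))%E.

(** Only quotients of moments enter, so no closed form of the weight or of a normalising constant is
    needed: multiplying the k-th radial density by |z|^{4s} gives the (k+s)-th one up to a constant,
    hence Markov's inequality, the tilting and the variance in Chebyshev's inequality all reduce to
    the recursion for M(k). That recursion comes from writing K_v as an integral of exponentials:
    after scaling the plane, the moment splits into a Gaussian moment and an integral of a power of
    sech against cosh(vt), each with its own recursion. The angle pi/n is dictated by the squares in
    the Vandermonde factor: z_j^2 turns by 2 pi/n, and a root of unity of order n separates the
    exponents 0, ..., n-1. Finite averages thus replace integrals over angles, and no polar
    coordinates occur. The losses in passing from |z| to Re z are harmless because ln n = o(n d_n^2)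
    and 1/n = o(d_n). With d_n = 1 these conditions hold as well, so (i) and (ii) are two instances
    of one limit theorem. *)

Definition affine_map (a b : R) : measurableTypeR R -> measurableTypeR R :=
  fun x : R => a * x + b.

Lemma measurable_affine (a b : R) : measurable_fun setT
  (affine_map a b).
Proof. by apply: measurable_funD => //; exact: measurable_funM. Qed.

Lemma lebesgue_measure_affine (a b : R) (A : set (measurableTypeR R)) :
  0 < a -> measurable A ->
  (a%:E * pushforward mu
     (affine_map a b) A = mu A)%E.
Proof.
move=> a0 mA; have mf := measurable_affine a b.
pose p : {measure set measurableTypeR R -> \bar R} :=
   measure_function_pushforward__canonical__measure_function_Measure mu mf.
have -> : (a%:E * pushforward mu
     (affine_map a b) A)%E =
   mscale (NngNum (ltW a0)) p A by [].
(* The scaled pushforward is a measure, so agreement on half-open intervals suffices. *)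
apply/esym; apply: lebesgue_measure_unique => //= _ [[c d] _ <-].
rewrite /mscale /= /pushforward /=.
rewrite (_ : _ @^-1` _ = `](c - b) / a, (d - b) / a]%classic); last first.
  apply/seteqP; split=> x /=; rewrite !in_itv /= ltr_pdivrMr // ler_pdivlMr //.
  - by rewrite ltrBlDr lerBrDr (mulrC x).
  - by rewrite ltrBlDr lerBrDr (mulrC x).
rewrite !lebesgue_measure_itv/= !lte_fin ltr_pM2r ?invr_gt0 // ltrD2r.
case: ifP => _; last by rewrite mule0.
by rewrite -!EFinB -EFinM; congr _%:E; field; rewrite gt_eqF.
Qed.

Lemma integral_affine (a b : R) (G : R -> \bar R) : 0 < a ->
  measurable_fun setT G -> (forall x, 0 <= G x)%E ->
  (a%:E * \int[mu]_x G (a * x + b)%R = \int[mu]_x G x)%E.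
Proof.
move=> a0 mG G0; have mf := measurable_affine a b.
pose p : {measure set measurableTypeR R -> \bar R} :=
   measure_function_pushforward__canonical__measure_function_Measure mu mf.
transitivity (a%:E * \int[p]_x G x)%E.
  by rewrite /p /= ge0_integral_pushforward // preimage_setT.
rewrite -(@ge0_integral_mscale _ _ _ p setT _ (NngNum (ltW a0))) //.
apply: eq_measure_integral => /= A mA _.
exact: lebesgue_measure_affine.
Qed.

Lemma measurable_pair2 d (T : measurableType d) (f g : T -> R) :
  measurable_fun setT f -> measurable_fun setT g ->
  measurable_fun setT (fun x => (f x, g x) : plane).
Proof. by move=> mf mg; exact: measurable_fun_pair. Qed.

Lemma measurable_fst2 : measurable_fun setT (fun p : plane => p.1 : R).
Proof. exact: measurable_fst. Qed.

Lemma measurable_snd2 : measurable_fun setT (fun p : plane => p.2 : R).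
Proof. exact: measurable_snd. Qed.

Lemma measurable_lincomb (a b : R) :
  measurable_fun setT (fun p : plane => a * (p.1 : R) + b * (p.2 : R) : R).
Proof.
by apply: measurable_funD; apply: measurable_funM.
Qed.

Definition lin2 (a b c d : R) (p : plane) : plane :=
  let x : R := p.1 in let y : R := p.2 in (a * x + b * y, c * x + d * y).

Lemma measurable_lin2 a b c d : measurable_fun setT (lin2 a b c d).
Proof. by apply: measurable_pair2; exact: measurable_lincomb. Qed.

Implicit Type G : plane -> \bar R.

Lemma plane_tonelli1 G : measurable_fun setT G -> (forall z, 0 <= G z)%E ->
  (\int[mu2]_z G z = \int[mu]_x \int[mu]_y G (x, y))%E.
Proof. by move=> mG G0; rewrite fubini_tonelli1. Qed.

Lemma plane_tonelli2 G : measurable_fun setT G -> (forall z, 0 <= G z)%E ->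
  (\int[mu2]_z G z = \int[mu]_y \int[mu]_x G (x, y))%E.
Proof. 
move=> mG G0; rewrite (fubini_tonelli1 _ mG G0); exact: fubini_tonelli mG G0.
Qed.

Lemma measurable_section_l G (x : R) : measurable_fun setT G ->
  measurable_fun setT (fun y : R => G (x, y)).
Proof. by move=> mG; apply: (measurableT_comp mG); exact: measurable_pair2. Qed.

Lemma measurable_section_r G (y : R) : measurable_fun setT G ->
  measurable_fun setT (fun x : R => G (x, y)).
Proof. by move=> mG; apply: (measurableT_comp mG); exact: measurable_pair2. Qed.

(** For fixed y the shear is a translation in x, so Tonelli with x inside reduces to one
    dimension. *)
Lemma integral_shearl (a : R) G :
  measurable_fun setT G -> (forall x, 0 <= G x)%E ->
  (\int[mu2]_z G (lin2 1 a 0 1 z) = \int[mu2]_z G z)%E.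
Proof.
move=> mG G0.
have mGs : measurable_fun setT (G \o lin2 1 a 0 1).
  by apply: measurableT_comp => //; exact: measurable_lin2.
rewrite (plane_tonelli2 mGs (fun z => G0 _)) (plane_tonelli2 mG G0).
apply: eq_integral => y _.
have := @integral_affine 1 (a * y) (fun x => G (x, y)) ltr01 _ (fun x => G0 _).
rewrite mul1e => <- //.
  apply: eq_integral => x _; rewrite /lin2 /=.
  by congr (G (_, _)); rewrite mul0r mul1r add0r.
exact: measurable_section_r.
Qed.

Lemma integral_shearr (a : R) G :
  measurable_fun setT G -> (forall x, 0 <= G x)%E ->
  (\int[mu2]_z G (lin2 1 0 a 1 z) = \int[mu2]_z G z)%E.
Proof.
move=> mG G0.
have mGs : measurable_fun setT (G \o lin2 1 0 a 1).
  by apply: measurableT_comp => //; exact: measurable_lin2.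
rewrite (plane_tonelli1 mGs (fun z => G0 _)) (plane_tonelli1 mG G0).
apply: eq_integral => x _.
have := @integral_affine 1 (a * x) (fun y => G (x, y)) ltr01 _ (fun x => G0 _).
rewrite mul1e => <- //.
  apply: eq_integral => y _; rewrite /lin2 /=.
  by congr (G (_, _)); rewrite ?mul0r ?mul1r ?addr0 // addrC.
exact: measurable_section_l.
Qed.

(* A rotation with [b <> 0] is a product of three shears; the remaining case
   is the square of the quarter turn. *)
Lemma integral_rotation (a b : R) G : a ^+ 2 + b ^+ 2 = 1 ->
  measurable_fun setT G -> (forall x, 0 <= G x)%E ->
  (\int[mu2]_z G (lin2 a (- b) b a z) = \int[mu2]_z G z)%E.
Proof.
have gen (c s : R) H : s != 0 -> c ^+ 2 + s ^+ 2 = 1 ->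
  measurable_fun setT H -> (forall x, 0 <= H x)%E ->
  (\int[mu2]_z H (lin2 c (- s) s c z) = \int[mu2]_z H z)%E.
  (* For c = cos x and s = sin x this is -tan(x/2), the parameter of the two outer shears. *)
  move=> s0 cs mH H0; set k := (c - 1) / s.
  have m1 := measurable_lin2 1 k 0 1; have m2 := measurable_lin2 1 0 s 1.
  rewrite -[RHS](integral_shearl k) //.
  rewrite -[RHS](@integral_shearr s (fun z => H (lin2 1 k 0 1 z))) //; last first.
    exact: measurableT_comp.
  rewrite -[RHS](@integral_shearl k
    (fun z => H (lin2 1 k 0 1 (lin2 1 0 s 1 z)))) //; last first.
    by apply: measurableT_comp => //; exact: measurableT_comp.
  apply: eq_integral => -[x y] _; congr (H _); rewrite /lin2 /= /k.
  have s2 : s ^+ 2 = 1 - c ^+ 2 by rewrite -cs addrAC subrr add0r.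
  congr pair.
    have -> : (- s) = (c ^+ 2 - 1) / s.
      by rewrite -opprB -s2; field.
    by field.
  by field.
move=> ab mG G0.
have [b0|b0] := eqVneq b 0; last exact: gen.
have mq := measurable_lin2 0 (- 1) 1 0.
have q2 : (\int[mu2]_z G (lin2 (-1) 0 0 (-1) z) = \int[mu2]_z G z)%E.
  have h : (0 : R) ^+ 2 + 1 ^+ 2 = 1 by rewrite expr0n /= add0r expr1n.
  rewrite -[RHS](gen _ _ _ (oner_neq0 _) h) //.
  rewrite -[RHS](gen _ _ (fun z => G (lin2 0 (- 1) 1 0 z)) (oner_neq0 _) h) //;
    last exact: measurableT_comp.
  apply: eq_integral => -[x y] _; congr (G _); rewrite /lin2 /=.
  by congr pair; ring.
move: ab; rewrite b0 expr0n /= addr0 oppr0 => /eqP.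
rewrite sqrf_eq1 => /orP[] /eqP -> //.
apply: eq_integral => -[x y] _; congr (G _); rewrite /lin2 /=.
by congr pair; ring.
Qed.

Lemma integral_scale2 (c : R) G : 0 < c ->
  measurable_fun setT G -> (forall x, 0 <= G x)%E ->
  ((c ^+ 2)%:E * \int[mu2]_z G (lin2 c 0 0 c z) = \int[mu2]_z G z)%E.
Proof.
move=> c0 mG G0.
have mGs : measurable_fun setT (G \o lin2 c 0 0 c).
  by apply: measurableT_comp => //; exact: measurable_lin2.
rewrite (plane_tonelli1 mGs (fun z => G0 _)) (plane_tonelli1 mG G0).
have mF : measurable_fun setT (fubini_F mu G : R -> \bar R).
  exact: measurable_fun_fubini_tonelli_F.
have F0 x : (0 <= fubini_F mu G x)%E by apply: integral_ge0.
rewrite -[RHS](@integral_affine c 0 _ c0 mF F0) expr2 EFinM -muleA; congr (_ * _)%E.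
rewrite -ge0_integralZl //; last 3 first.
- exact: (measurable_fun_fubini_tonelli_F _ mGs (fun z => G0 _)).
- by move=> x _; apply: integral_ge0 => y _; exact: G0.
- by rewrite lee_fin ltW.
apply: eq_integral => x _; rewrite /fubini_F.
have := @integral_affine c 0 (fun y => G (c * x + 0, y)%R) c0 _ (fun x => G0 _).
move=> <- //.
  congr (_ * _)%E.
  by apply: eq_integral => y _; rewrite /lin2 /= ?mul0r ?addr0 ?add0r.
exact: measurable_section_l.
Qed.

(** The half-turn exchanges the two open half-planes, and the imaginary axis is null: after Tonelli,
    only the abscissa 0 is exceptional. *)
Lemma integral_half_plane G :
  measurable_fun setT G -> (forall z, 0 <= G z)%E ->
  (forall x y : R, G (- x, - y) = G (x, y)) ->
  (\int[mu2]_z G z =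
   2%:E * \int[mu2]_z ((0 < (z.1 : R))%R%:R%:E * G z))%E.
Proof.
move=> mG G0 Gs.
pose H (e : R) (z : plane) : \bar R := ((0 < e * (z.1 : R))%R%:R%:E * G z)%E.
have mH e : measurable_fun setT (H e).
  apply: emeasurable_funM => //; apply/measurable_EFinP.
  apply: (@measurableT_comp _ _ _ _ _ _ (fun b : bool => b%:R : R)) => //.
  have m1 : measurable_fun setT (fun z : plane => e * (z.1 : R)).
    by apply: measurable_funM => //; exact: measurable_fst2.
  exact: (measurable_fun_ltr (f := fun=> 0) _ m1).
have H0 e z : (0 <= H e z)%E by rewrite /H mule_ge0 // lee_fin.
have HN : (\int[mu2]_z H (-1)%R z = \int[mu2]_z H 1%R z)%E.
  rewrite -(@integral_rotation (-1) 0 (H 1)) //; last first.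
    by rewrite sqrrN expr1n expr0n /= addr0.
  apply: eq_integral => -[x y] _; rewrite /H /lin2 /=.
  congr (_ * _)%E; last by rewrite -Gs /=; congr (G (_, _)); ring.
  by congr ((0 < _)%R%:R%:E); ring.
transitivity (\int[mu2]_z (H 1%R z + H (-1)%R z))%E; last first.
  rewrite ge0_integralD // HN.
  rewrite -mule2n -mule_natl; congr (_ * _)%E.
  by apply: eq_integral => z _; rewrite /H mul1r.
pose S z := (H 1%R z + H (-1)%R z)%E.
have mS : measurable_fun setT S by exact: emeasurable_funD.
have S0 z : (0 <= S z)%E by exact: adde_ge0.
rewrite (plane_tonelli1 mG G0) (plane_tonelli1 mS S0).
apply: ge0_ae_eq_integral => //.
- exact: (measurable_fun_fubini_tonelli_F _ mG G0).
- exact: (measurable_fun_fubini_tonelli_F _ mS S0).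
- by move=> x _; exact: integral_ge0.
- by move=> x _; exact: integral_ge0.
exists [set 0]; split => //.
  exact: lebesgue_measure_set1.
move=> x /= /not_implyP[_ h]; apply: contrapT => /eqP x0; apply: h.
apply: eq_integral => y _; rewrite /S /H /=.
rewrite mul1r mulN1r oppr_gt0.
by case: ltgtP x0 => //= _ _; rewrite ?mul1e ?mul0e ?adde0 ?add0e.
Qed.

End PlaneMeasure.

(** * Iterated integrals over C^n: monotonicity, linearity, changes of coordinates *)

Section IteratedIntegral.
Context {R : realType}.
Local Notation plane := (measurableTypeR R * measurableTypeR R)%type.
Local Notation mu := (@lebesgue_measure R).
Local Notation mu2 := ((@lebesgue_measure R) \x (@lebesgue_measure R))%E.

Lemma integral_Cn_ge0 n (f : n.-tuple plane -> \bar R) :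
  (forall s, 0 <= f s)%E -> (0 <= integral_Cn f)%E.
Proof.
elim: n f => [|n IH] f f0 //=.
by apply: integral_ge0 => z _; exact: IH.
Qed.

Lemma eq_integral_Cn n (f g : n.-tuple plane -> \bar R) :
  f =1 g -> integral_Cn f = integral_Cn g.
Proof. by move=> /funext ->. Qed.

(** Tonelli's measurability statement is applied once per real coordinate, after reassociating T *
    (R * R) as (T * R) * R. *)
Lemma measurable_plane_integral d (T : measurableType d)
    (G : T * plane -> \bar R) :
  measurable_fun setT G -> (forall x, 0 <= G x)%E ->
  measurable_fun setT (fun x => \int[mu2]_z G (x, z))%E.
Proof.
move=> mG G0.
pose G2 (u : (T * measurableTypeR R) * measurableTypeR R) :=
  G (u.1.1, (u.1.2, u.2)).
have mG2 : measurable_fun setT G2.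
  apply: (measurableT_comp mG); apply: measurable_fun_pair.
    exact: measurableT_comp.
  by apply: measurable_fun_pair => //; exact: measurableT_comp.
have mH := @measurable_fun_fubini_tonelli_F _ _ _ _ R mu G2 mG2 (fun u => G0 _).
have H0 v : (0 <= fubini_F mu G2 v)%E.
  by apply: integral_ge0 => y _; exact: G0.
have mK := @measurable_fun_fubini_tonelli_F _ _ _ _ R mu _ mH H0.
rewrite (_ : (fun x => _) = fubini_F mu (fubini_F mu G2)) //.
apply/funext => x; rewrite plane_tonelli1 //.
by apply: (measurableT_comp mG); exact: measurable_fun_pair.
Qed.

(** The parameter space is arbitrary because the induction moves the first coordinate of the tuple
    into it. *)
Lemma measurable_integral_Cn d (T : measurableType d) n
    (F : T * n.-tuple plane -> \bar R) :
  measurable_fun setT F -> (forall x, 0 <= F x)%E ->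
  measurable_fun setT (fun x => integral_Cn (fun s => F (x, s))).
Proof.
elim: n d T F => [|n IH] d T F mF F0 /=.
  by apply: (measurableT_comp mF); exact: measurable_fun_pair.
pose F' (u : (T * plane) * n.-tuple plane) :=
  F (u.1.1, [tuple of u.1.2 :: u.2]).
have mF' : measurable_fun setT F'.
  apply: (measurableT_comp mF); apply: measurable_fun_pair.
    exact: measurableT_comp.
  by apply: measurable_cons => //; exact: measurableT_comp.
have mG := IH _ _ F' mF' (fun u => F0 _).
set G := (X in measurable_fun _ X) in mG.
have G0 u : (0 <= G u)%E by apply: integral_Cn_ge0 => s; exact: F0.
exact: (measurable_plane_integral mG G0).
Qed.

Lemma measurable_cons_section n (z : plane) (f : n.+1.-tuple plane -> \bar R) :
  measurable_fun setT f ->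
  measurable_fun setT (fun s : n.-tuple plane => f [tuple of z :: s]).
Proof.
by move=> mf; apply: (measurableT_comp mf); exact: measurable_cons.
Qed.

Lemma measurable_integral_Cn_cons n (f : n.+1.-tuple plane -> \bar R) :
  measurable_fun setT f -> (forall s, 0 <= f s)%E ->
  measurable_fun setT (fun z : plane =>
    integral_Cn (fun s : n.-tuple plane => f [tuple of z :: s])).
Proof.
move=> mf f0.
pose F (u : plane * n.-tuple plane) := f [tuple of u.1 :: u.2].
apply: (@measurable_integral_Cn _ _ _ F) => [|u]; last exact: f0.
by apply: (measurableT_comp mf); exact: measurable_cons.
Qed.

Lemma le_integral_Cn n (f g : n.-tuple plane -> \bar R) :
  measurable_fun setT f -> measurable_fun setT g ->
  (forall s, 0 <= f s)%E -> (forall s, f s <= g s)%E ->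
  (integral_Cn f <= integral_Cn g)%E.
Proof.
elim: n f g => [|n IH] f g mf mg f0 fg //=.
have g0 s : (0 <= g s)%E by exact: le_trans (f0 s) (fg s).
apply: ge0_le_integral => //.
- by move=> z _; exact: integral_Cn_ge0.
- exact: measurable_integral_Cn_cons.
- exact: measurable_integral_Cn_cons.
- by move=> z _; apply: IH => //; exact: measurable_cons_section.
Qed.

Lemma integral_CnD n (f g : n.-tuple plane -> \bar R) :
  measurable_fun setT f -> measurable_fun setT g ->
  (forall s, 0 <= f s)%E -> (forall s, 0 <= g s)%E ->
  (integral_Cn (fun s => f s + g s) = integral_Cn f + integral_Cn g)%E.
Proof.
elim: n f g => [|n IH] f g mf mg f0 g0 //=.
rewrite -ge0_integralD //.
- apply: eq_integral => z _; apply: IH => //; exact: measurable_cons_section.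
- by move=> z _; exact: integral_Cn_ge0.
- exact: measurable_integral_Cn_cons.
- by move=> z _; exact: integral_Cn_ge0.
- exact: measurable_integral_Cn_cons.
Qed.

Lemma integral_Cn0 n : integral_Cn (fun _ : n.-tuple plane => 0%E) = 0%E.
Proof.
elim: n => [|n IH] //=.
by under eq_integral do rewrite IH; rewrite integral0.
Qed.

Lemma integral_Cn_sum n (I : Type) (r : seq I) (F : I -> n.-tuple plane -> \bar R) :
  (forall i, measurable_fun setT (F i)) -> (forall i s, 0 <= F i s)%E ->
  (integral_Cn (fun s => \sum_(i <- r) F i s) = \sum_(i <- r) integral_Cn (F i))%E.
Proof.
move=> mF F0; elim: r => [|i r IH].
  rewrite big_nil -[RHS](integral_Cn0 n).
  by apply: eq_integral_Cn => s; rewrite big_nil.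
rewrite big_cons -IH -integral_CnD //.
- by apply: eq_integral_Cn => s; rewrite big_cons.
- exact: emeasurable_sum.
- by move=> s; rewrite sume_ge0.
Qed.

Lemma integral_CnZl n (k : \bar R) (f : n.-tuple plane -> \bar R) : (0 <= k)%E ->
  measurable_fun setT f -> (forall s, 0 <= f s)%E ->
  (integral_Cn (fun s => k * f s) = k * integral_Cn f)%E.
Proof.
move=> k0; elim: n f => [|n IH] f mf f0 //=.
rewrite -ge0_integralZl //.
- apply: eq_integral => z _; apply: IH => //; exact: measurable_cons_section.
- exact: measurable_integral_Cn_cons.
- by move=> z _; exact: integral_Cn_ge0.
Qed.

Lemma integral_Cn_prod n (F : 'I_n -> plane -> \bar R) :
  (forall i, measurable_fun setT (F i)) -> (forall i z, 0 <= F i z)%E ->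
  (integral_Cn (fun s => \prod_(i < n) F i (tnth s i)) =
   \prod_(i < n) \int[mu2]_z F i z)%E.
Proof.
elim: n F => [|n IH] F mF F0 /=; first by rewrite !big_ord0.
have mP (I : finType) (m : nat) (j : I -> 'I_m) (H : I -> plane -> \bar R) :
  (forall i, measurable_fun setT (H i)) ->
  measurable_fun setT (fun s : m.-tuple plane => \prod_(i : I) H i (tnth s (j i)))%E.
  move=> mH; elim: (index_enum I) => [|i r IHr].
    by under eq_fun do rewrite big_nil; exact: measurable_cst.
  under eq_fun do rewrite big_cons; apply: emeasurable_funM => //.
  by apply: (measurableT_comp (mH i)); exact: measurable_tnth.
rewrite big_ord_recl -(IH (fun i => F (lift ord0 i))) //.
rewrite muleC -ge0_integralZl //; last first.
  by apply: integral_Cn_ge0 => s; apply: prode_ge0.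
apply: eq_integral => z _.
rewrite muleC -integral_CnZl //.
- apply: eq_integral_Cn => s; rewrite big_ord_recl tnth0.
  by congr (_ * _)%E; apply: eq_bigr => i _; rewrite tnthS.
- exact: (mP _ _ id (fun i => F (lift ord0 i))).
- by move=> s; apply: prode_ge0.
Qed.

Definition map_coord n (phi : 'I_n -> plane -> plane) (s : n.-tuple plane) :=
  [tuple phi i (tnth s i) | i < n].

Lemma map_coord_cons n (phi : 'I_n.+1 -> plane -> plane) z (s : n.-tuple plane) :
  map_coord phi [tuple of z :: s] =
  [tuple of phi ord0 z :: map_coord (fun i => phi (lift ord0 i)) s].
Proof.
apply: eq_from_tnth => i; rewrite tnth_mktuple.
case: (unliftP ord0 i) => [j ->|->]; last by rewrite !tnth0.
by rewrite !tnthS tnth_mktuple.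
Qed.

Lemma measurable_map_coord n (phi : 'I_n -> plane -> plane) :
  (forall i, measurable_fun setT (phi i)) ->
  measurable_fun setT (map_coord phi).
Proof.
move=> mphi; apply/measurable_fun_tnthP => i.
rewrite (_ : _ \o _ = fun s => phi i (tnth s i)); last first.
  by apply/funext => s /=; rewrite tnth_mktuple.
by apply: (measurableT_comp (mphi i)); exact: measurable_tnth.
Qed.

Lemma integral_Cn_map_coord n (phi : 'I_n -> plane -> plane)
    (f : n.-tuple plane -> \bar R) :
  (forall i, measurable_fun setT (phi i)) ->
  (forall i (G : plane -> \bar R), measurable_fun setT G ->
    (forall z, 0 <= G z)%E ->
    (\int[mu2]_z G (phi i z) = \int[mu2]_z G z)%E) ->
  measurable_fun setT f -> (forall s, 0 <= f s)%E ->
  integral_Cn (fun s => f (map_coord phi s)) = integral_Cn f.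
Proof.
elim: n phi f => [|n IH] phi f mphi inv mf f0 /=.
  by congr f; apply: eq_from_tnth => -[].
pose G z := integral_Cn (fun s : n.-tuple plane => f [tuple of z :: s]).
rewrite -[RHS](inv ord0 G).
- apply: eq_integral => z _; rewrite /G.
  rewrite -[RHS](IH (fun i => phi (lift ord0 i)) _ (fun i => mphi _)
    (fun i => inv _) (measurable_cons_section (phi ord0 z) mf) (fun s => f0 _)).
  by apply: eq_integral_Cn => s; rewrite map_coord_cons.
- exact: measurable_integral_Cn_cons.
- by move=> z; exact: integral_Cn_ge0.
Qed.

Definition opp_plane (z : plane) : plane :=
  let x : R := z.1 in let y : R := z.2 in (- x, - y).

Definition flip (b : bool) (z : plane) : plane := if b then opp_plane z else z.

(** Written as a product of indicators, it splits along [cons] in the induction on n. *)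
Definition right_half n (s : n.-tuple plane) : R :=
  \prod_(i < n) (0 < ((tnth s i).1 : R))%R%:R.

Lemma measurable_right_half n : measurable_fun setT (@right_half n).
Proof.
apply: measurable_prod => i _.
apply: (@measurableT_comp _ _ _ _ _ _ (fun b : bool => b%:R : R)) => //.
have m1 : measurable_fun setT (fun s : n.-tuple plane => (tnth s i).1 : R).
  by apply: (measurableT_comp measurable_fst2); exact: measurable_tnth.
exact: (measurable_fun_ltr (f := fun=> 0) _ m1).
Qed.

Lemma right_half_ge0 n (s : n.-tuple plane) : 0 <= right_half s.
Proof. by apply: prodr_ge0 => i _. Qed.

(** Each coordinate contributes a factor 2 through [integral_half_plane]. In the induction, [g]
    carries the constraint on all coordinates but the first. *)
Lemma integral_Cn_right_half n (f : n.-tuple plane -> \bar R) :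
  measurable_fun setT f -> (forall s, 0 <= f s)%E ->
  (forall e s, f (map_coord (fun i => flip (e i)) s) = f s) ->
  (integral_Cn f =
   (2 ^+ n)%:E * integral_Cn (fun s => (right_half s)%:E * f s))%E.
Proof.
elim: n f => [|n IH] f mf f0 fs /=.
  by rewrite /right_half big_ord0 !mul1e.
pose g (s : n.+1.-tuple plane) := ((right_half [tuple of behead s])%:E * f s)%E.
have mg : measurable_fun setT g.
  apply: emeasurable_funM => //; apply/measurable_EFinP.
  by apply: (measurableT_comp (@measurable_right_half n));
    exact: measurable_behead.
have g0 s : (0 <= g s)%E by rewrite mule_ge0 // lee_fin right_half_ge0.
pose G z := integral_Cn (fun s : n.-tuple plane => g [tuple of z :: s]).
have mG : measurable_fun setT G by exact: measurable_integral_Cn_cons.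
have G0 z : (0 <= G z)%E by exact: integral_Cn_ge0.
have gE z (s : n.-tuple plane) : g [tuple of z :: s] = ((right_half s)%:E * f [tuple of z :: s])%E.
  have E : [tuple of behead [tuple of z :: s]] = s :> n.-tuple plane.
    exact: val_inj.
  by rewrite /g E.
transitivity (\int[mu2]_z ((2 ^+ n)%:E * G z))%E.
  apply: eq_integral => z _; rewrite IH //.
  - by congr (_ * _)%E; apply: eq_integral_Cn => s; rewrite gE.
  - exact: measurable_cons_section.
  - move=> e s.
    (* The flips of the tail are extended by no flip of the head. *)
    rewrite -[RHS](fs (fun i => if unlift ord0 i is Some j then e j else false)).
    rewrite map_coord_cons unlift_none /=; congr (f [tuple of _ :: _]).
    by apply: eq_from_tnth => i; rewrite !tnth_mktuple liftK.
rewrite ge0_integralZl // (integral_half_plane mG G0); last first.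
  move=> x y; apply: eq_integral_Cn => s; rewrite !gE; congr (_ * _)%E.
  rewrite -(fs (fun i => i == ord0) [tuple of (x, y) :: s]).
  rewrite map_coord_cons eqxx /=; congr (f [tuple of _ :: _]).
  by apply: eq_from_tnth => i; rewrite !tnth_mktuple.
rewrite muleA -EFinM -exprSr; congr (_ * _)%E.
apply: eq_integral => z _; rewrite -integral_CnZl //.
- apply: eq_integral_Cn => s; rewrite gE muleA -EFinM; congr (_%:E * _)%E.
  rewrite /right_half big_ord_recl; congr (_ * _).
  by apply: eq_bigr => i _; rewrite tnthS.
- exact: measurable_cons_section.
Qed.

End IteratedIntegral.

(** * Moments of the Bessel weight *)

Section Moments.
Context {R : realType}.
Local Notation mu := (@lebesgue_measure R).
Local Notation plane := (measurableTypeR R * measurableTypeR R)%type.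
Local Notation mu2 := ((@lebesgue_measure R) \x (@lebesgue_measure R))%E.

Lemma integral_gt0_on d (T : measurableType d) (m : {measure set T -> \bar R})
    (D A : set T) (f : T -> R) (c : R) :
  measurable D -> measurable A -> A `<=` D -> measurable_fun D f ->
  (forall x, D x -> 0 <= f x) -> 0 < c -> (forall x, A x -> c <= f x) ->
  (0 < m A)%E -> (0 < \int[m]_(x in D) (f x)%:E)%E.
Proof.
move=> mD mA AD mf f0 c0 cf mA0.
apply: (@lt_le_trans _ _ (\int[m]_(x in A) (f x)%:E)%E); last first.
  by apply: ge0_subset_integral => //; exact/measurable_EFinP.
apply: (@lt_le_trans _ _ (c%:E * m A)%E); first by rewrite mule_gt0.
rewrite -integral_cst //; apply: ge0_le_integral => //.
- by move=> x _; rewrite lee_fin ltW.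
- by apply/measurable_EFinP; exact: measurable_funS mf.
Qed.

Definition sinh (x : R) : R := (expR x - expR (- x)) / 2.

Lemma cosh_gt0 (x : R) : 0 < cosh x.
Proof. by rewrite /cosh divr_gt0 // addr_gt0 // expR_gt0. Qed.

Lemma cosh2_sinh2 (x : R) : cosh x ^+ 2 - sinh x ^+ 2 = 1.
Proof.
rewrite /cosh /sinh; have : expR x * expR (- x) = 1 by rewrite expRxMexpNx_1.
by move: (expR x) (expR (- x)) => a b ab; rewrite -[RHS]ab; field.
Qed.

Lemma cosh_ge1 (x : R) : 1 <= cosh x.
Proof.
rewrite -(@ler_pXn2r _ 2) ?nnegrE ?ler01 ?(ltW (cosh_gt0 x)) // expr1n.
by have := cosh2_sinh2 x; have := sqr_ge0 (sinh x); lra.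
Qed.

Lemma normr_sinh_le (x : R) : `|sinh x| <= cosh x.
Proof.
rewrite -(@ler_pXn2r _ 2) ?nnegrE ?normr_ge0 ?(ltW (cosh_gt0 x)) //.
by rewrite real_normK ?num_real //; have := cosh2_sinh2 x; lra.
Qed.

Lemma cosh_le_expR (x : R) : 0 <= x -> cosh x <= expR x.
Proof.
move=> x0; have : expR (- x) <= expR x by rewrite ler_expR; lra.
by rewrite /cosh; lra.
Qed.

Lemma expR_le_cosh (x : R) : expR x <= 2 * cosh x.
Proof.
have := expR_gt0 (- x); rewrite /cosh; lra.
Qed.

Global Instance is_derive_cosh (x : R) : is_derive x 1 cosh (sinh x).
Proof.
rewrite /cosh /sinh; apply: is_derive_eq.
by rewrite /GRing.scale /=; field.
Qed.

Global Instance is_derive_sinh (x : R) : is_derive x 1 sinh (cosh x).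
Proof.
rewrite /cosh /sinh; apply: is_derive_eq.
by rewrite /GRing.scale /=; field.
Qed.

Definition sech (x : R) : R := (cosh x)^-1.

Global Instance is_derive_sech (x : R) :
  is_derive x 1 sech (- sinh x * sech x ^+ 2).
Proof.
rewrite /sech; apply: is_derive_eq; first by apply: is_deriveV; rewrite gt_eqF ?cosh_gt0.
rewrite /GRing.scale /=; field; by rewrite gt_eqF ?cosh_gt0.
Qed.

Lemma is_derive_comp_mull (f : R -> R) (v x df : R) :
  is_derive (v * x) 1 f df -> is_derive x 1 (fun t => f (v * t)) (v * df).
Proof.
move=> fdf; have dv : is_derive x 1 ( *%R v) v.
  by apply: is_derive_eq; rewrite /GRing.scale /= mulr1.
by rewrite mulrC; exact: (is_derive1_comp fdf dv).
Qed.

Lemma sech_gt0 (x : R) : 0 < sech x.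
Proof. by rewrite invr_gt0 cosh_gt0. Qed.

Lemma sech_le1 (x : R) : sech x <= 1.
Proof. by rewrite invf_le1 ?cosh_gt0 ?cosh_ge1. Qed.

Lemma sech_le_expR (x : R) : sech x <= 2 * expR (- x).
Proof.
rewrite expRN /sech -[leLHS]mul1r ler_pdivrMr ?cosh_gt0 // mulrAC.
by rewrite ler_pdivlMr ?expR_gt0 // mul1r expR_le_cosh.
Qed.

(** Of the p factors sech x, each at most min(1, 2 exp(-x)), v+1 are enough to beat cosh(vx) <=
    exp(vx) and leave one exp(-x). The bound does not depend on p. *)
Lemma sechX_cosh_le (v p : nat) (x : R) : (v < p)%N -> 0 <= x ->
  sech x ^+ p * cosh (v%:R * x) <= 2 ^+ v.+1 * expR (- x).
Proof.
move=> vp x0; have s0 := ltW (sech_gt0 x).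
apply: (@le_trans _ _ (sech x ^+ v.+1 * expR (v%:R * x))).
  apply: ler_pM; rewrite ?exprn_ge0 ?(ltW (cosh_gt0 _)) //.
    by apply: ler_wiXn2l => //; exact: sech_le1.
  by rewrite cosh_le_expR // mulr_ge0.
apply: (@le_trans _ _ ((2 * expR (- x)) ^+ v.+1 * expR (v%:R * x))).
  rewrite ler_wpM2r ?expR_ge0 //.
  by rewrite lerXn2r ?nnegrE ?mulr_ge0 ?expR_ge0 // sech_le_expR.
rewrite exprMn -mulrA ler_pM2l ?exprn_gt0 // -expRM_natl -expRD ler_expR.
by rewrite -natr1; lra.
Qed.

Local Notation posR := (`[0%R, +oo[%classic : set R).

Lemma integral_expRN :
  (\int[mu]_(t in posR) (expR (- t))%:E = 1)%E.
Proof.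
rewrite (@ge0_continuous_FTC2y _ (fun t => expR (- t)) (fun t => - expR (- t)) 0 0).
- by rewrite oppr0 expR0 -EFinB sub0r opprK.
- by move=> x _; exact: expR_ge0.
- apply: continuous_subspaceT => x; apply: continuous_comp.
    exact: opp_continuous.
  exact: continuous_expR.
- by rewrite -[X in _ --> X]oppr0; apply: cvgN; exact: cvgr_expR.
- by move=> x _; apply: ex_derive.
- apply: cvg_at_right_filter; apply: cvgN; apply: continuous_comp.
    exact: opp_continuous.
  exact: continuous_expR.
- move=> x _; rewrite derive1E; apply: derive_val.
  by apply: is_derive_eq; rewrite /GRing.scale /=; ring.
Qed.

(* Adding [C e^-t] makes the derivative of F nonnegative. *)
Lemma balanced_FTC (f g F : R -> R) (C : R) :
  (forall t, 0 <= t -> 0 <= f t <= C * expR (- t)) ->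
  (forall t, 0 <= t -> 0 <= g t <= C * expR (- t)) ->
  continuous f -> continuous g ->
  (forall t : R, is_derive t 1 F (f t - g t)) -> F 0 = 0 ->
  (forall t, 0 <= t -> `|F t| <= C * expR (- t)) ->
  (\int[mu]_(t in posR) (f t)%:E = \int[mu]_(t in posR) (g t)%:E)%E.
Proof.
move=> f0 g0 cf cg dF F0 FC.
have C0 : 0 <= C.
  by have := FC 0 (lexx _); rewrite oppr0 expR0 mulr1; apply: le_trans.
have cE : continuous (fun t : R => expR (- t)).
  move=> x; apply: continuous_comp; [exact: opp_continuous|exact: continuous_expR].
have cCE : continuous (fun t : R => C * expR (- t)).
  by move=> x; apply: cvgM; [exact: cvg_cst|exact: cE].
have cEy : (C * expR (- x)) @[x --> +oo] --> (0 : R).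
  rewrite -[X in _ --> X](mulr0 C); apply: cvgM; first exact: cvg_cst.
  exact: cvgr_expR.
have iE : (\int[mu]_(t in posR) (C * expR (- t))%:E = C%:E)%E.
  under eq_integral do rewrite EFinM.
  rewrite ge0_integralZl ?lee_fin //.
  - by rewrite integral_expRN mule1.
  - by apply/measurable_EFinP; apply: measurable_funTS;
      exact: continuous_measurable_fun.
pose h t := f t - g t + C * expR (- t).
have ch : continuous h.
  move=> x; apply: cvgD; [apply: cvgB; [exact: cf|exact: cg]|exact: cCE].
have h0 t : 0 <= t -> 0 <= h t.
  by move=> t0; rewrite /h; have := f0 t t0; have := g0 t t0; lra.
pose H t := F t - C * expR (- t).
have dH (t : R) : is_derive t 1 H (h t).
  by rewrite /H; apply: is_derive_eq; rewrite /h /GRing.scale /=; ring.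
have cH : continuous H.
  by move=> x; apply: differentiable_continuous; apply/derivable1_diffP; apply: ex_derive.
have Hy : H x @[x --> +oo] --> (0 : R).
  rewrite -[X in _ --> X]subr0; apply: cvgB => //.
  apply/cvgr0Pnorm_le => e e0; near=> t.
  rewrite (le_trans (FC t _)) //.
  near: t; move/cvgrPdist_le : cEy => /(_ _ e0) [M [Mr HM]].
  exists (Num.max M 0); split; first by rewrite max_real.
  move=> t; rewrite /= gt_max => /andP[Mt _].
  have := HM t Mt; rewrite sub0r normrN; apply: le_trans.
  exact: ler_norm.
have iH : (\int[mu]_(t in posR) (h t)%:E = C%:E)%E.
  rewrite (@ge0_continuous_FTC2y _ h H 0 0) //.
  - by rewrite /H F0 oppr0 expR0 mulr1 sub0r -EFinB sub0r opprK.
  - exact: continuous_subspaceT.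
  - by apply: cvg_at_right_filter; exact: cH.
  - by move=> x _; rewrite derive1E derive_val.
have meas (u : R -> R) : continuous u -> measurable_fun posR (EFin \o u).
  move=> cu; apply/measurable_EFinP; apply: measurable_funTS.
  exact: continuous_measurable_fun.
have sum1 : (\int[mu]_(t in posR) (f t)%:E + C%:E =
             \int[mu]_(t in posR) (g t)%:E + C%:E)%E.
  rewrite -{1}iE -iH -!ge0_integralD //; try exact: meas.
  - apply: eq_integral => t _; rewrite -!EFinD; congr _%:E; rewrite /h; ring.
  - by move=> t /=; rewrite in_itv /= andbT => t0; rewrite lee_fin; case/andP: (g0 t t0).
  - by move=> t /=; rewrite in_itv /= andbT => t0; rewrite lee_fin h0.
  - by move=> t /=; rewrite in_itv /= andbT => t0; rewrite lee_fin; case/andP: (f0 t t0).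
  - by move=> t _; rewrite lee_fin mulr_ge0 ?expR_ge0.
by move: sum1 => /(congr1 (fun x => x - C%:E)%E); rewrite !addeK.
Unshelve. all: end_near. Qed.

Lemma continuous_sech : continuous sech.
Proof.
move=> x; apply: differentiable_continuous; apply/derivable1_diffP.
exact: ex_derive.
Qed.

Lemma continuous_cosh_mull (a : R) : continuous (fun t : R => cosh (a * t)).
Proof.
move=> x; apply: differentiable_continuous; apply/derivable1_diffP.
have d := is_derive_comp_mull (is_derive_cosh (a * x)); exact: ex_derive.
Qed.

Lemma continuous_sechX_cosh (v p : nat) :
  continuous (fun t : R => sech t ^+ p * cosh (v%:R * t)).
Proof.
move=> x; apply: cvgM; last exact: continuous_cosh_mull.
apply: (@continuous_comp _ _ _ sech (fun y : R => y ^+ p)).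
  exact: continuous_sech.
exact: exprn_continuous.
Qed.

(** What remains of the integral representation of K_v in a moment once the plane integral has been
    scaled by cosh t. *)
Definition sech_integral (v p : nat) : \bar R :=
  (\int[mu]_(t in posR) (sech t ^+ p * cosh (v%:R * t))%:E)%E.

Lemma sechX_cosh_ge0 v p t : 0 <= sech t ^+ p * cosh (v%:R * t).
Proof. by rewrite mulr_ge0 ?exprn_ge0 ?(ltW (sech_gt0 _)) ?(ltW (cosh_gt0 _)). Qed.

Lemma integral_CexpRN (C : R) : 0 <= C ->
  (\int[mu]_(t in posR) (C * expR (- t))%:E = C%:E)%E.
Proof.
move=> C0; under eq_integral do rewrite EFinM.
rewrite ge0_integralZl ?lee_fin //; first by rewrite integral_expRN mule1.
apply/measurable_EFinP; apply: measurable_funTS.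
apply: continuous_measurable_fun => x.
apply: (@continuous_comp _ _ _ -%R (@expR R)); first exact: opp_continuous.
exact: continuous_expR.
Qed.

Lemma measurable_continuous_pos (u : R -> R) :
  continuous u -> measurable_fun posR (EFin \o u).
Proof.
move=> cu; apply/measurable_EFinP; apply: measurable_funTS.
exact: continuous_measurable_fun.
Qed.

Lemma continuous_CexpRN (C : R) : continuous (fun t : R => C * expR (- t)).
Proof.
move=> x; apply: cvgM; first exact: cvg_cst.
apply: (@continuous_comp _ _ _ -%R (@expR R)); first exact: opp_continuous.
exact: continuous_expR.
Qed.

Lemma sech_integral_lty v p : (v < p)%N -> (sech_integral v p < +oo)%E.
Proof.
move=> vp; apply: (@le_lt_trans _ _ (2 ^+ v.+1)%:E); last exact: ltry.
rewrite -[leRHS]integral_CexpRN ?exprn_ge0 //; apply: ge0_le_integral => //.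
- by move=> t _; rewrite lee_fin sechX_cosh_ge0.
- by apply: measurable_continuous_pos; exact: continuous_sechX_cosh.
- by apply: measurable_continuous_pos; exact: continuous_CexpRN.
- by move=> t; rewrite /= in_itv /= andbT => t0; rewrite lee_fin sechX_cosh_le.
Qed.

Lemma sech_integral_gt0 v p : (0 < sech_integral v p)%E.
Proof.
apply: (@integral_gt0_on _ _ mu posR `[0%R, 1%R]%classic _ (sech 1 ^+ p)) => //.
- by move=> x /=; rewrite !in_itv /= => /andP[-> _].
- by apply: measurable_funTS; apply: continuous_measurable_fun;
    exact: continuous_sechX_cosh.
- by move=> t _; exact: sechX_cosh_ge0.
- by rewrite exprn_gt0 ?sech_gt0.
- move=> t /=; rewrite in_itv /= => /andP[t0 t1].
  rewrite -[leLHS]mulr1 ler_pM ?exprn_ge0 ?(ltW (sech_gt0 _)) ?cosh_ge1 //.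
  rewrite lerXn2r ?nnegrE ?(ltW (sech_gt0 _)) //.
  rewrite lef_pV2 ?posrE ?cosh_gt0 // /cosh ler_pM2r ?invr_gt0 //.
  have : expR t + expR (- t) <= expR 1 + expR (- 1) :> R.
    rewrite !expRN; set a := expR t; set b := expR 1.
    have a1 : 1 <= a by rewrite -expR0 ler_expR.
    have ab : a <= b by rewrite ler_expR.
    have a0 : 0 < a by lra.
    have b0 : 0 < b by lra.
    rewrite -subr_ge0 (_ : _ - _ = (b - a) * (a * b - 1) / (a * b)); last first.
      by field; rewrite !gt_eqF.
    by rewrite divr_ge0 ?mulr_ge0 ?subr_ge0 ?(ltW a0) ?(ltW b0) // mulr_ege1 //; lra.
  by [].
- have := @lebesgue_measure_itv R `[0%R, 1%R]; rewrite /= lte_fin ltr01 => ->.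
  by rewrite oppr0 adde0 lte01.
Qed.

(** The function is the Wronskian y'w - yw' of y = sech^{p+1} and w = cosh(vt). Its derivative is
    y''w - yw'', where w'' = v^2 w and y'' = (p+1)^2 y - (p+1)(p+2) sech^{p+3}. *)
Lemma is_derive_sech_wronskian v p (t : R) :
  is_derive t 1 (fun t => - p.+1%:R * (sinh t * sech t ^+ p.+2 * cosh (v%:R * t))
            - v%:R * (sech t ^+ p.+1 * sinh (v%:R * t)))
  (((p.+1 ^ 2)%:R - (v ^ 2)%:R) * (sech t ^+ p.+1 * cosh (v%:R * t))
   - (p.+1 * p.+2)%:R * (sech t ^+ p.+3 * cosh (v%:R * t))).
Proof.
have d1 := is_derive_comp_mull (is_derive_cosh (v%:R * t)).
have d2 := is_derive_comp_mull (is_derive_sinh (v%:R * t)).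
have dX q : is_derive t 1 (fun t => sech t ^+ q)
    (q%:R * sech t ^+ q.-1 * (- sinh t * sech t ^+ 2)).
  have := @is_deriveX _ _ sech q t 1 _ (is_derive_sech t).
  by rewrite (_ : sech ^+ q = fun t => sech t ^+ q) //; apply/funext => ?;
    rewrite exprfctE.
have D := is_deriveB (is_deriveZ (- p.+1%:R)
    (is_deriveM (is_deriveM (is_derive_sinh t) (dX p.+2)) d1))
  (is_deriveZ v%:R (is_deriveM (dX p.+1) d2)).
apply: (is_derive_eq D); rewrite /GRing.scale /= mulrfctE.
have cq : cosh t * sech t = 1 by rewrite mulfV ?gt_eqF ?cosh_gt0.
have r2 : sinh t ^+ 2 * sech t ^+ 2 = 1 - sech t ^+ 2.
  have : cosh t ^+ 2 * sech t ^+ 2 = 1 by rewrite -exprMn cq expr1n.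
  have -> : cosh t ^+ 2 = 1 + sinh t ^+ 2 by have := cosh2_sinh2 t; lra.
  by rewrite mulrDl mul1r; lra.
move: (cosh t) (sinh t) (sech t) (cosh (_ * _)) (sinh (_ * _)) cq r2.
move=> c s q cv sv cq r2; rewrite !natrX !natrM !exprS expr0.
(* The combination of the relations cq = 1 and s^2 q^2 = 1 - q^2 by which the two sides differ;
   adding it leaves a polynomial identity. *)
have z : - p.+1%:R * q ^+ p.+1 * cv * (c * q - 1) +
    p.+1%:R * p.+2%:R * q ^+ p.+1 * cv * (s ^+ 2 * q ^+ 2 - (1 - q ^+ 2)) = 0.
  by rewrite cq r2; ring.
rewrite -[RHS]addr0 -z !exprS expr0.
rewrite -!natr1.
ring.
Qed.

(** The Wronskian vanishes at 0 and decays at infinity, so its derivative has integral zero. The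
    hypothesis makes both integrals finite and the left coefficient nonnegative. *)
Lemma sech_integral_rec v p : (v < p)%N ->
  (((p ^ 2)%:R - (v ^ 2)%:R)%:E * sech_integral v p =
   (p * p.+1)%:R%:E * sech_integral v p.+2 :> \bar R)%E.
Proof.
move=> vp; have p0 : (0 < p)%N by exact: leq_ltn_trans vp.
pose a : R := (p ^ 2)%:R - (v ^ 2)%:R; pose b : R := (p * p.+1)%:R.
have a0 : 0 <= a by rewrite subr_ge0 ler_nat leq_sqr ltnW.
have b0 : 0 <= b by [].
pose f t := a * (sech t ^+ p * cosh (v%:R * t)).
pose g t := b * (sech t ^+ p.+2 * cosh (v%:R * t)).
pose F t := - p%:R * (sinh t * sech t ^+ p.+1 * cosh (v%:R * t))
            - v%:R * (sech t ^+ p * sinh (v%:R * t)).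
pose K : R := 2 ^+ v.+1; have K0 : 0 < K by rewrite exprn_gt0.
(* One constant for the three bounds that [balanced_FTC] asks for: a and b serve the integrands, p +
   v the Wronskian. *)
pose C := (a + b + p%:R + v%:R) * K.
have ce q := @continuous_sechX_cosh v q.
rewrite /sech_integral -!ge0_integralZl ?lee_fin //; last 4 first.
- by apply: measurable_continuous_pos; exact: ce.
- by move=> t _; rewrite lee_fin sechX_cosh_ge0.
- by apply: measurable_continuous_pos; exact: ce.
- by move=> t _; rewrite lee_fin sechX_cosh_ge0.
under eq_integral do rewrite -EFinM; under [RHS]eq_integral do rewrite -EFinM.
have q0 t := sech_gt0 t.
apply: (@balanced_FTC f g F C).
- move=> t t0; rewrite mulr_ge0 ?sechX_cosh_ge0 //=.
  apply: (@le_trans _ _ (a * (K * expR (- t)))).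
    by rewrite ler_wpM2l // sechX_cosh_le.
  rewrite mulrA ler_wpM2r ?expR_ge0 // ler_wpM2r ?(ltW K0) //.
  by move: (ler0n R p) (ler0n R v) a0 b0; lra.
- move=> t t0; rewrite mulr_ge0 ?sechX_cosh_ge0 //=.
  apply: (@le_trans _ _ (b * (K * expR (- t)))).
    by rewrite ler_wpM2l // sechX_cosh_le // ltnW // ltnW.
  rewrite mulrA ler_wpM2r ?expR_ge0 // ler_wpM2r ?(ltW K0) //.
  by move: (ler0n R p) (ler0n R v) a0 b0; lra.
- by move=> x; apply: cvgM; [exact: cvg_cst|exact: ce].
- by move=> x; apply: cvgM; [exact: cvg_cst|exact: ce].
- move=> t.
  rewrite /F /f /g /a /b -(prednK p0).
  exact: is_derive_sech_wronskian.
- have sh0 : sinh 0 = 0 by rewrite /sinh oppr0 subrr mul0r.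
  by rewrite /F (mulr0 v%:R) sh0 !mul0r !mulr0 subr0.
- move=> t t0; rewrite /F.
  have e0 : 0 <= v%:R * t by rewrite mulr_ge0.
  have X0 : 0 <= sech t ^+ p by rewrite exprn_ge0 // ltW.
  have sq : `|sinh t| * sech t <= 1.
    by rewrite ler_pdivrMr ?cosh_gt0 // mul1r normr_sinh_le.
  have Kp := sechX_cosh_le vp t0.
  apply: (@le_trans _ _ (p%:R * (sech t ^+ p * cosh (v%:R * t)) +
                         v%:R * (sech t ^+ p * cosh (v%:R * t)))).
    apply: (le_trans (ler_normB _ _)); rewrite (normrM (- p%:R)) normrN.
    rewrite (normrM v%:R) !normr_nat (normrM (sinh t * _)) (normrM (sinh t)).
    rewrite (normrM (sech t ^+ p)).
    rewrite !(ger0_norm (exprn_ge0 _ (ltW (q0 t)))) (gtr0_norm (cosh_gt0 _)).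
    apply: lerD; rewrite ler_wpM2l // ?ler_wpM2l ?normr_sinh_le //.
    rewrite exprS mulrA ler_wpM2r ?(ltW (cosh_gt0 _)) // ler_piMl //.
  rewrite -mulrDl; apply: (@le_trans _ _ ((p%:R + v%:R) * (K * expR (- t)))).
    by rewrite ler_wpM2l // addr_ge0.
  rewrite mulrA ler_wpM2r ?expR_ge0 // ler_wpM2r ?(ltW K0) //.
  by move: (ler0n R p) (ler0n R v) a0 b0; lra.
Qed.

End Moments.

(** * Roots of unity and the averaged Vandermonde determinant *)

Section RootsOfUnity.
Context {R : realType}.
Local Notation norm := (@ComplexField.Normc.normc R).

Definition cis (x : R) : R[i] := cos x +i* sin x.

Lemma cis0 : cis 0 = 1.
Proof. by rewrite /cis cos0 sin0. Qed.

Lemma cisD x y : cis (x + y) = cis x * cis y.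
Proof.
rewrite /cis cosD sinD; apply/eqP; rewrite eq_complex /=.
by rewrite [X in _ && (X == _)]addrC !eqxx.
Qed.

Lemma cisX x k : cis x ^+ k = cis (x * k%:R).
Proof.
elim: k => [|k IH]; first by rewrite expr0 mulr0 cis0.
by rewrite exprS IH -cisD -natr1 mulrDr mulr1 addrC.
Qed.

Lemma norm_cis x : norm (cis x) = 1.
Proof. by rewrite /cis /= cos2Dsin2 sqrtr1. Qed.

(** The square of [cis (pi / n)] is a primitive n-th root of unity: cos 2y = 1 would force sin y =
    0, impossible for 0 < y < pi. *)
Lemma cis_pi_div (n d : nat) : (0 < d < n)%N ->
  cis (pi / n%:R) ^+ (2 * d) != 1.
Proof.
move=> /andP[d0 dn]; have n0 : (0 : R) < n%:R.
  by rewrite ltr0n (leq_ltn_trans _ dn).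
rewrite cisX; apply/eqP => /eqP; rewrite eq_complex /= => /andP[/eqP + _].
set y := pi * d%:R / n%:R : R.
have -> : pi / n%:R * (2 * d)%:R = y *+ 2.
  by rewrite natrM /y -mulr_natl; field; rewrite gt_eqF.
rewrite cos_mulr2n => h.
have y0 : 0 < y by rewrite divr_gt0 // mulr_gt0 ?pi_gt0 ?ltr0n.
have yp : y < pi by rewrite /y ltr_pdivrMr // ltr_pM2l ?pi_gt0 // ltr_nat.
have /eqP : sin y ^+ 2 = 0 by rewrite sin2cos2; lra.
by rewrite sqrf_eq0 gt_eqF // sin_gt0_pi ?y0.
Qed.

Lemma cis_pi_div_period (n : nat) : (0 < n)%N ->
  cis (pi / n%:R) ^+ (2 * n) = 1.
Proof.
move=> n0; rewrite cisX natrM.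
have -> : pi / n%:R * (2 * n%:R) = pi *+ 2 :> R.
  by rewrite -mulr_natl; field; rewrite pnatr_eq0 -lt0n.
by rewrite /cis cos2pi sin2pi.
Qed.

Lemma sum_expr_root (u : R[i]) N : u ^+ N = 1 -> u != 1 ->
  \sum_(e < N) u ^+ e = 0.
Proof.
move=> uN u1; apply: (@mulfI _ (u - 1)); first by rewrite subr_eq0.
by rewrite mulr0 -subrX1 uN subrr.
Qed.

Lemma normc_realE (x : R[i]) : (norm x)%:C = `|x|.
Proof. by []. Qed.

(* Leibniz expansion of the Vandermonde determinant; by orthogonality of the
   characters of the group of roots of unity only the diagonal terms survive
   the average. *)
Lemma sum_rotated_Vandermonde (n : nat) (z : 'I_n -> R[i]) :
  (0 < n)%N ->
  \sum_(e : {ffun 'I_n -> 'I_(2 * n)})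
    \prod_(j < n) \prod_(k < n | (j < k)%N)
      norm ((cis (pi / n%:R) ^+ e j * z j) ^+ 2
            - (cis (pi / n%:R) ^+ e k * z k) ^+ 2) ^+ 2 =
  (2 * n)%:R ^+ n * \sum_(s : 'S_n) \prod_(j < n) norm (z j) ^+ (4 * s j).
Proof.
move=> n0; set eta := cis (pi / n%:R).
have eta1 : `|eta| = 1 by rewrite -normc_realE norm_cis.
have etac : eta * Num.conj eta = 1 by rewrite -normCK eta1 expr1n.
have etaN : eta ^+ (2 * n) = 1 by exact: cis_pi_div_period.
pose a (e : {ffun 'I_n -> 'I_(2 * n)}) j := (eta ^+ e j * z j) ^+ 2.
pose D e := \det (Vandermonde n (\row_j a e j)).
have DE (e : {ffun 'I_n -> 'I_(2 * n)}) : D e = \sum_(s : 'S_n) (-1) ^+ s * \prod_(j < n) a e j ^+ s j.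
  rewrite /D -det_tr /determinant; apply: eq_bigr => s _; congr (_ * _).
  by apply: eq_bigr => j _; rewrite !mxE.
have lhsE (e : {ffun 'I_n -> 'I_(2 * n)}) : (\prod_(j < n) \prod_(k < n | (j < k)%N)
    norm ((eta ^+ e j * z j) ^+ 2 - (eta ^+ e k * z k) ^+ 2) ^+ 2)%:C =
    D e * Num.conj (D e).
  rewrite -normCK /D det_Vandermonde normr_prod -prodrXl rmorph_prod.
  apply: eq_bigr => j _; rewrite normr_prod -prodrXl rmorph_prod.
  by apply: eq_bigr => k _; rewrite rmorphXn /= normc_realE !mxE distrC.
apply: (@fmorph_inj _ _ (real_complex R)).
rewrite rmorph_sum /=; under eq_bigr do rewrite lhsE.
rewrite rmorphM rmorphXn rmorph_nat rmorph_sum /=.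
(* The factor of coordinate j in the Leibniz term of two permutations s and t, for p = s j and q = t
   j. Its sum over e is geometric. *)
pose b j (p q : nat) (e : nat) : R[i] :=
  (eta ^+ (2 * p) * (Num.conj eta) ^+ (2 * q)) ^+ e * (z j ^+ (2 * p) * Num.conj (z j) ^+ (2 * q)).
have bE j p q : \sum_(e < 2 * n) b j p q e =
    (\sum_(e < 2 * n) (eta ^+ (2 * p) * (Num.conj eta) ^+ (2 * q)) ^+ e) *
    (z j ^+ (2 * p) * Num.conj (z j) ^+ (2 * q)) by rewrite mulr_suml.
have uE p q : (p <= q)%N -> eta ^+ (2 * p) * (Num.conj eta) ^+ (2 * q) =
    (Num.conj eta) ^+ (2 * (q - p)).
  move=> pq; rewrite -[in LHS](subnK pq) mulnDr exprD mulrCA mulrC -exprMn.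
  by rewrite etac expr1n mul1r.
have uE' p q : (p <= q)%N -> eta ^+ (2 * q) * (Num.conj eta) ^+ (2 * p) =
    eta ^+ (2 * (q - p)).
  move=> pq; rewrite -[in LHS](subnK pq) mulnDr exprD -mulrA -exprMn.
  by rewrite etac expr1n mulr1.
have uN p q : (eta ^+ (2 * p) * (Num.conj eta) ^+ (2 * q)) ^+ (2 * n) = 1.
  rewrite exprMn -!exprM (mulnC (2 * p)%N) (mulnC (2 * q)%N).
  by rewrite !(exprM _ (2 * n)) -rmorphXn etaN rmorph1 !expr1n mulr1.
(* Since 0 < |p - q| < n, the ratio of the geometric sum is a root of unity other than 1. *)
have b0 j (p q : 'I_n) : p != q -> \sum_(e < 2 * n) b j p q e = 0.
  move=> pq; rewrite bE sum_expr_root ?mul0r //.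
  have [lt|lt|/val_inj E] := ltngtP p q; last by rewrite E eqxx in pq.
    rewrite uE 1?ltnW // -rmorphXn; apply/eqP => /(congr1 Num.conj).
    rewrite conjCK rmorph1 => /eqP; apply/negP; apply: cis_pi_div.
    by rewrite subn_gt0 lt /= (leq_ltn_trans (leq_subr _ _)).
  rewrite uE' 1?ltnW //; apply: cis_pi_div.
  by rewrite subn_gt0 lt /= (leq_ltn_trans (leq_subr _ _)).
have b1 j (p : nat) : \sum_(e < 2 * n) b j p p e =
    (2 * n)%:R * (norm (z j) ^+ (4 * p))%:C.
  rewrite bE uE // subnn muln0 expr0; congr (_ * _).
    by under eq_bigr do rewrite expr1n; rewrite sumr_const card_ord.
  rewrite -exprMn -normCK -exprM rmorphXn /= normc_realE; congr (_ ^+ _).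
  by rewrite mulnA.
(* Summing over all functions e factorises into independent sums over each e j. Two distinct
   permutations differ at some j, whose factor vanishes. *)
transitivity (\sum_(s : 'S_n) \sum_(t : 'S_n) (-1) ^+ s * (-1) ^+ t *
    \prod_(j < n) \sum_(e < 2 * n) b j (s j) (t j) e).
  under eq_bigr => e _.
    rewrite DE rmorph_sum /= big_distrlr /=.
    over.
  rewrite exchange_big /=; apply: eq_bigr => s _.
  rewrite exchange_big /=; apply: eq_bigr => t _.
  rewrite bigA_distr_bigA /= mulr_sumr; apply: eq_bigr => e _.
  rewrite rmorphM rmorph_sign rmorph_prod /= mulrACA; congr (_ * _).
  rewrite -big_split /=; apply: eq_bigr => j _.
  rewrite /a /b !rmorphXn !rmorphM /= !rmorphXn -!exprM.
  rewrite !exprMn -!exprM mulrACA; congr (_ * _).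
  by congr (_ ^+ _ * _ ^+ _); rewrite mulnC.
rewrite mulr_sumr; apply: eq_bigr => s _.
rewrite (bigD1 s) //= [X in _ + X]big1 ?addr0.
  rewrite -exprD addnn -mul2n exprM sqrrN expr1n expr1n mul1r.
  under eq_bigr do rewrite b1.
  by rewrite big_split /= prodr_const card_ord rmorph_prod.
move=> t ts; have [j sj] : exists j, s j != t j.
  apply/existsP; apply: contraNT ts => /existsPn h; apply/eqP/permP => j.
  by have /negbNE/eqP -> := h j.
by rewrite (bigD1 j) //= b0 // mul0r mulr0.
Qed.

End RootsOfUnity.

(** * Gaussian moments and the recursion for the moments of the weight *)

Section BesselMoments.
Context {R : realType}.
Local Notation mu := (@lebesgue_measure R).
Local Notation plane := (measurableTypeR R * measurableTypeR R)%type.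
Local Notation mu2 := ((@lebesgue_measure R) \x (@lebesgue_measure R))%E.
Local Notation posR := (`[0%R, +oo[%classic : set R).
Local Notation norm := (@ComplexField.Normc.normc R).

Definition sqn (z : plane) : R := let x : R := z.1 in let y : R := z.2 in
  x ^+ 2 + y ^+ 2.

Lemma sqn_ge0 z : 0 <= sqn z.
Proof. by rewrite addr_ge0 ?sqr_ge0. Qed.

Lemma measurable_sqn : measurable_fun setT sqn.
Proof.
apply: measurable_funD; apply: measurable_funX.
- exact: measurable_fst2.
- exact: measurable_snd2.
Qed.

Lemma norm2E (z : plane) : norm (complex_of_plane z) ^+ 2 = sqn z.
Proof. by rewrite /= sqr_sqrtr // addr_ge0 ?sqr_ge0. Qed.

Lemma integral_indicl d (T : measurableType d) (m : {measure set T -> \bar R})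
  (D : set T) (f : T -> \bar R) :
  (\int[m]_(x in D) f x = \int[m]_x ((\1_D x)%:E * f x))%E.
Proof.
rewrite integral_mkcond; apply: eq_integral => x _.
by rewrite patchE indicE; case: ifPn => _; rewrite ?mul1e ?mul0e.
Qed.

(** The variable t is exchanged with the two real coordinates of z in turn. *)
Lemma plane_tonelli_swap (G : plane * measurableTypeR R -> \bar R) :
  measurable_fun setT G -> (forall u, 0 <= G u)%E ->
  (\int[mu2]_z \int[mu]_t G (z, t) = \int[mu]_t \int[mu2]_z G (z, t))%E.
Proof.
move=> mG G0.
have m1 : measurable_fun setT (fun z => \int[mu]_t G (z, t))%E.
  exact: (measurable_fun_fubini_tonelli_F _ mG G0).
rewrite plane_tonelli1 //; last by move=> z; exact: integral_ge0.
pose H (u : measurableTypeR R * measurableTypeR R) : \bar R :=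
  (\int[mu]_y G ((u.1, y), u.2))%E.
have mH : measurable_fun setT H.
  pose G' (w : (measurableTypeR R * measurableTypeR R) * measurableTypeR R) :=
    G ((w.1.1, w.2), w.1.2).
  have mG' : measurable_fun setT G'.
    apply: (measurableT_comp mG); apply: measurable_fun_pair.
      by apply: measurable_fun_pair => //; exact: measurableT_comp.
    exact: measurableT_comp.
  exact: (measurable_fun_fubini_tonelli_F _ mG' (fun u => G0 _)).
have H0 u : (0 <= H u)%E by exact: integral_ge0.
transitivity (\int[mu]_x \int[mu]_t H (x, t))%E.
  apply: eq_integral => x _; rewrite /H /=.
  have mGx : measurable_fun setT
      (fun u : measurableTypeR R * measurableTypeR R => G ((x, u.1), u.2)).
    apply: (measurableT_comp mG); apply: measurable_fun_pair => //.
    exact: measurable_fun_pair.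
  exact: (fubini_tonelli _ mGx (fun u => G0 _)).
rewrite (fubini_tonelli _ mH H0); apply: eq_integral => t _.
rewrite plane_tonelli1 //.
by apply: (measurableT_comp mG); exact: measurable_fun_pair.
Qed.

Definition bessel_integrand (v : nat) (x t : R) : R :=
  expR (- x * cosh t) * cosh (v%:R * t).

Lemma bessel_integrand_ge0 v x t : 0 <= bessel_integrand v x t.
Proof. by rewrite mulr_ge0 ?expR_ge0 ?(ltW (cosh_gt0 _)). Qed.

Lemma measurable_cosh : measurable_fun setT (@cosh R).
Proof.
apply: continuous_measurable_fun => x.
apply: differentiable_continuous; apply/derivable1_diffP; exact: ex_derive.
Qed.

Lemma measurable_bessel_integrand (v : nat) :
  measurable_fun setT (fun u : measurableTypeR R * measurableTypeR R =>
    bessel_integrand v u.1 u.2).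
Proof.
have m1 : measurable_fun setT
    (fun u : measurableTypeR R * measurableTypeR R => - (u.1 : R) * cosh u.2).
  apply: measurable_funM.
    by apply: measurable_funN; exact: measurable_fst2.
  by apply: (measurableT_comp measurable_cosh); exact: measurable_snd.
have m2 : measurable_fun setT
    (fun u : measurableTypeR R * measurableTypeR R => v%:R * (u.2 : R)).
  by apply: measurable_funM => //; exact: measurable_snd.
apply: measurable_funM.
  exact: (measurableT_comp (@measurable_expR R) m1).
exact: (measurableT_comp measurable_cosh m2).
Qed.

(** One term of the exponential series, exp(y) >= y^{v+1}/(v+1)! at y = x cosh t, yields enough
    powers of sech t for [sechX_cosh_le]. *)
Lemma bessel_integrand_le (v : nat) (x t : R) : 0 < x -> 0 <= t ->
  bessel_integrand v x t <=
  (v.+1)`!%:R / x ^+ v.+1 * (2 ^+ v.+1) * expR (- t).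
Proof.
move=> x0 t0; have c0 := cosh_gt0 t.
have h : expR (- x * cosh t) <= v.+1`!%:R / x ^+ v.+1 * sech t ^+ v.+1.
  rewrite mulNr expRN -[leLHS]mul1r ler_pdivrMr ?expR_gt0 //.
  have := @expR_ge1Dxn R (x * cosh t) v.
  move=> /(_ (mulr_ge0 (ltW x0) (ltW c0))) E.
  apply: (@le_trans _ _ (v.+1`!%:R / x ^+ v.+1 * sech t ^+ v.+1 *
     ((x * cosh t) ^+ v.+1 / v.+1`!%:R))).
    rewrite /sech exprVn [(x * cosh t) ^+ _]exprMn le_eqVlt; apply/orP; left; apply/eqP.
    have X0 : x ^+ v.+1 != 0 by rewrite expf_neq0 ?gt_eqF.
    have C0 : cosh t ^+ v.+1 != 0 by rewrite expf_neq0 ?gt_eqF.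
    have f0 : v.+1`!%:R != 0 :> R by rewrite pnatr_eq0 -lt0n fact_gt0.
    move: (x ^+ _) (cosh t ^+ _) (v.+1`!%:R) X0 C0 f0 => X Y f X0 Y0 f0.
    by field; rewrite X0 Y0 f0.
  rewrite ler_wpM2l ?mulr_ge0 ?invr_ge0 ?exprn_ge0 ?(ltW x0) ?(ltW (sech_gt0 t)) //.
  by apply: le_trans E; rewrite lerDr.
rewrite /bessel_integrand -[leRHS]mulrA.
apply: (@le_trans _ _ (v.+1`!%:R / x ^+ v.+1 * sech t ^+ v.+1 * cosh (v%:R * t))).
  by rewrite ler_wpM2r // ltW // cosh_gt0.
rewrite -mulrA ler_wpM2l ?mulr_ge0 ?invr_ge0 ?exprn_ge0 ?(ltW x0) //.
exact: sechX_cosh_le.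
Qed.

(** The extended-real integral of which [besselK] is the finite part. It is finite for x > 0 and
    diverges at x = 0. *)
Definition ebesselK (v : nat) (x : R) : \bar R :=
  (\int[mu]_(t in posR) (bessel_integrand v x t)%:E)%E.

Lemma measurable_section_bessel v x :
  measurable_fun setT (bessel_integrand v x).
Proof.
have mp : measurable_fun setT (fun t : R => (x, t) : plane).
  exact: measurable_pair2.
exact: (measurableT_comp (measurable_bessel_integrand v) mp).
Qed.

Lemma ebesselK_fin (v : nat) (x : R) : 0 < x -> ebesselK v x \is a fin_num.
Proof.
move=> x0; rewrite ge0_fin_numE; last first.
  by apply: integral_ge0 => t _; rewrite lee_fin bessel_integrand_ge0.
set K := v.+1`!%:R / x ^+ v.+1 * 2 ^+ v.+1 : R.
have K0 : 0 <= K by rewrite !mulr_ge0 ?invr_ge0 ?exprn_ge0 // ltW.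
apply: (@le_lt_trans _ _ K%:E); last exact: ltry.
rewrite -[leRHS]integral_CexpRN //; apply: ge0_le_integral => //.
- by move=> t _; rewrite lee_fin bessel_integrand_ge0.
- by apply/measurable_EFinP; apply: measurable_funTS; exact: measurable_section_bessel.
- by apply: measurable_continuous_pos; exact: continuous_CexpRN.
- by move=> t; rewrite /= in_itv /= andbT => t0; rewrite lee_fin bessel_integrand_le.
Qed.

Lemma besselKE v x : 0 < x -> (besselK v x)%:E = ebesselK v x.
Proof. by move=> x0; rewrite -(fineK (ebesselK_fin v x0)). Qed.

Lemma besselK_ge0 v (x : R) : 0 <= besselK v x.
Proof.
by apply: Rintegral_ge0 => t _; exact: bessel_integrand_ge0.
Qed.

Lemma measurable_besselK v : measurable_fun setT (@besselK R v).
Proof.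
rewrite (_ : besselK v = fine \o ebesselK v) //.
apply: measurableT_comp; first exact: fine_measurable.
pose G (u : measurableTypeR R * measurableTypeR R) : \bar R :=
  ((\1_posR (u.2 : R))%:E * (bessel_integrand v u.1 u.2)%:E)%E.
have mG : measurable_fun setT G.
  apply: emeasurable_funM; apply/measurable_EFinP.
    apply: (@measurableT_comp _ _ _ _ _ _ (\1_posR : R -> R)) => //.
  exact: measurable_bessel_integrand.
have G0 u : (0 <= G u)%E by rewrite mule_ge0 // lee_fin bessel_integrand_ge0.
have := @measurable_fun_fubini_tonelli_F _ _ _ _ R mu G mG G0.
congr measurable_fun; apply/funext => x; rewrite /ebesselK integral_indicl //.
Qed.

Definition gauss_moment (a : nat) (b : R) : \bar R :=
  (\int[mu2]_z (sqn z ^+ a * expR (- (b * sqn z)))%:E)%E.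

Lemma measurable_sqn_gauss a : measurable_fun setT
  (fun u : plane * measurableTypeR R =>
    sqn u.1 ^+ a * expR (- ((u.2 : R) * sqn u.1))).
Proof.
have m1 : measurable_fun setT (fun u : plane * measurableTypeR R => sqn u.1).
  by apply: (measurableT_comp measurable_sqn); exact: measurable_fst.
have m2 : measurable_fun setT
    (fun u : plane * measurableTypeR R => - ((u.2 : R) * sqn u.1)).
  by apply: measurable_funN; apply: measurable_funM => //; exact: measurable_snd.
apply: measurable_funM; first exact: measurable_funX.
exact: (measurableT_comp (@measurable_expR R) m2).
Qed.

Lemma sqn_gauss_ge0 a (b : R) z : 0 <= sqn z ^+ a * expR (- (b * sqn z)).
Proof. by rewrite mulr_ge0 ?expR_ge0 // exprn_ge0 // sqn_ge0. Qed.

Lemma measurable_sqn_gauss_b a (b : R) : measurable_fun setT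
  (fun z : plane => sqn z ^+ a * expR (- (b * sqn z))).
Proof.
have mp : measurable_fun setT
    (fun z : plane => (z, b) : plane * measurableTypeR R).
  exact: measurable_fun_pair.
exact: (measurableT_comp (measurable_sqn_gauss a) mp).
Qed.

(** Substituting sqrt(b) z, the area element contributes one power of b and |z|^{2a} the other a. *)
Lemma gauss_moment_scale a (b : R) : 0 < b ->
  ((b ^+ a.+1)%:E * gauss_moment a b = gauss_moment a 1)%E.
Proof.
move=> b0; rewrite /gauss_moment.
have c0 : 0 < Num.sqrt b by rewrite sqrtr_gt0.
rewrite -[RHS](integral_scale2 c0); last 2 first.
- by apply/measurable_EFinP; exact: measurable_sqn_gauss_b.
- by move=> z; rewrite lee_fin sqn_gauss_ge0.
rewrite (sqr_sqrtr (ltW b0)) exprS EFinM -[LHS]muleA; congr (_ * _)%E.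
rewrite -ge0_integralZl //; last 3 first.
- by apply/measurable_EFinP; exact: measurable_sqn_gauss_b.
- by move=> z _; rewrite lee_fin sqn_gauss_ge0.
- by rewrite lee_fin exprn_ge0 // ltW.
apply: eq_integral => -[x y] _; rewrite -EFinM; congr _%:E.
have -> : sqn (lin2 (Num.sqrt b) 0 0 (Num.sqrt b) (x, y)) = b * sqn (x, y).
  rewrite /sqn /lin2 /= !mul0r addr0 add0r !exprMn sqr_sqrtr ?(ltW b0) //.
  by rewrite mulrDr.
by rewrite mul1r exprMn mulrA.
Qed.

Lemma integral_expR_tail (s : R) : 0 < s ->
  (\int[mu]_(b in `[1%R, +oo[%classic) (expR (- (b * s)))%:E
   = (expR (- s) / s)%:E)%E.
Proof.
move=> s0.
have cE : continuous (fun b : R => expR (- (b * s))).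
  move=> x; apply: (@continuous_comp _ _ _ (fun b : R => - (b * s)) (@expR R)).
    by apply: cvgN; apply: cvgM; [exact: cvg_id|exact: cvg_cst].
  exact: continuous_expR.
have dF (x : R) : is_derive x 1 (fun b => - s^-1 * expR (- (b * s)))
    (expR (- (x * s))).
  by apply: is_derive_eq; rewrite /GRing.scale /=; field; rewrite gt_eqF.
rewrite (@ge0_continuous_FTC2y _ _ (fun b => - s^-1 * expR (- (b * s))) 1 0).
- by rewrite mul1r -EFinB sub0r mulNr opprK mulrC.
- by move=> x _; exact: expR_ge0.
- exact: continuous_subspaceT.
- rewrite -[X in _ --> X](mulr0 (- s^-1)); apply: cvgM; first exact: cvg_cst.
  apply: (@cvg_comp _ _ _ (fun b : R => b * s) (fun y => expR (- y)) _ +oo).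
    exact: gt0_cvgMly.
  exact: cvgr_expR.
- by move=> x _; apply: ex_derive.
- apply: cvg_at_right_filter; apply: cvgM; first exact: cvg_cst.
  exact: cE.
- by move=> x _; rewrite derive1E derive_val.
Qed.

Lemma continuous_within_invX (m : nat) :
  {within `[1%R, +oo[, continuous (fun b : R => b^-1 ^+ m)}.
Proof.
apply: continuous_in_subspaceT => x; rewrite inE /= in_itv /= andbT => x1.
have x0 : x != 0 by rewrite gt_eqF // (lt_le_trans _ x1).
apply: (@continuous_comp _ _ _ (fun b : R => b^-1) (fun y => y ^+ m)).
  exact: inv_continuous.
exact: exprn_continuous.
Qed.

Lemma integral_invX_tail (a : nat) :
  (\int[mu]_(b in `[1%R, +oo[%classic) (b^-1 ^+ a.+2)%:E
   = (a.+1%:R^-1)%:E :> \bar R)%E.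
Proof.
have dV (x : R) : 1 <= x -> is_derive x 1 (fun b => b^-1) (- x^-1 ^+ 2).
  move=> x1; have x0 : x != 0 by rewrite gt_eqF // (lt_le_trans _ x1).
  have := @is_deriveV R (fun y : R => y) x 1 1 x0 (is_derive_id x 1).
  by move=> h; apply: (is_derive_eq h); rewrite /GRing.scale /= exprVn mulr1.
have dF (x : R) : 1 <= x ->
    is_derive x 1 (fun b => - a.+1%:R^-1 * b^-1 ^+ a.+1) (x^-1 ^+ a.+2).
  move=> x1; have h := is_deriveZ (- a.+1%:R^-1) (is_deriveX a.+1 (dV x x1)).
  have -> : (fun b => - a.+1%:R^-1 * b^-1 ^+ a.+1) =
      (- a.+1%:R^-1 \*: (fun b : R => b^-1) ^+ a.+1).
    by apply/funext => y /=; rewrite exprfctE.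
  apply: (is_derive_eq h); rewrite /GRing.scale /=.
  rewrite [in RHS]exprS [in RHS]exprS expr2.
  move: (x^-1) (x^-1 ^+ a) => u w; field.
  by rewrite ?natr1 ?nat1r pnatr_eq0.
rewrite (@ge0_continuous_FTC2y _ _ (fun b => - a.+1%:R^-1 * b^-1 ^+ a.+1) 1 0).
- by rewrite invr1 expr1n mulr1 -EFinB sub0r opprK.
- by move=> x x1; rewrite exprn_ge0 // invr_ge0 (le_trans _ x1).
- exact: continuous_within_invX.
- rewrite -[X in _ --> X](mulr0 (- a.+1%:R^-1)); apply: cvgM; first exact: cvg_cst.
  rewrite (_ : (fun x : R => x^-1 ^+ a.+1) = fun x => x^-1 * x^-1 ^+ a); last first.
    by apply/funext => x; rewrite exprS.
  apply/cvgr0Pnorm_le => e e0; near=> x.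
  have x1 : 1 <= x by near: x; apply: nbhs_pinfty_ge; rewrite num_real.
  have xe : e^-1 <= x by near: x; apply: nbhs_pinfty_ge; rewrite num_real.
  have x0 : 0 < x by exact: (lt_le_trans _ x1).
  have i0 : 0 <= x^-1 by rewrite invr_ge0 ltW.
  rewrite ger0_norm ?mulr_ge0 ?exprn_ge0 //.
  apply: (@le_trans _ _ x^-1).
    by rewrite ler_piMr // exprn_ile1 // invf_le1.
  by rewrite -[e]invrK lef_pV2 ?posrE ?invr_gt0.
- by move=> x x1; have h := dF x (ltW x1); apply: ex_derive.
- apply: cvg_at_right_filter; apply: cvgM; first exact: cvg_cst.
  apply: (@continuous_comp _ _ _ (fun b : R => b^-1) (fun y => y ^+ a.+1)).
    exact: inv_continuous.
  exact: exprn_continuous.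
- move=> x; rewrite in_itv /= andbT => x1; have h := dF x (ltW x1).
  by rewrite derive1E derive_val.
Unshelve. all: end_near. Qed.

(* Integrate [gauss_moment a.+1 b] over [b >= 1] in two ways: by scaling in b,
   and by exchanging the two integrals. *)
Lemma gauss_moment_rec a : (0 < a)%N ->
  (gauss_moment a.+1 1 = a.+1%:R%:E * gauss_moment a 1)%E.
Proof.
move=> a0; set B := (`[1%R, +oo[%classic : set R).
have mB : measurable (B : set (measurableTypeR R)) by exact: measurable_itv.
pose G (u : plane * measurableTypeR R) : \bar R :=
  ((\1_B (u.2 : R))%:E *
   (sqn u.1 ^+ a.+1 * expR (- ((u.2 : R) * sqn u.1)))%:E)%E.
have mG : measurable_fun setT G.
  apply: emeasurable_funM; apply/measurable_EFinP; last exact: measurable_sqn_gauss.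
  have m1 : measurable_fun setT (\1_B : R -> R).
    by apply: measurable_indic; exact: measurable_itv.
  exact: (measurableT_comp m1 measurable_snd).
have G0 u : (0 <= G u)%E by rewrite mule_ge0 // lee_fin sqn_gauss_ge0.
have N0 c b : (0 <= gauss_moment c b)%E.
  by apply: integral_ge0 => z _; rewrite lee_fin sqn_gauss_ge0.
have lhs : (\int[mu]_t \int[mu2]_z G (z, t) =
            gauss_moment a.+1 1 * (a.+1%:R^-1)%:E)%E.
  rewrite -integral_invX_tail -ge0_integralZl //; last 2 first.
  - apply/measurable_EFinP; apply: subspace_continuous_measurable_fun => //.
    exact: continuous_within_invX.
  - move=> t; rewrite /= in_itv /= andbT => t1.
    by rewrite lee_fin exprn_ge0 // invr_ge0 (le_trans _ t1).
  rewrite integral_indicl; apply: eq_integral => t _.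
  rewrite /G /= ge0_integralZl //; last 2 first.
  - by apply/measurable_EFinP; exact: measurable_sqn_gauss_b.
  - by move=> z _; rewrite lee_fin sqn_gauss_ge0.
  rewrite indicE; case: (boolP (t \in B)) => [|_]; last by rewrite !mul0e.
  rewrite inE /B /= in_itv /= andbT => t1.
  have t0 : 0 < t by exact: (lt_le_trans _ t1).
  rewrite !mul1e -/(gauss_moment a.+1 t) -(gauss_moment_scale a.+1 t0).
  by rewrite muleAC -EFinM exprVn mulfV ?mul1e // expf_neq0 // (gt_eqF t0).
have rhs : (\int[mu2]_z \int[mu]_t G (z, t) = gauss_moment a 1)%E.
  apply: eq_integral => z _; rewrite /G /= mul1r.
  (* At the origin both sides vanish, which uses 0 < a; elsewhere the integral over b converges. *)
  have [s0|s0] := eqVneq (sqn z) 0.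
    rewrite s0 !expr0n /= (gtn_eqF a0) mul0r.
    by under eq_integral do rewrite mul0r mule0; rewrite integral0.
  have sp : 0 < sqn z by rewrite lt_neqAle eq_sym s0 sqn_ge0.
  rewrite -integral_indicl; under eq_integral do rewrite EFinM.
  rewrite ge0_integralZl ?lee_fin ?exprn_ge0 ?sqn_ge0 //; last first.
  - apply/measurable_EFinP; apply: measurable_funTS.
    apply: continuous_measurable_fun => x.
    apply: (@continuous_comp _ _ _ (fun b : R => - (b * sqn z)) (@expR R)).
      by apply: cvgN; apply: cvgM; [exact: cvg_id|exact: cvg_cst].
    exact: continuous_expR.
  rewrite integral_expR_tail // -EFinM exprSr; congr _%:E.
  by field.
by rewrite -rhs plane_tonelli_swap // lhs muleCA -EFinM mulfV ?mule1.
Qed.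

Lemma gauss_moment_gt0 a : (0 < gauss_moment a 1)%E.
Proof.
pose I12 := (`[1%R, 2%R]%classic : set R).
have mI : measurable (I12 : set (measurableTypeR R)) by exact: measurable_itv.
have muI : (mu I12 = 1)%E.
  have := @lebesgue_measure_itv R `[1%R, 2%R]; rewrite /= lte_fin ltr1n => ->.
  by rewrite -EFinB; congr _%:E; lra.
have mu2I : mu2 (I12 `*` I12) = 1%E.
  by rewrite product_measure1E // [X in (X * _)%E]muI mul1e.
apply: (@integral_gt0_on _ _ _ mu2 setT (I12 `*` I12) _ (expR (- 8))) => //.
- exact: measurableX.
- exact: measurable_sqn_gauss_b.
- by move=> z _; exact: sqn_gauss_ge0.
- move=> [x y]; rewrite /I12 => -[] /=; rewrite !in_itv /= => /andP[x1 x2] /andP[y1 y2].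
  have sE : 1 <= sqn (x, y) <= 8 by rewrite /sqn /=; nra.
  case/andP: sE => s1 s8; rewrite -[leLHS]mul1r ler_pM ?expR_ge0 //.
    by rewrite exprn_ege1.
  by rewrite ler_expR mul1r lerN2.
- by rewrite [X in (_ < X)%E]mu2I.
Qed.

Lemma gauss_moment0 : gauss_moment 0 1 = pi%:E.
Proof.
rewrite /gauss_moment plane_tonelli1; last 2 first.
- by apply/measurable_EFinP; exact: measurable_sqn_gauss_b.
- by move=> z; rewrite lee_fin sqn_gauss_ge0.
have mg := @measurable_gauss_fun R.
transitivity (\int[mu]_x ((gauss_fun x)%:E * (Num.sqrt pi)%:E))%E.
  apply: eq_integral => x _; rewrite -integralT_gauss.
  have me : measurable_fun setT (EFin \o @gauss_fun R) by exact/measurable_EFinP.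
  have e0 (y : R) : setT y -> (0 <= (gauss_fun y)%:E)%E.
    by move=> _; rewrite lee_fin gauss_fun_ge0.
  have x0 : (0 <= (gauss_fun x)%:E)%E by exact: e0.
  apply: (etrans _ (ge0_integralZl mu measurableT me e0 x0)).
  apply: eq_integral => y _; rewrite -EFinM /gauss_fun -expRD; congr (_%:E).
  by rewrite expr0 !mul1r /sqn /=; congr expR; ring.
rewrite ge0_integralZr ?lee_fin ?sqrtr_ge0 //; last 2 first.
- exact/measurable_EFinP.
- by move=> y _; rewrite lee_fin gauss_fun_ge0.
by rewrite integralT_gauss -EFinM -expr2 sqr_sqrtr // pi_ge0.
Qed.

(** The recursion starts at a = 1. There s exp(-s) <= 2 exp(-s/2) reduces finiteness to the Gaussian
    integral, rescaled to parameter 1/2. *)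
Lemma gauss_moment_lty a : (0 < a)%N -> (gauss_moment a 1 < +oo)%E.
Proof.
case: a => // a _; elim: a => [|a IH]; last first.
  by rewrite gauss_moment_rec // lte_mul_pinfty // lee_fin.
have h0 : 0 < 2^-1 :> R by [].
have h := gauss_moment_scale 0 h0; rewrite expr1 gauss_moment0 in h.
apply: (@le_lt_trans _ _ (2%:E * gauss_moment 0 2^-1)%E); last first.
  rewrite lte_mul_pinfty ?lee_fin //.
  case: (gauss_moment 0 2^-1) h => [r _|/eqP|//]; first exact: ltry.
  by rewrite mulry gtr0_sg // mul1e.
rewrite /gauss_moment -ge0_integralZl //; last 2 first.
- by apply/measurable_EFinP; exact: measurable_sqn_gauss_b.
- by move=> z _; rewrite lee_fin sqn_gauss_ge0.
apply: ge0_le_integral => //.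
- by move=> z _; rewrite lee_fin sqn_gauss_ge0.
- by apply/measurable_EFinP; exact: measurable_sqn_gauss_b.
- apply: emeasurable_funM => //.
  by apply/measurable_EFinP; exact: measurable_sqn_gauss_b.
- move=> z _; rewrite -EFinM lee_fin expr1 expr0 !mul1r.
  have -> : expR (- sqn z) = expR (- (2^-1 * sqn z)) * expR (- (2^-1 * sqn z)).
    by rewrite -expRD; congr expR; field.
  rewrite mulrA ler_wpM2r ?expR_ge0 // expRN ler_pdivrMr ?expR_gt0 //.
  by have := expR_ge1Dx (2^-1 * sqn z); lra.
Qed.

Definition weight (n v : nat) (z : plane) : R :=
  norm (complex_of_plane z) ^+ (2 * v + 2)
  * besselK v (2 * n%:R * norm (complex_of_plane z) ^+ 2).

Lemma weightE n v z :
  weight n v z = sqn z ^+ v.+1 * besselK v (2 * n%:R * sqn z).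
Proof.
rewrite /weight norm2E; congr (_ * _).
by rewrite -norm2E -exprM; congr (_ ^+ _); rewrite mulnS addnC.
Qed.

Lemma weight_ge0 n v z : 0 <= weight n v z.
Proof. by rewrite weightE mulr_ge0 ?exprn_ge0 ?sqn_ge0 ?besselK_ge0. Qed.

Lemma measurable_weight n v : measurable_fun setT (weight n v).
Proof.
rewrite (_ : weight n v = fun z => sqn z ^+ v.+1 * besselK v (2 * n%:R * sqn z)).
  apply: measurable_funM; first exact: (measurable_funX _ measurable_sqn).
  have m1 : measurable_fun setT (fun z : plane => 2 * n%:R * sqn z).
    by apply: measurable_funM => //; exact: measurable_sqn.
  exact: (measurableT_comp (measurable_besselK v) m1).
by apply/funext => z; rewrite weightE.
Qed.

Definition moment (n v k : nat) : \bar R :=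
  (\int[mu2]_z (sqn z ^+ (2 * k) * weight n v z)%:E)%E.

(** Insert the integral for K_v and exchange integrals: for fixed t the integrand is Gaussian with
    parameter 2n cosh t, and scaling it away separates z from t. *)
Lemma momentE (n v k : nat) : (0 < n)%N ->
  let a := (2 * k + v).+1 in
  (moment n v k =
   ((2 * n%:R)^-1 ^+ a.+1)%:E * gauss_moment a 1 * sech_integral v a.+1 :> \bar R)%E.
Proof.
move=> n0 a; set c : R := 2 * n%:R; have c0 : 0 < c by rewrite mulr_gt0 ?ltr0n.
pose G (u : plane * measurableTypeR R) : \bar R :=
  ((\1_posR (u.2 : R))%:E *
   (sqn u.1 ^+ a * bessel_integrand v (c * sqn u.1) u.2)%:E)%E.
have mH : measurable_fun setT (fun u : plane * measurableTypeR R =>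
    sqn u.1 ^+ a * bessel_integrand v (c * sqn u.1) u.2).
  have m1 : measurable_fun setT (fun u : plane * measurableTypeR R => sqn u.1).
    by apply: (measurableT_comp measurable_sqn); exact: measurable_fst.
  apply: measurable_funM; first exact: (measurable_funX _ m1).
  have m2 : measurable_fun setT (fun u : plane * measurableTypeR R =>
      (c * sqn u.1, u.2 : R) : plane).
    apply: measurable_pair2; last exact: measurable_snd.
    exact: measurable_funM.
  exact: (measurableT_comp (measurable_bessel_integrand v) m2).
have mG : measurable_fun setT G.
  apply: emeasurable_funM; apply/measurable_EFinP => //.
  have m1 : measurable_fun setT (\1_posR : R -> R).
    by apply: measurable_indic; exact: measurable_itv.
  exact: (measurableT_comp m1 measurable_snd).
have G0 u : (0 <= G u)%E.
  by rewrite mule_ge0 // lee_fin mulr_ge0 ?bessel_integrand_ge0 ?exprn_ge0 ?sqn_ge0.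
have gN : (0 <= gauss_moment a 1)%E by rewrite ltW // gauss_moment_gt0.
transitivity (\int[mu2]_z \int[mu]_t G (z, t))%E.
  apply: eq_integral => z _; rewrite /G /=.
  rewrite weightE mulrA -exprD addnS -/a.
  have [s0|s0] := eqVneq (sqn z) 0.
    rewrite s0 expr0n /= mul0r.
    by under eq_integral do rewrite mul0r mule0; rewrite integral0.
  have sp : 0 < sqn z by rewrite lt_neqAle eq_sym s0 sqn_ge0.
  rewrite -integral_indicl; under eq_integral do rewrite EFinM.
  rewrite ge0_integralZl ?lee_fin ?exprn_ge0 ?sqn_ge0 //; last 2 first.
  - apply/measurable_EFinP; apply: measurable_funTS.
    exact: measurable_section_bessel.
  - by move=> x _; rewrite lee_fin bessel_integrand_ge0.
  by rewrite EFinM besselKE // mulr_gt0.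
rewrite plane_tonelli_swap //.
rewrite /sech_integral -ge0_integralZl //; last 3 first.
- by apply: measurable_continuous_pos; exact: continuous_sechX_cosh.
- by move=> x _; rewrite lee_fin sechX_cosh_ge0.
- by rewrite mule_ge0 // lee_fin exprn_ge0 // invr_ge0 ltW.
rewrite integral_indicl; apply: eq_integral => t _.
rewrite /G /= ge0_integralZl //; last 2 first.
- have m2 : measurable_fun setT (fun z : plane => (z, t) : plane * measurableTypeR R).
    exact: measurable_fun_pair.
  by apply/measurable_EFinP; exact: (measurableT_comp mH m2).
- by move=> z _; rewrite lee_fin mulr_ge0 ?bessel_integrand_ge0 ?exprn_ge0 ?sqn_ge0.
congr (_ * _)%E.
have b0 : 0 < c * cosh t by rewrite mulr_gt0 ?cosh_gt0.
rewrite -(gauss_moment_scale a b0) /gauss_moment.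
transitivity (\int[mu2]_z ((cosh (v%:R * t))%:E *
   (sqn z ^+ a * expR (- (c * cosh t * sqn z)))%:E))%E.
  apply: eq_integral => z _; rewrite -EFinM /bessel_integrand; congr _%:E.
  have -> : - (c * sqn z) * cosh t = - (c * cosh t * sqn z) by ring.
  by ring.
rewrite ge0_integralZl ?lee_fin ?(ltW (cosh_gt0 _)) //; last 2 first.
- by apply/measurable_EFinP; exact: measurable_sqn_gauss_b.
- by move=> z _; rewrite lee_fin sqn_gauss_ge0.
rewrite [RHS]muleC !muleA -!EFinM; congr (_%:E * _)%E.
rewrite exprMn /sech !exprVn.
have X0 : c ^+ a.+1 != 0 by rewrite expf_neq0 ?gt_eqF.
have Y0 : cosh t ^+ a.+1 != 0 by rewrite expf_neq0 ?gt_eqF ?cosh_gt0.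
move: (c ^+ _) (cosh t ^+ _) X0 Y0 => X Y X0 Y0.
by field; rewrite X0 Y0.
Qed.

Lemma moment_gt0 n v k : (0 < n)%N -> (0 < moment n v k)%E.
Proof.
move=> n0; rewrite momentE // !mule_gt0 ?gauss_moment_gt0 ?sech_integral_gt0 //.
by rewrite lte_fin exprn_gt0 // invr_gt0 mulr_gt0 ?ltr0n.
Qed.

Lemma moment_fin_num n v k : (0 < n)%N -> moment n v k \is a fin_num.
Proof.
move=> n0; rewrite momentE // !fin_numM //.
- by rewrite ge0_fin_numE ?gauss_moment_lty // ltW // gauss_moment_gt0.
- rewrite ge0_fin_numE ?sech_integral_lty ?(ltW (sech_integral_gt0 _ _)) //.
  by rewrite ltnS -addSn leq_addl.
Qed.

(** Raising k by 1 raises a by 2. With p = a+1, the Gaussian factor gains p(p+1) and the sech factor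
    (p^2 - v^2)/(p(p+1)). Their product is p^2 - v^2 = 4(k+1)(k+1+v), and the 4 cancels against
    (2n)^2. *)
Lemma moment_rec n v k : (0 < n)%N ->
  ((n ^ 2)%:R%:E * moment n v k.+1 =
   (k.+1 * (k.+1 + v))%:R%:E * moment n v k :> \bar R)%E.
Proof.
move=> n0; rewrite !momentE //.
have -> : (2 * k.+1 + v = (2 * k + v).+2)%N by rewrite mulnS.
set a := (2 * k + v).+1.
have vp : (v < a.+1)%N by rewrite ltnS /a -addSn leq_addl.
have := @sech_integral_rec R _ _ vp.
rewrite (@gauss_moment_rec a.+1) // (@gauss_moment_rec a) //.
have gf : gauss_moment a 1 \is a fin_num.
  by rewrite ge0_fin_numE ?gauss_moment_lty // ltW // gauss_moment_gt0.
have sf p : (v < p)%N -> @sech_integral R v p \is a fin_num.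
  by move=> h; rewrite ge0_fin_numE ?sech_integral_lty ?(ltW (sech_integral_gt0 _ _)).
have vp3 : (v < a.+3)%N by rewrite ltnW // ltnW.
rewrite -(fineK gf) -(fineK (sf _ vp)) -(fineK (sf _ vp3)) -!EFinM => -[E].
congr _%:E; move: E.
move: (fine _) (fine _) (fine _) => g s' s E.
have nn : n%:R != 0 :> R by rewrite pnatr_eq0 -lt0n.
have E' : s' = ((a.+1 ^ 2)%:R - (v ^ 2)%:R) * s / (a.+1 * a.+2)%:R.
  by rewrite E mulrC mulKf // pnatr_eq0.
rewrite E' [_ ^+ a.+3]exprSr [_ ^+ a.+2]exprSr; move: (_ ^+ a.+1) => c.
rewrite /a -!mulnn -[(2 * k + v).+3]addn3 -[(2 * k + v).+2]addn2 -addn1 !natrM.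
rewrite ?(natrD, natrM).
field; rewrite nn andbT.
by have := ler0n R k; have := ler0n R v; move=> *; rewrite !gt_eqF //; lra.
Qed.

End BesselMoments.

(** * Reduction to independent moduli *)

Section EigenvalueDensity.
Context {R : realType}.
Local Notation plane := (measurableTypeR R * measurableTypeR R)%type.
Local Notation mu2 := ((@lebesgue_measure R) \x (@lebesgue_measure R))%E.
Local Notation norm := (@ComplexField.Normc.normc R).

(* Unfolding [weight] makes failed unifications explore [Num.sqrt]. *)
Opaque weight.

Definition rot (th : R) : plane -> plane :=
  lin2 (cos th) (- sin th) (sin th) (cos th).

Lemma measurable_rot th : measurable_fun setT (rot th).
Proof. exact: measurable_lin2. Qed.

Lemma complex_of_rot th (z : plane) :
  complex_of_plane (rot th z) = cis th * complex_of_plane z.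
Proof.
case: z => x y; apply/eqP; rewrite eq_complex /= /rot /lin2 /=.
by rewrite mulNr addrC [X in _ && (_ == X)]addrC !eqxx.
Qed.

Lemma integral_rot th (G : plane -> \bar R) :
  measurable_fun setT G -> (forall z, 0 <= G z)%E ->
  (\int[mu2]_z G (rot th z) = \int[mu2]_z G z)%E.
Proof. by move=> mG G0; apply: integral_rotation => //; exact: cos2Dsin2. Qed.

Lemma sqn_rot th z : sqn (rot th z) = sqn z.
Proof.
by rewrite -norm2E complex_of_rot ComplexField.Normc.normcM norm_cis mul1r norm2E.
Qed.

Lemma weight_sqn n v (z z' : plane) : sqn z = sqn z' -> weight n v z = weight n v z'.
Proof. by rewrite !weightE => ->. Qed.

Definition vandermonde2 n (s : n.-tuple plane) : R :=
  let z j := complex_of_plane (tnth s j) in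
  \prod_(j < n) \prod_(k < n | (j < k)%N) norm (z j ^+ 2 - z k ^+ 2) ^+ 2.

(** The density without its half-plane constraint, which the rotations would not preserve. *)
Definition core n v (s : n.-tuple plane) : R :=
  vandermonde2 s * \prod_(j < n) weight n v (tnth s j).

Lemma dirac_densityE n v (s : n.-tuple plane) :
  dirac_density v s = right_half s * core v s.
Proof.
rewrite /dirac_density -[X in if _ then X else _]/(core v s) /right_half.
case: ifPn => [/forallP h|].
  rewrite (_ : \prod_(i < n) _ = 1 :> R) ?mul1r //.
  by apply: big1 => j _; have /= -> := h j.
rewrite negb_forall => /existsP[j hj].
by rewrite [X in _ = X * _](bigD1 j) //= (negbTE hj) !mul0r.
Qed.

Lemma vandermonde2_ge0 n (s : n.-tuple plane) : 0 <= vandermonde2 s.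
Proof. by apply: prodr_ge0 => j _; apply: prodr_ge0 => k _; exact: sqr_ge0. Qed.

Lemma core_ge0 n v (s : n.-tuple plane) : 0 <= core v s.
Proof.
by rewrite mulr_ge0 ?vandermonde2_ge0 // prodr_ge0 // => j _; exact: weight_ge0.
Qed.

Lemma normc2E (w : R[i]) : norm w ^+ 2 = complex.Re w ^+ 2 + complex.Im w ^+ 2.
Proof. by case: w => a b; rewrite /= sqr_sqrtr // addr_ge0 ?sqr_ge0. Qed.

Lemma measurable_vandermonde2 n : measurable_fun setT (@vandermonde2 n).
Proof.
apply: measurable_prod => j _.
(* In real coordinates the squared moduli are polynomials, and the condition j < k becomes a factor
   1, so measurability follows by closure properties. *)
have E (s : n.-tuple plane) :
  \prod_(k < n | (j < k)%N) norm (complex_of_plane (tnth s j) ^+ 2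
    - complex_of_plane (tnth s k) ^+ 2) ^+ 2 =
  \prod_(k < n) (if (j < k)%N then
    (((tnth s j).1 : R) * (tnth s j).1 - ((tnth s j).2 : R) * (tnth s j).2
     - (((tnth s k).1 : R) * (tnth s k).1 - ((tnth s k).2 : R) * (tnth s k).2)) ^+ 2
    + (((tnth s j).1 : R) * (tnth s j).2 + ((tnth s j).2 : R) * (tnth s j).1
     - (((tnth s k).1 : R) * (tnth s k).2 + ((tnth s k).2 : R) * (tnth s k).1)) ^+ 2
    else 1).
  rewrite big_mkcond; apply: eq_bigr => k _; case: ifP => // _.
  rewrite normc2E; case: (tnth s j) => a b; case: (tnth s k) => c d /=.
  by [].
under eq_fun do rewrite E.
apply: measurable_prod => k _; case: (j < k)%N; last exact: measurable_cst.
have m1 i : measurable_fun setT (fun s : n.-tuple plane => (tnth s i).1 : R).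
  by apply: (measurableT_comp measurable_fst2); exact: measurable_tnth.
have m2 i : measurable_fun setT (fun s : n.-tuple plane => (tnth s i).2 : R).
  by apply: (measurableT_comp measurable_snd2); exact: measurable_tnth.
by apply: measurable_funD; apply: measurable_funX; apply: measurable_funB;
  [apply: measurable_funB | apply: measurable_funB |
   apply: measurable_funD | apply: measurable_funD ];
  apply: measurable_funM.
Qed.

Lemma measurable_core n v : measurable_fun setT (@core n v).
Proof.
apply: measurable_funM; first exact: measurable_vandermonde2.
apply: measurable_prod => j _.
by apply: (measurableT_comp (measurable_weight n v)); exact: measurable_tnth.
Qed.

Lemma complex_of_flip b (z : plane) :
  complex_of_plane (flip b z) ^+ 2 = complex_of_plane z ^+ 2.
Proof.
by case: b => //; rewrite -[RHS]sqrrN.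
Qed.

Lemma sqn_flip b (z : plane) : sqn (flip b z) = sqn z.
Proof. by case: b => //; rewrite /sqn /= !sqrrN. Qed.

Lemma core_congr n v (s s' : n.-tuple plane) :
  vandermonde2 s = vandermonde2 s' ->
  (forall j, sqn (tnth s j) = sqn (tnth s' j)) -> core v s = core v s'.
Proof.
move=> e1 e2.
have e3 j : weight n v (tnth s j) = weight n v (tnth s' j).
  exact: weight_sqn (e2 j).
have e4 : \prod_(j < n) weight n v (tnth s j) = \prod_(j < n) weight n v (tnth s' j).
  by apply: eq_bigr => j _.
exact: (f_equal2 *%R e1 e4).
Qed.

Lemma core_flip n v e (s : n.-tuple plane) :
  core v (map_coord (fun i => flip (e i)) s) = core v s.
Proof.
apply: core_congr => [|j]; last by rewrite tnth_mktuple sqn_flip.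
apply: eq_bigr => j _; apply: eq_bigr => k _.
by rewrite !tnth_mktuple !complex_of_flip.
Qed.

Lemma core_rot n v th (s : n.-tuple plane) :
  core v (map_coord (fun=> rot th) s) = core v s.
Proof.
apply: core_congr => [|j]; last by rewrite tnth_mktuple sqn_rot.
apply: eq_bigr => j _; apply: eq_bigr => k _.
rewrite !tnth_mktuple !complex_of_rot !exprMn -mulrBr.
by rewrite ComplexField.Normc.normcM expr2 ComplexField.Normc.normcM norm_cis !mul1r.
Qed.

Lemma emeasurable_prod d (T : measurableType d) (I : Type) (r : seq I)
    (F : I -> T -> \bar R) :
  (forall i, measurable_fun setT (F i)) ->
  measurable_fun setT (fun x => \prod_(i <- r) F i x)%E.
Proof.
move=> mF; elim: r => [|i r IH].
  by under eq_fun do rewrite big_nil; exact: measurable_cst.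
by under eq_fun do rewrite big_cons; exact: emeasurable_funM.
Qed.

(* Average over independent rotations of the coordinates by multiples of pi/n:
   the Vandermonde factor becomes a sum of products of functions of the
   moduli. *)
Lemma integral_core_radial n v (g : plane -> R) : (0 < n)%N ->
  measurable_fun setT g -> (forall z, 0 <= g z) ->
  (forall th z, g (rot th z) = g z) ->
  (integral_Cn (fun s => (core v s * \prod_(j < n) g (tnth s j))%:E) =
   n`!%:R%:E *
   \prod_(k < n) \int[mu2]_z (sqn z ^+ (2 * k) * weight n v z * g z)%:E)%E.
Proof.
move=> n0 mg g0 gr.
pose f (s : n.-tuple plane) := core v s * \prod_(j < n) g (tnth s j).
have mgt (j : 'I_n) : measurable_fun setT (fun s : n.-tuple plane => g (tnth s j)).
  by apply: (measurableT_comp mg); exact: measurable_tnth.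
have mf : measurable_fun setT f.
  by apply: measurable_funM; [exact: measurable_core|exact: measurable_prod].
have f0 s : 0 <= f s by rewrite mulr_ge0 ?core_ge0 // prodr_ge0.
pose ph (e : {ffun 'I_n -> 'I_(2 * n)}) (i : 'I_n) := rot (pi / n%:R * (e i)%:R).
pose h k z := sqn z ^+ (2 * k) * weight n v z * g z.
have h0 k z : 0 <= h k z.
  by rewrite mulr_ge0 // mulr_ge0 ?weight_ge0 // exprn_ge0 ?sqn_ge0.
have mh k : measurable_fun setT (h k).
  apply: measurable_funM => //; apply: measurable_funM; last exact: measurable_weight.
  exact: (measurable_funX _ measurable_sqn).
set c : R := (2 * n)%:R ^+ n.
have c0 : 0 < c by rewrite exprn_gt0 // ltr0n muln_gt0.
have avg s : \sum_e f (map_coord (ph e) s) =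
    c * \sum_(p : 'S_n) \prod_(j < n) h (p j) (tnth s j).
  have fE e : f (map_coord (ph e) s) = vandermonde2 (map_coord (ph e) s) *
      (\prod_(j < n) (weight n v (tnth s j) * g (tnth s j))).
    rewrite /f /core -mulrA -big_split /=.
    rewrite (eq_bigr (fun j => weight n v (tnth s j) * g (tnth s j))) // => j _.
    by rewrite tnth_mktuple gr (weight_sqn n v (sqn_rot _ _)).
  under eq_bigr do rewrite fE.
  rewrite -mulr_suml.
  have := sum_rotated_Vandermonde (fun j => complex_of_plane (tnth s j)) n0.
  rewrite -/c => E; rewrite [X in X * _](_ : _ =
      c * \sum_(p : 'S_n) \prod_(j < n) sqn (tnth s j) ^+ (2 * p j)).
    rewrite -mulrA mulr_suml; congr (_ * _); apply: eq_bigr => p _.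
    by rewrite -big_split /=; apply: eq_bigr => j _; rewrite /h mulrA.
  have E2 : \sum_(p : 'S_n) \prod_(j < n) norm (complex_of_plane (tnth s j)) ^+ (4 * p j)
      = \sum_(p : 'S_n) \prod_(j < n) sqn (tnth s j) ^+ (2 * p j).
    apply: eq_bigr => p _; apply: eq_bigr => j _.
    by rewrite -norm2E -exprM mulnA.
  rewrite -E2 -E; apply: eq_bigr => e _.
  apply: eq_bigr => j _; apply: eq_bigr => k _.
  by rewrite !tnth_mktuple !complex_of_rot !cisX.
have sumE : (c%:E * integral_Cn (EFin \o f) =
    c%:E * (n`!%:R%:E * \prod_(k < n) \int[mu2]_z (h k z)%:E))%E.
  transitivity (\sum_(e : {ffun 'I_n -> 'I_(2 * n)})
      integral_Cn (fun s => (f (map_coord (ph e) s))%:E))%E.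
    transitivity (\sum_(e : {ffun 'I_n -> 'I_(2 * n)}) integral_Cn (EFin \o f))%E.
      by rewrite sumr_const card_ffun !card_ord /c -natrX mule_natl.
    apply: eq_bigr => e _; symmetry.
    apply: (@integral_Cn_map_coord _ _ (ph e) (EFin \o f)).
    - by move=> i; exact: measurable_rot.
    - by move=> i G mG G0; exact: integral_rot.
    - exact/measurable_EFinP.
    - by move=> s; rewrite lee_fin.
  have mph e : measurable_fun setT (fun s => f (map_coord (ph e) s)).
    apply: (measurableT_comp mf); apply: measurable_map_coord => i.
    exact: measurable_rot.
  rewrite -integral_Cn_sum; last 2 first.
  - by move=> e; apply/measurable_EFinP.
  - by move=> e s; rewrite lee_fin.
  transitivity (integral_Cn (fun s =>
      c%:E * \sum_(p : 'S_n) \prod_(j < n) (h (p j) (tnth s j))%:E))%E.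
    apply: eq_integral_Cn => s; rewrite sumEFin avg EFinM -sumEFin; congr (_ * _)%E.
    by apply: eq_bigr => p _; rewrite prodEFin.
  have mP (p : 'S_n) : measurable_fun setT
      (fun s : n.-tuple plane => \prod_(j < n) (h (p j) (tnth s j))%:E)%E.
    apply: emeasurable_prod => j; apply/measurable_EFinP.
    by apply: (measurableT_comp (mh _)); exact: measurable_tnth.
  have P0 (p : 'S_n) (s : n.-tuple plane) :
      (0 <= \prod_(j < n) (h (p j) (tnth s j))%:E)%E.
    by apply: prode_ge0 => j _; rewrite lee_fin.
  rewrite integral_CnZl; last 3 first.
  - by rewrite lee_fin ltW.
  - exact: emeasurable_sum.
  - by move=> s; apply: sume_ge0 => p _; exact: P0.
  congr (_ * _)%E; rewrite integral_Cn_sum //.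
  transitivity (\sum_(p : 'S_n) \prod_(k < n) \int[mu2]_z (h k z)%:E)%E.
    apply: eq_bigr => p _.
    rewrite (@integral_Cn_prod _ _ (fun j z => (h (p j) z)%:E)); last 2 first.
    - by move=> j; apply/measurable_EFinP; exact: mh.
    - by move=> j z; rewrite lee_fin.
    (* Reindexing by p shows that all n! permutations contribute equally. *)
    by rewrite [RHS](reindex_inj (@perm_inj _ p)).
  by rewrite sumr_const card_Sn mule_natl.
have cK (x : \bar R) : ((c^-1)%:E * (c%:E * x) = x)%E.
  by rewrite muleA -EFinM mulVf ?gt_eqF // mul1e.
by have := congr1 (fun x => (c^-1)%:E * x)%E sumE; rewrite !cK.
Qed.

End EigenvalueDensity.

(** * Tail estimates for the radial densities *)

Section RadialTails.
Context {R : realType}.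
Local Notation plane := (measurableTypeR R * measurableTypeR R)%type.
Local Notation mu2 := ((@lebesgue_measure R) \x (@lebesgue_measure R))%E.

(** Serves both sides of the inequality integrated in [tail_Chebyshev], arranged so that every
    coefficient is nonnegative. *)
Lemma integral_lincomb3 d (T : measurableType d) (m : {measure set T -> \bar R})
    (f g h : T -> R) (a b c F G H : R) :
  measurable_fun setT f -> measurable_fun setT g -> measurable_fun setT h ->
  (forall x, 0 <= f x) -> (forall x, 0 <= g x) -> (forall x, 0 <= h x) ->
  0 <= a -> 0 <= b -> 0 <= c ->
  (\int[m]_x (f x)%:E = F%:E -> \int[m]_x (g x)%:E = G%:E ->
   \int[m]_x (h x)%:E = H%:E ->
   \int[m]_x (a * f x + b * g x + c * h x)%:E = (a * F + b * G + c * H)%:E)%E.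
Proof.
move=> mf mg mh f0 g0 h0 a0 b0 c0 iF iG iH.
have Z (k : R) (u : T -> R) (U : R) : measurable_fun setT u ->
    (forall x, 0 <= u x) -> 0 <= k -> (\int[m]_x (u x)%:E = U%:E)%E ->
    (\int[m]_x (k * u x)%:E = (k * U)%:E)%E.
  move=> mu u0 k0 uU; under eq_integral do rewrite EFinM.
  rewrite ge0_integralZl ?lee_fin //; first by rewrite uU -EFinM.
  - exact/measurable_EFinP.
  - by move=> x _; rewrite lee_fin.
have mk (k : R) (u : T -> R) : measurable_fun setT u ->
    measurable_fun setT (fun x => k * u x).
  by move=> mu; apply: measurable_funM.
have D (u w : T -> R) (U W : R) : measurable_fun setT u -> measurable_fun setT w ->
    (forall x, 0 <= u x) -> (forall x, 0 <= w x) ->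
    (\int[m]_x (u x)%:E = U%:E -> \int[m]_x (w x)%:E = W%:E ->
     \int[m]_x (u x + w x)%:E = (U + W)%:E)%E.
  move=> mu mw u0 w0 uU wW; under eq_integral do rewrite EFinD.
  rewrite ge0_integralD //; first by rewrite uU wW -EFinD.
  - by move=> x _; rewrite lee_fin.
  - exact/measurable_EFinP.
  - by move=> x _; rewrite lee_fin.
  - exact/measurable_EFinP.
apply: (D (fun x => a * f x + b * g x) (fun x => c * h x)).
- by apply: measurable_funD; exact: mk.
- exact: mk.
- by move=> x; rewrite addr_ge0 // mulr_ge0.
- by move=> x; rewrite mulr_ge0.
- apply: (D (fun x => a * f x) (fun x => b * g x)); try exact: mk.
  + by move=> x; rewrite mulr_ge0.
  + by move=> x; rewrite mulr_ge0.
  + exact: Z.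
  + exact: Z.
- exact: Z.
Qed.

Variables (n v : nat).
Hypothesis n_gt0 : (0 < n)%N.

Definition radial (k : nat) (z : plane) : R := sqn z ^+ (2 * k) * weight n v z.

Lemma radial_ge0 k z : 0 <= radial k z.
Proof. by rewrite mulr_ge0 ?weight_ge0 // exprn_ge0 ?sqn_ge0. Qed.

Lemma measurable_radial k : measurable_fun setT (radial k).
Proof.
apply: measurable_funM; last exact: measurable_weight.
exact: (measurable_funX _ measurable_sqn).
Qed.

Definition rmoment k : R := fine (moment n v k : \bar R).

Lemma integral_radial k : (\int[mu2]_z (radial k z)%:E = (rmoment k)%:E)%E.
Proof. by rewrite /rmoment fineK ?moment_fin_num. Qed.

Lemma rmoment_gt0 k : 0 < rmoment k.
Proof. by rewrite -lte_fin -integral_radial; exact: moment_gt0. Qed.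

Lemma rmomentS k :
  rmoment k.+1 = (k.+1 * (k.+1 + v))%:R / (n ^ 2)%:R * rmoment k.
Proof.
have nn : (n ^ 2)%:R != 0 :> R by rewrite pnatr_eq0 -lt0n expn_gt0 n_gt0.
have := @moment_rec R n v k n_gt0.
have mE j : moment n v j = (rmoment j)%:E by exact: integral_radial.
rewrite !mE -!EFinM => -[E].
by rewrite mulrAC -E mulrAC mulfV // mul1r.
Qed.

(** For j > 0, the quotient of the moments of index j and j-1. *)
Definition ratio (j : nat) : R := (j * (j + v))%:R / (n ^ 2)%:R.

Lemma ratio_ge0 j : 0 <= ratio j.
Proof. by rewrite divr_ge0. Qed.

Lemma ratio_gt0 j : (0 < j)%N -> 0 < ratio j.
Proof.
by move=> j0; rewrite divr_gt0 // ltr0n ?expn_gt0 ?n_gt0 // muln_gt0 j0 addn_gt0 j0.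
Qed.

Lemma le_ratio j k : (j <= k)%N -> ratio j <= ratio k.
Proof.
move=> jk; rewrite ler_wpM2r ?invr_ge0 // ler_nat leq_mul // leq_add2r //.
Qed.

Lemma rmomentD k s :
  rmoment (k + s) = (\prod_(i < s) ratio (k + i).+1) * rmoment k.
Proof.
elim: s => [|s IH]; first by rewrite addn0 big_ord0 mul1r.
by rewrite addnS rmomentS IH big_ord_recr /= mulrA [_ * \prod_(_ < _) _]mulrC.
Qed.

Definition above (Y : R) (z : plane) : R := (Y <= sqn z)%R%:R.

Lemma measurable_above Y : measurable_fun setT (above Y).
Proof.
apply: (@measurableT_comp _ _ _ _ _ _ (fun b : bool => b%:R : R)) => //.
exact: (measurable_fun_ler (f := fun=> Y) _ measurable_sqn).
Qed.

Definition tail k (Y : R) : R := fine (\int[mu2]_z (radial k z * above Y z)%:E)%E.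

Lemma radial_above_ge0 k Y z : 0 <= radial k z * above Y z.
Proof. by rewrite mulr_ge0 ?radial_ge0. Qed.

Lemma measurable_radial_above k Y :
  measurable_fun setT (fun z => radial k z * above Y z).
Proof.
by apply: measurable_funM; [exact: measurable_radial|exact: measurable_above].
Qed.

Lemma integral_radial_above k Y :
  (\int[mu2]_z (radial k z * above Y z)%:E = (tail k Y)%:E)%E.
Proof.
rewrite /tail fineK // ge0_fin_numE; last first.
  by apply: integral_ge0 => z _; rewrite lee_fin radial_above_ge0.
apply: (@le_lt_trans _ _ (rmoment k)%:E); last exact: ltry.
rewrite -integral_radial; apply: ge0_le_integral => //.
- by move=> z _; rewrite lee_fin radial_above_ge0.
- by apply/measurable_EFinP; exact: measurable_radial_above.
- by apply/measurable_EFinP; exact: measurable_radial.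
- by move=> z _; rewrite lee_fin /above; case: (Y <= _);
    rewrite ?mulr1 ?mulr0 ?radial_ge0.
Qed.

Lemma tail_ge0 k Y : 0 <= tail k Y.
Proof.
by apply: fine_ge0; apply: integral_ge0 => z _; rewrite lee_fin radial_above_ge0.
Qed.

Lemma integral_radial_below k Y :
  (\int[mu2]_z (radial k z * (1 - above Y z))%:E = (rmoment k - tail k Y)%:E)%E.
Proof.
have h : (\int[mu2]_z (radial k z * (1 - above Y z))%:E + (tail k Y)%:E
          = (rmoment k)%:E)%E.
  rewrite -integral_radial_above -integral_radial -ge0_integralD //.
  - apply: eq_integral => z _; rewrite -EFinD; congr _%:E; ring.
  - by move=> z _; rewrite lee_fin mulr_ge0 ?radial_ge0 // /above;
      case: (Y <= _); rewrite ?subrr ?subr0.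
  - apply/measurable_EFinP; apply: measurable_funM; first exact: measurable_radial.
    by apply: measurable_funB => //; exact: measurable_above.
  - by move=> z _; rewrite lee_fin radial_above_ge0.
  - by apply/measurable_EFinP; exact: measurable_radial_above.
by rewrite EFinB -h addeK.
Qed.

Lemma tail_le k Y : tail k Y <= rmoment k.
Proof.
rewrite -subr_ge0 -lee_fin -integral_radial_below; apply: integral_ge0 => z _.
by rewrite lee_fin mulr_ge0 ?radial_ge0 // /above; case: (Y <= _);
  rewrite ?subrr ?subr0.
Qed.

(** Markov's inequality: on the event Y^{2s} <= |z|^{4s}, and the factor |z|^{4s} turns [radial k]
    into [radial (k + s)]. Monotonicity of [ratio] then gives one bound for all k < n, that of k =
    n-1. *)
Lemma tail_Chernoff k s Y : 0 < Y -> (k < n)%N ->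
  tail k Y / rmoment k <= \prod_(i < s) (ratio (n + i) / Y ^+ 2).
Proof.
move=> Y0 kn; have m0 := rmoment_gt0 k.
apply: (@le_trans _ _ (\prod_(i < s) (ratio (k + i).+1 / Y ^+ 2))); last first.
  apply: ler_prod => i _; rewrite divr_ge0 ?ratio_ge0 ?sqr_ge0 //=.
  by rewrite ler_wpM2r ?invr_ge0 ?sqr_ge0 // le_ratio // -addSn leq_add2r.
rewrite big_split /= prodr_const card_ord ler_pdivrMr // mulrAC -rmomentD.
rewrite exprVn ler_pdivlMr ?exprn_gt0 // -lee_fin mulrC EFinM -integral_radial.
rewrite -integral_radial_above -ge0_integralZl //; last 3 first.
- by apply/measurable_EFinP; exact: measurable_radial_above.
- by move=> z _; rewrite lee_fin radial_above_ge0.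
- by rewrite lee_fin exprn_ge0 // exprn_ge0 // ltW.
apply: ge0_le_integral => //.
- by move=> z _; rewrite -EFinM lee_fin mulr_ge0 ?radial_above_ge0 //
    exprn_ge0 // exprn_ge0 // ltW.
- apply: emeasurable_funM => //.
  by apply/measurable_EFinP; exact: measurable_radial_above.
- by apply/measurable_EFinP; exact: measurable_radial.
- move=> z _; rewrite -EFinM lee_fin /above.
  case: (leP Y (sqn z)) => Yz; last by rewrite !mulr0 radial_ge0.
  rewrite mulr1 /radial mulnDr exprD [leLHS]mulrA ler_wpM2r ?weight_ge0 //.
  rewrite mulrC ler_wpM2l ?exprn_ge0 ?sqn_ge0 // -exprM.
  by rewrite lerXn2r ?nnegrE ?sqn_ge0 // ltW.
Qed.

(* Under the weight [radial (n.-1 + s)] the variable [sqn z ^+ 2] has mean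
   [ratio (n + s)] and relative variance at most [3 / n]. *)
Lemma tail_Chebyshev s Y dl : 0 < Y -> 0 < dl < 1 -> 6 <= n%:R * dl ^+ 2 ->
  Y ^+ 2 <= ratio (n + s) * (1 - dl) ->
  2^-1 * (1 + dl) ^- s * \prod_(i < s) (ratio (n + i) / ratio (n + s))
  <= tail n.-1 Y / rmoment n.-1.
Proof.
move=> Y0 /andP[dl0 dl1] ndl Yr.
set r := ratio (n + s); have r0 : 0 < r by rewrite ratio_gt0 // addn_gt0 n_gt0.
set N := (n.-1 + s)%N.
have NE : (N.+1 = n + s)%N by rewrite /N -addSn prednK.
(* With u = |z|^4, [A] bounds u^s where |u - r| <= dl r, and C (u - r)^2 >= 1 elsewhere. *)
pose A := (r * (1 + dl)) ^+ s; pose C := (dl * r) ^- 2.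
have A0 : 0 < A by rewrite exprn_gt0 // mulr_gt0 // addr_gt0.
have C0 : 0 < C by rewrite invr_gt0 exprn_gt0 // mulr_gt0.
have I1 := @integral_lincomb3 _ _ mu2 _ _ _ A C (C * r ^+ 2) _ _ _
  (measurable_radial_above n.-1 Y) (measurable_radial N.+2) (measurable_radial N)
  (radial_above_ge0 _ _) (radial_ge0 _) (radial_ge0 _)
  (ltW A0) (ltW C0) (mulr_ge0 (ltW C0) (sqr_ge0 _))
  (integral_radial_above _ _) (integral_radial _) (integral_radial _).
have I2 := @integral_lincomb3 _ _ mu2 _ _ _ 1 (C * (2 * r)) 0 _ _ _
  (measurable_radial N) (measurable_radial N.+1) (measurable_radial N)
  (radial_ge0 _) (radial_ge0 _) (radial_ge0 _)
  ler01 (mulr_ge0 (ltW C0) (mulr_ge0 (ler0n _ 2) (ltW r0))) (lexx 0)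
  (integral_radial _) (integral_radial _) (integral_radial _).
have mN := rmoment_gt0 N; have mn := rmoment_gt0 n.-1.
(* The integral against [radial n.-1] of u^s <= A 1(Y <= |z|^2) + C u^s (u - r)^2, with the cross
   term moved to the left. *)
have I : rmoment N + C * (2 * r) * rmoment N.+1 <=
    A * tail n.-1 Y + C * rmoment N.+2 + C * r ^+ 2 * rmoment N.
  rewrite -[leLHS]addr0 -[X in _ + X <= _](mul0r (rmoment N)) -{1}[rmoment N]mul1r.
  rewrite -lee_fin -I1 -I2; apply: ge0_le_integral => //.
  - move=> z _; rewrite lee_fin mul0r addr0 mul1r addr_ge0 ?radial_ge0 //.
    exact: (mulr_ge0 (mulr_ge0 (ltW C0) (mulr_ge0 (ler0n _ 2) (ltW r0)))
                     (radial_ge0 _ _)).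
  - apply/measurable_EFinP; apply: measurable_funD; [apply: measurable_funD|];
      by apply: measurable_funM => //; exact: measurable_radial.
  - apply/measurable_EFinP; apply: measurable_funD; [apply: measurable_funD|];
      apply: measurable_funM => //; try exact: measurable_radial.
    exact: measurable_radial_above.
  - move=> z _; rewrite lee_fin mul0r addr0 mul1r.
    set u := sqn z ^+ 2; have u0 : 0 <= u by exact: sqr_ge0.
    have rE k : radial (n.-1 + k) z = radial n.-1 z * u ^+ k.
      by rewrite /radial mulnDr exprD (exprM _ 2 k) -/u mulrAC.
    rewrite /N -!addnS !rE; have := radial_ge0 n.-1 z.
    move: (radial n.-1 z) => w w0.
    rewrite -subr_ge0 (_ : _ - _ =
      w * (A * above Y z + u ^+ s * (C * (u - r) ^+ 2 - 1))); last first.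
      by rewrite !exprSr; ring.
    rewrite mulr_ge0 //.
    have us0 : 0 <= u ^+ s by exact: exprn_ge0.
    have [far|near] := ltP (dl * r) `|u - r|.
      have h1 : 1 <= C * (u - r) ^+ 2.
        have pos : 0 < (dl * r) ^+ 2 by rewrite exprn_gt0 // mulr_gt0.
        rewrite /C mulrC (ler_pdivlMr _ _ pos) mul1r.
        rewrite -(real_normK (num_real (u - r))).
        by rewrite lerXn2r ?nnegrE ?(mulr_ge0 (ltW dl0) (ltW r0)) // ltW.
      rewrite addr_ge0 ?(mulr_ge0 (ltW A0)) // mulr_ge0 //; lra.
    have /andP[n1 n2] : - (dl * r) <= u - r <= dl * r by rewrite -ler_norml.
    have Yz : Y <= sqn z.
      rewrite -(@ler_pXn2r _ 2) ?nnegrE ?sqn_ge0 ?(ltW Y0) //.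
      by apply: (le_trans Yr); rewrite -/r -/u; lra.
    rewrite /above Yz mulr1 mulrBr mulr1 addrCA addr_ge0 //.
      exact: (mulr_ge0 us0 (mulr_ge0 (ltW C0) (sqr_ge0 _))).
    have rd : 0 <= r * (1 + dl) by rewrite (mulr_ge0 (ltW r0)) // addr_ge0 // ltW.
    by rewrite subr_ge0 /A lerXn2r ?nnegrE //; lra.
have e1 : rmoment N.+1 = r * rmoment N by rewrite rmomentS NE -/(ratio _).
have e2 : rmoment N.+2 = ratio (n + s).+1 * (r * rmoment N).
  by rewrite rmomentS e1 NE -/(ratio _).
(* Consecutive ratios differ by a relative amount at most 3/n, so the Chebyshev bound is 3/(n dl^2)
   <= 1/2; this is the origin of the constant 6 and of the factor 1/2 in the conclusion. *)
have var : C * (r * (ratio (n + s).+1 - r)) <= 2^-1.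
  have n0 : 0 < n%:R :> R by rewrite ltr0n.
  have h : ratio (n + s).+1 - r <= 3 / n%:R * r.
    have a1 : n%:R <= (n + s)%:R :> R by rewrite ler_nat leq_addr.
    have a2 : 1 <= n%:R :> R by rewrite ler1n.
    rewrite /r /ratio !natrX !natrM !(natrD _ _ v) -(natr1 (n + s)).
    have v0 := ler0n R v.
    move: (n%:R : R) ((n + s)%:R : R) (v%:R : R) n0 a1 a2 v0 => x y w x0 xy x1 w0.
    rewrite -mulrBl mulrA ler_wpM2r ?invr_ge0 ?sqr_ge0 //.
    rewrite mulrAC ler_pdivlMr //; nra.
  apply: (@le_trans _ _ (C * (r * (3 / n%:R * r)))).
    by rewrite ler_wpM2l ?(ltW C0) // ler_wpM2l ?(ltW r0).
  have -> : C * (r * (3 / n%:R * r)) = 3 / (n%:R * dl ^+ 2).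
    by rewrite /C; field; rewrite !gt_eqF.
  rewrite ler_pdivrMr; last by rewrite mulr_gt0 // exprn_gt0.
  by lra.
have key : rmoment N / 2 <= A * tail n.-1 Y.
  have := ler_wpM2r (ltW mN) var; move: I; rewrite e1 e2.
  by move: (rmoment N) (tail n.-1 Y) (ratio _) => M t r'; nra.
rewrite ler_pdivlMr //.
have -> : 2^-1 * (1 + dl) ^- s * \prod_(i < s) (ratio (n + i) / r) * rmoment n.-1
    = rmoment N / 2 / A.
  rewrite big_split /= prodr_const card_ord /N rmomentD /A exprMn.
  rewrite [in RHS](eq_bigr (fun i : 'I_s => ratio (n + i))); last first.
    by move=> i _; rewrite -addSn prednK.
  rewrite exprVn invfM.
  move: (\prod_(i < s) _) (_ ^- s) (_ ^- s) => p a b; ring.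
by rewrite ler_pdivrMr // [leRHS]mulrC.
Qed.

End RadialTails.

(** * From the radial tails to the probability that the maximum is large *)

Section MaximumProbability.
Context {R : realType}.
Local Notation plane := (measurableTypeR R * measurableTypeR R)%type.
Local Notation mu2 := ((@lebesgue_measure R) \x (@lebesgue_measure R))%E.

(** The union bound for independent events with probabilities q k. *)
Lemma onem_prod_le_sum m (q : nat -> R) : (forall k, 0 <= q k <= 1) ->
  1 - \prod_(k < m) (1 - q k) <= \sum_(k < m) q k.
Proof.
move=> q01; elim: m => [|m IH]; first by rewrite !big_ord0 subrr.
rewrite !big_ord_recr /=; have /andP[q0 q1] := q01 m.
have P1 : \prod_(k < m) (1 - q k) <= 1.
  apply: prodr_ile1 => k _; have /andP[h0 h1] := q01 k.
  by apply/andP; split; lra.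
move: (\prod_(k < m) _) (\sum_(k < m) _) IH P1 => P S IH P1.
have : 0 <= (1 - P) * q m by rewrite mulr_ge0 // subr_ge0.
by lra.
Qed.

(** The union of independent events contains the last one. *)
Lemma le_onem_prod m (q : nat -> R) : (forall k, 0 <= q k <= 1) ->
  q m <= 1 - \prod_(k < m.+1) (1 - q k).
Proof.
move=> q01; rewrite big_ord_recr /=; have /andP[q0 q1] := q01 m.
have P1 : \prod_(k < m) (1 - q k) <= 1.
  apply: prodr_ile1 => k _; have /andP[h0 h1] := q01 k.
  by apply/andP; split; lra.
have : \prod_(k < m) (1 - q k) * (1 - q m) <= 1 * (1 - q m).
  by rewrite ler_wpM2r // subr_ge0.
by lra.
Qed.

Section Hitting.
Variable n : nat.
Implicit Types (b : plane -> bool) (s : n.-tuple plane).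

(** The indicator that some coordinate satisfies b, in a form whose complement is a product over
    coordinates, as [integral_core_radial] requires. *)
Definition hit b s : R := 1 - \prod_(j < n) (1 - (b (tnth s j))%:R).

Lemma hitE b s : hit b s = [exists j, b (tnth s j)]%:R.
Proof.
rewrite /hit; case: existsP => [[j bj]|h].
  by rewrite (bigD1 j) //= bj subrr mul0r subr0.
rewrite big1 ?subrr // => j _; case: (boolP (b _)) => [bj|_]; last by rewrite subr0.
by case: h; exists j.
Qed.

Lemma hit_ge0 b s : 0 <= hit b s.
Proof. by rewrite hitE. Qed.

Lemma measurable_hit b : measurable_fun setT (fun z => (b z)%:R : R) ->
  measurable_fun setT (hit b).
Proof.
move=> mb; apply: measurable_funB => //; apply: measurable_prod => j _.
apply: measurable_funB => //.
by apply: (measurableT_comp mb); exact: measurable_tnth.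
Qed.

Lemma le_hit b b' s : (forall z, b z -> b' z) -> hit b s <= hit b' s.
Proof.
move=> bb'; rewrite !hitE; case: existsP => [[j /bb' bj]|_]; last exact: ler0n.
by rewrite (_ : [exists j, b' _] = true) //; apply/existsP; exists j.
Qed.

End Hitting.

Definition far (Y : R) (z : plane) : bool := Y <= sqn z.
(** The absolute value makes the event invariant under z -> -z, so that it extends from the right
    half-plane to the whole plane. *)
Definition wide (x : R) (z : plane) : bool := x <= `|z.1 : R|.

Lemma measurable_far Y : measurable_fun setT (fun z => (far Y z)%:R : R).
Proof. exact: measurable_above. Qed.

Lemma measurable_wide x : measurable_fun setT (fun z => (wide x z)%:R : R).
Proof.
apply: (@measurableT_comp _ _ _ _ _ _ (fun b : bool => b%:R : R)) => //.
have m1 : measurable_fun setT (fun z : plane => `|z.1 : R|).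
  by apply: (measurableT_comp (@normr_measurable R setT)); exact: measurable_fst2.
exact: (measurable_fun_ler (f := fun=> x) _ m1).
Qed.

Lemma wide_far x z : 0 <= x -> wide x z -> far (x ^+ 2) z.
Proof.
move=> x0 xz; rewrite /far /sqn.
apply: (@le_trans _ _ (`|z.1 : R| ^+ 2)).
  by rewrite lerXn2r ?nnegrE ?normr_ge0.
by rewrite real_normK ?num_real // lerDl sqr_ge0.
Qed.

(* Some rotation by a multiple of pi/n brings z within the angle pi/n of the
   real axis. *)
Lemma far_wide_rot n y z : (1 < n)%N -> 0 <= y -> far (y ^+ 2) z ->
  exists l : 'I_n.+1, wide (cos (pi / n%:R) * y) (rot (pi / n%:R * l%:R) z).
Proof.
move=> n1 y0 yz.
have n0 : 0 < n%:R :> R by rewrite ltr0n ltnW.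
have p0 := pi_gt0 R.
set a := pi / n%:R; have a0 : 0 < a by rewrite divr_gt0.
have api : a <= pi / 2.
  by rewrite ler_wpM2l ?(ltW p0) // lef_pV2 ?posrE // ler_nat.
have c0 : 0 <= cos a.
  by rewrite cos_ge0_pihalf // api andbT; lra.
(* The claim is even in z. From the lower half-plane the counterclockwise rotations lead towards the
   positive real axis. *)
wlog im : z yz / (z.2 : R) <= 0.
  move=> W; have [|im] := leP (z.2 : R) 0; first exact: W.
  have [||l] := W (opp_plane z).
  - by rewrite /far (sqn_flip true z).
  - by rewrite /= oppr_le0 ltW.
  rewrite /wide /rot /lin2 /= => wl; exists l; move: wl.
  by rewrite /wide /rot /lin2 /= !mulrN -opprD normrN.
set r := Num.sqrt (sqn z).
have yr : y <= r.
  by rewrite -(ger0_norm y0) -sqrtr_sqr ler_wsqrtr.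
have r2 : r ^+ 2 = sqn z by rewrite sqr_sqrtr // sqn_ge0.
have [r0|r0] := eqVneq r 0.
  have y00 : y = 0 by apply/eqP; rewrite eq_le y0 -r0 yr.
  by exists ord0; rewrite /wide y00 mulr0.
have rp : 0 < r by rewrite lt_neqAle eq_sym r0 sqrtr_ge0.
pose u : R := (z.1 : R) / r; pose psi := acos u.
have u2 : u ^+ 2 <= 1.
  rewrite exprMn exprVn ler_pdivrMr ?exprn_gt0 // mul1r r2.
  by rewrite lerDl sqr_ge0.
have u1 : -1 <= u <= 1.
  by rewrite -ler_norml -(@ler_pXn2r _ 2) ?nnegrE // expr1n real_normK ?num_real.
have xE : (z.1 : R) = r * cos psi.
  by rewrite acosK // /u mulrC mulfVK.
have yE : (z.2 : R) = - (r * sin psi).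
  have E : r * Num.sqrt (1 - u ^+ 2) = Num.sqrt ((z.2 : R) ^+ 2).
    rewrite -{1}(ger0_norm (ltW rp)) -sqrtr_sqr -sqrtrM ?sqr_ge0 //.
    congr Num.sqrt; rewrite mulrBr mulr1 -exprMn /u mulrC divfK // r2.
    by rewrite /sqn addrC addKr.
  by rewrite sin_acos // E sqrtr_sqr ler0_norm // opprK.
have psi0 : 0 <= psi by exact: acos_ge0.
have psipi : psi <= pi by exact: acos_lepi.
(* The argument of z is -psi, and k is the last rotation that does not pass the positive axis. Since
   psi <= pi, k <= n, hence n+1 candidates. *)
pose k := Num.truncn (psi / a).
have /andP[k1 k2] : k%:R <= psi / a < k.+1%:R.
  by apply: truncn_itv; rewrite divr_ge0 // ltW.
have kn : (k < n.+1)%N.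
  rewrite ltnS -(ler_nat R) (le_trans k1) // ler_pdivrMr //.
  by rewrite /a mulrCA mulfV ?mulr1 // gt_eqF.
exists (Ordinal kn); rewrite /wide /rot /lin2 /= xE yE -/a.
have -> : cos (a * k%:R) * (r * cos psi) + - sin (a * k%:R) * - (r * sin psi)
   = r * cos (psi - a * k%:R) by rewrite cosB; ring.
have d0 : 0 <= psi - a * k%:R by rewrite subr_ge0 mulrC -ler_pdivlMr.
have d1 : psi - a * k%:R <= a.
  rewrite lerBlDr -[X in X + _]mulr1 -mulrDr addrC natr1 mulrC -ler_pdivrMr //.
  exact: ltW.
have cc : cos a <= cos (psi - a * k%:R).
  rewrite leNgt ltr_cos ?in_itv /= -?leNgt //; apply/andP; split; lra.
rewrite ger0_norm; last by rewrite mulr_ge0 ?(ltW rp) // (le_trans c0).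
by rewrite mulrC ler_pM.
Qed.

Section Probability.
Variables (n v : nat).
Hypothesis n_gt0 : (0 < n)%N.

Definition total : R := n`!%:R * \prod_(k < n) rmoment n v k.

Lemma total_gt0 : 0 < total.
Proof.
rewrite mulr_gt0 ?ltr0n ?fact_gt0 // prodr_gt0 // => k _.
exact: rmoment_gt0.
Qed.

Lemma integral_core :
  integral_Cn (fun s : n.-tuple plane => (core v s)%:E) = total%:E.
Proof.
have := @integral_core_radial R n v (fun=> 1) n_gt0 (measurable_cst _)
  (fun=> ler01) (fun _ _ => erefl).
rewrite (eq_integral_Cn (g := fun s : n.-tuple plane => (core v s)%:E)); last first.
  by move=> s; rewrite big1 // mulr1.
move=> ->; rewrite /total EFinM -prodEFin; congr (_ * _)%E.
apply: eq_bigr => k _; rewrite -integral_radial //.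
by apply: eq_integral => z _; rewrite mulr1.
Qed.

Lemma integral_core_below Y :
  integral_Cn (fun s : n.-tuple plane =>
    (core v s * \prod_(j < n) (1 - (far Y (tnth s j))%:R))%:E) =
  (n`!%:R * \prod_(k < n) (rmoment n v k - tail n v k Y))%:E.
Proof.
rewrite (@integral_core_radial R n v (fun z => 1 - (far Y z)%:R)) //.
- rewrite EFinM -prodEFin; congr (_ * _)%E; apply: eq_bigr => k _.
  by rewrite -integral_radial_below.
- by apply: measurable_funB => //; exact: measurable_far.
- by move=> z; case: far; rewrite ?subrr ?subr0.
- by move=> th z; rewrite /far sqn_rot.
Qed.

(** The complementary event constrains each modulus separately, so its integral factorises: the
    moduli behave as if independent. *)
Lemma integral_core_hit_far Y :
  integral_Cn (fun s : n.-tuple plane => (core v s * hit (far Y) s)%:E) =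
  (total * (1 - \prod_(k < n) (1 - tail n v k Y / rmoment n v k)))%:E.
Proof.
have tm k : 0 < rmoment n v k :> R by exact: rmoment_gt0.
have -> : total * (1 - \prod_(k < n) (1 - tail n v k Y / rmoment n v k)) =
  total - n`!%:R * \prod_(k < n) (rmoment n v k - tail n v k Y).
  rewrite mulrBr mulr1 /total -mulrA -big_split /=; congr (_ - _ * _).
  by apply: eq_bigr => k _; field; rewrite gt_eqF.
rewrite EFinB -integral_core_below -integral_core.
set I := integral_Cn (fun s => (core v s * \prod_(_ < _) _)%:E).
have If : I \is a fin_num by rewrite /I integral_core_below.
rewrite -[LHS](addeK _ If); congr (_ - _)%E; rewrite -integral_CnD.
- apply: eq_integral_Cn => s; rewrite -EFinD; congr _%:E; rewrite /hit; ring.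
- apply/measurable_EFinP; apply: measurable_funM; first exact: measurable_core.
  by apply: measurable_hit; exact: measurable_far.
- apply/measurable_EFinP; apply: measurable_funM; first exact: measurable_core.
  apply: measurable_prod => j _; apply: measurable_funB => //.
  by apply: (measurableT_comp (measurable_far Y)); exact: measurable_tnth.
- by move=> s; rewrite lee_fin mulr_ge0 ?core_ge0 ?hit_ge0.
- move=> s; rewrite lee_fin mulr_ge0 ?core_ge0 // prodr_ge0 // => j _.
  by case: far; rewrite ?subrr ?subr0.
Qed.

Definition reach_integral x : \bar R :=
  integral_Cn (fun s : n.-tuple plane => (core v s * hit (wide x) s)%:E).

Lemma measurable_core_hit (b : plane -> bool) :
  measurable_fun setT (fun z => (b z)%:R : R) ->
  measurable_fun setT (fun s : n.-tuple plane => core v s * hit b s).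
Proof.
by move=> mb; apply: measurable_funM; [exact: measurable_core|exact: measurable_hit].
Qed.

Lemma core_hit_ge0 (b : plane -> bool) (s : n.-tuple plane) : 0 <= core v s * hit b s.
Proof. by rewrite mulr_ge0 ?core_ge0 ?hit_ge0. Qed.

Lemma reach_integral_le x : 0 <= x ->
  (reach_integral x <=
   (total * (1 - \prod_(k < n) (1 - tail n v k (x ^+ 2) / rmoment n v k)))%:E)%E.
Proof.
move=> x0; rewrite -integral_core_hit_far; apply: le_integral_Cn.
- by apply/measurable_EFinP; apply: measurable_core_hit; exact: measurable_wide.
- by apply/measurable_EFinP; apply: measurable_core_hit; exact: measurable_far.
- by move=> s; rewrite lee_fin core_hit_ge0.
- move=> s; rewrite lee_fin ler_wpM2l ?core_ge0 //; apply: le_hit => z.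
  exact: wide_far.
Qed.

(** A common rotation of all coordinates leaves [core] invariant, so the n+1 rotated events have
    equal integrals. They cover the event on the moduli, since it suffices to bring one far
    coordinate near the real axis. *)
Lemma reach_integral_ge y : (1 < n)%N -> 0 <= y ->
  ((total * (1 - \prod_(k < n) (1 - tail n v k (y ^+ 2) / rmoment n v k)))%:E
   <= n.+1%:R%:E * reach_integral (cos (pi / n%:R) * y))%E.
Proof.
move=> n1 y0; set x := cos _ * y; rewrite -integral_core_hit_far.
pose th (l : 'I_n.+1) : R := pi / n%:R * l%:R.
pose f (s : n.-tuple plane) := core v s * hit (wide x) s.
have mf : measurable_fun setT f by apply: measurable_core_hit; exact: measurable_wide.
have mr l : measurable_fun setT
    (fun s : n.-tuple plane => f (map_coord (fun=> rot (th l)) s)).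
  apply: (measurableT_comp mf); apply: measurable_map_coord => i.
  exact: measurable_rot.
have sE : (n.+1%:R%:E * reach_integral x = \sum_(l < n.+1)
    integral_Cn (fun s : n.-tuple plane => (f (map_coord (fun=> rot (th l)) s))%:E))%E.
  transitivity (\sum_(l < n.+1) reach_integral x)%E.
    by rewrite sumr_const card_ord mule_natl.
  apply: eq_bigr => l _; symmetry.
  apply: (@integral_Cn_map_coord _ _ (fun=> rot (th l)) (EFin \o f)).
  - by move=> i; exact: measurable_rot.
  - by move=> i G mG G0; exact: integral_rot.
  - exact/measurable_EFinP.
  - by move=> s; rewrite lee_fin core_hit_ge0.
rewrite sE -integral_Cn_sum; last 2 first.
- by move=> l; apply/measurable_EFinP.
- by move=> l s; rewrite lee_fin core_hit_ge0.
apply: le_integral_Cn.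
- by apply/measurable_EFinP; apply: measurable_core_hit; exact: measurable_far.
- by apply: emeasurable_sum => l; apply/measurable_EFinP.
- by move=> s; rewrite lee_fin core_hit_ge0.
- move=> s; rewrite sumEFin lee_fin hitE; case: existsP => [[j fj]|_]; last first.
    by rewrite mulr0 sumr_ge0 // => l _; exact: core_hit_ge0.
  have [l wl] := far_wide_rot n1 y0 fj.
  have fl : f (map_coord (fun=> rot (th l)) s) = core v s * 1.
    rewrite /f core_rot hitE.
    have -> // : [exists j, wide x (tnth (map_coord (fun=> rot (th l)) s) j)] = true.
    by apply/existsP; exists j; rewrite tnth_mktuple.
  rewrite -fl (bigD1 l) //=; apply: ler_wpDr; last exact: lexx.
  by apply: sumr_ge0 => i _; exact: core_hit_ge0.
Qed.

(** The event is exchangeable, so the density gives its probability. The full event identifies the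
    unknown constant as 2^n / [total], and the powers of 2 cancel after unfolding to the whole of
    C^n. *)
Lemma reach_probability d (T : measurableType d) (Pr : probability T R)
    (sigma : T -> 'I_n -> R[i]) (x : R) :
  has_dirac_density Pr v sigma -> 0 < x ->
  (Pr [set w | exists i, (x <= complex.Re (sigma w i))%R] =
   (total^-1)%:E * reach_integral x)%E.
Proof.
case=> c c0 dens x0; have t0 := total_gt0.
pose B : set (n.-tuple plane) := [set p | exists i, x <= ((tnth p i).1 : R)].
pose b (z : plane) := x <= (z.1 : R).
have mb : measurable_fun setT (fun z => (b z)%:R : R).
  apply: (@measurableT_comp _ _ _ _ _ _ (fun b : bool => b%:R : R)) => //.
  exact: (measurable_fun_ler (f := fun=> x) _ measurable_fst2).
have BE : B = hit b @^-1` [set 1].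
  apply/seteqP; split=> p /=; rewrite hitE.
    by case=> i xi; rewrite (_ : [exists j, _] = true) //; apply/existsP; exists i.
  case: existsP => [[i xi] _|_ /eqP]; first by exists i.
  by rewrite eq_sym oner_eq0.
have mB : measurable B.
  by rewrite BE -[X in measurable X]setTI; apply: measurable_hit.
have exB : exchangeable_set B.
  move=> s p [i xi]; exists ((s^-1)%g i).
  by rewrite tnth_mktuple permKV.
have exT : exchangeable_set [set: n.-tuple plane] by [].
have mrc (f : n.-tuple plane -> R) : measurable_fun setT f ->
    measurable_fun setT (fun s => ((right_half s)%:E * (f s)%:E)%E).
  move=> mf; apply: emeasurable_funM; apply/measurable_EFinP => //.
  exact: measurable_right_half.
have mch := measurable_core_hit (measurable_wide x).
have E1 : (total%:E =
    (2 ^+ n)%:E * integral_Cn (fun s : n.-tuple plane => (right_half s)%:E * (core v s)%:E))%E.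
  rewrite -integral_core.
  apply: (integral_Cn_right_half (f := fun s : n.-tuple plane => (core v s)%:E)).
  - by apply/measurable_EFinP; exact: measurable_core.
  - by move=> s; rewrite lee_fin core_ge0.
  - by move=> e s; rewrite core_flip.
have E2 : (reach_integral x = (2 ^+ n)%:E *
    integral_Cn (fun s : n.-tuple plane => (right_half s)%:E * (core v s * hit (wide x) s)%:E))%E.
  apply: (integral_Cn_right_half
    (f := fun s : n.-tuple plane => (core v s * hit (wide x) s)%:E)).
  - exact/measurable_EFinP.
  - by move=> s; rewrite lee_fin core_hit_ge0.
  - move=> e s; rewrite core_flip !hitE; congr (_ * _%:R)%:E.
    congr (nat_of_bool _); apply: eq_existsb => j; rewrite tnth_mktuple /wide.
    by case: (e j) => //=; rewrite normrN.
have P1 : (c%:E * integral_Cn (fun s : n.-tuple plane =>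
    (right_half s)%:E * (core v s)%:E) = 1)%E.
  have := dens setT measurableT exT.
  rewrite (_ : [set w | _] = setT); last by apply/seteqP.
  rewrite probability_setT => ->; congr (_ * _)%E; apply: eq_integral_Cn => s.
  by rewrite indicE in_setT mulr1 dirac_densityE EFinM.
have P2 : (Pr [set w | exists i, (x <= complex.Re (sigma w i))%R] =
    c%:E * integral_Cn (fun s : n.-tuple plane =>
      (right_half s)%:E * (core v s * hit (wide x) s)%:E))%E.
  have := dens B mB exB.
  rewrite (_ : [set w | _] = [set w | exists i, x <= complex.Re (sigma w i)]);
    last first.
    apply/seteqP; split=> w [j xj]; exists j; move: xj; rewrite tnth_mktuple //.
  move=> ->; congr (_ * _)%E; apply: eq_integral_Cn => s.
  rewrite dirac_densityE -EFinM -mulrA; congr _%:E.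
  rewrite /right_half.
  (* On the right half-planes Re z and its absolute value agree; off them both sides vanish. *)
  case: (boolP [forall j, 0 < ((tnth s j).1 : R)]) => [/forallP h|].
    congr (_ * (_ * _)); rewrite BE indicE hitE.
    have -> : [exists j, wide x (tnth s j)] = [exists j, b (tnth s j)].
      by apply: eq_existsb => j; rewrite /wide gtr0_norm.
    congr (nat_of_bool _)%:R.
    apply/idP/idP; rewrite inE /= hitE; first by case: [exists j, _] => // /eqP;
      rewrite eq_sym oner_eq0.
    by move=> ->.
  rewrite negb_forall => /existsP[j hj].
  by rewrite (bigD1 j) //= (negbTE hj) !mul0r.
have tw : 2 ^+ n != 0 :> R by rewrite expf_neq0.
have cE : c = 2 ^+ n / total.
  (* An infinite I would contradict the finiteness of [total] in [E1]. *)
  move: E1 P1; set I := integral_Cn _.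
  case: I => [r| |].
  - rewrite -!EFinM => -[-> [cr]].
    have r0 : r != 0 by apply/eqP => r0; move: cr; rewrite r0 mulr0 => /eqP;
      rewrite eq_sym oner_eq0.
    by rewrite invfM mulrA mulfV // mul1r -[LHS]mulr1 -(mulfV r0) mulrA cr mul1r.
  - by rewrite mulry gtr0_sg ?exprn_gt0 // mul1e.
  - by rewrite mulrNy gtr0_sg ?exprn_gt0 // mul1e.
by rewrite P2 E2 muleA -EFinM cE mulrC.
Qed.

End Probability.
End MaximumProbability.

(** * Explicit two-sided bounds for the scaled maximum *)

Section MaximumBounds.
Context {R : realType}.

Definition rho (g u : R) : R := (1 + u) * (1 + g * u).

Lemma rho_gt0 g u : 0 <= g -> 0 <= u -> 0 < rho g u.
Proof. by move=> g0 u0; rewrite mulr_gt0 // ltr_wpDr ?mulr_ge0. Qed.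

(* With u = i/n and g = n/(n+v), [rho g u] is the ratio M(n+i) / M(n+i-1) of
   consecutive moments times g; the t^4 absorbs this normalisation. *)
Lemma max_Re_bounds (n v : nat) d (T : measurableType d) (Pr : probability T R)
    (sigma : T -> 'I_n -> R[i]) (t : R) :
  (0 < n)%N -> has_dirac_density Pr v sigma -> 0 < t ->
  let g := n%:R / (n + v)%:R in
  exists p : R,
    [/\ Pr [set w | t <= scaled_max v (sigma w)] = p%:E,
        forall s : nat, p <= n%:R * \prod_(i < s) (rho g (i%:R / n%:R) / t ^+ 4)
      & forall (s : nat) (dl : R), (1 < n)%N -> 0 < dl < 1 ->
          6 <= n%:R * dl ^+ 2 -> 0 < cos (pi / n%:R) :> R ->
          (t / cos (pi / n%:R)) ^+ 4 <= rho g (s%:R / n%:R) * (1 - dl) ->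
          n.+1%:R^-1 * (2^-1 * (1 + dl) ^- s *
            \prod_(i < s) (rho g (i%:R / n%:R) / rho g (s%:R / n%:R))) <= p].
Proof.
move=> n0 dens t0 g.
have nr : 0 < n%:R :> R by rewrite ltr0n.
have nv0 : 0 < (n + v)%:R :> R by rewrite ltr0n addn_gt0 n0.
have g0 : 0 < g by rewrite divr_gt0.
pose kap := g `^ (4^-1); have kap0 : 0 < kap by rewrite powR_gt0.
have kap4 : kap ^+ 4 = g.
  by rewrite -powR_mulrn ?powR_ge0 // -powRrM mulVf // powRr1 // ltW.
pose x := t / kap; have x0 : 0 < x by rewrite divr_gt0.
have x4 : x ^+ 4 = t ^+ 4 / g by rewrite expr_div_n kap4.
have ratioE i : ratio n v (n + i) = rho g (i%:R / n%:R) / g.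
  rewrite /ratio /rho /g natrX !natrM !natrD; field.
  by rewrite -natrD gt_eqF // gt_eqF.
have setE : [set w | t <= scaled_max v (sigma w)] =
    [set w | exists i, x <= complex.Re (sigma w i)].
  apply/seteqP; split=> w /=; rewrite /scaled_max -/g -/kap mulrC -ler_pdivrMr //;
    rewrite -/x /max_Re.
    (* The neutral element 0 of the maximum cannot reach the positive threshold x. *)
    by case/bigmax_geP => [|[i _ xi]]; [rewrite leNgt x0|exists i].
  by case=> i xi; apply/bigmax_geP; right; exists i.
have tot0 := @total_gt0 R n v n0.
pose q k : R := tail n v k (x ^+ 2) / rmoment n v k.
have q01 (Y : R) k : 0 <= tail n v k Y / rmoment n v k <= 1.
  have m0 := @rmoment_gt0 R n v n0 k.
  by rewrite divr_ge0 ?tail_ge0 ?(ltW m0) //= ler_pdivrMr // mul1r tail_le.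
have le1 := @reach_integral_le R n v n0 x (ltW x0).
have fin : reach_integral n v x \is a fin_num.
  rewrite ge0_fin_numE; first by apply: le_lt_trans le1 _; exact: ltry.
  by apply: integral_Cn_ge0 => s; rewrite lee_fin core_hit_ge0.
pose p : R := (total n v)^-1 * fine (reach_integral n v x).
exists p; split.
- by rewrite setE (reach_probability n0 dens x0) -(fineK fin) -EFinM.
- move=> s; have : p <= 1 - \prod_(k < n) (1 - q k).
    rewrite /p mulrC ler_pdivrMr // mulrC -lee_fin fineK //.
  move/le_trans; apply; apply: (le_trans (onem_prod_le_sum n (q01 _))).
  rewrite (_ : n%:R * _ = \sum_(k < n) \prod_(i < s) (rho g (i%:R / n%:R) / t ^+ 4));
    last by rewrite sumr_const card_ord mulr_natl.
  apply: ler_sum => k _.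
  apply: (le_trans (@tail_Chernoff R n v n0 k s (x ^+ 2) _ _)) => //.
    by rewrite exprn_gt0.
  rewrite le_eqVlt; apply/orP; left; apply/eqP; apply: eq_bigr => i _.
  rewrite ratioE -exprM x4; field.
  by rewrite !gt_eqF // exprn_gt0.
- move=> s dl n1 dl01 ndl c0 hs.
  set c := cos _ in c0 hs *.
  (* The rotation loses the factor c, so the modulus is asked to reach x / c. *)
  pose y := x / c; have y0 : 0 < y by rewrite divr_gt0.
  have := @reach_integral_ge R n v n0 y n1 (ltW y0).
  rewrite -/c (_ : c * y = x); last by rewrite /y mulrC divfK // gt_eqF.
  rewrite -(fineK fin) -EFinM lee_fin => ge1.
  have Yr : (y ^+ 2) ^+ 2 <= ratio n v (n + s) * (1 - dl).
    rewrite ratioE -exprM /y expr_div_n x4 mulrAC.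
    rewrite [leRHS]mulrAC ler_wpM2r ?invr_ge0 ?(ltW g0) //.
    by rewrite -expr_div_n.
  have := @tail_Chebyshev R n v n0 s (y ^+ 2) dl (exprn_gt0 _ y0) dl01 ndl Yr.
  have := @le_onem_prod R n.-1 _ (q01 (y ^+ 2)); rewrite prednK //.
  move=> h1 h2; have {h1 h2} h := le_trans h2 h1.
  rewrite mulrC ler_pdivrMr ?ltr0n //.
  have -> : \prod_(i < s) (rho g (i%:R / n%:R) / rho g (s%:R / n%:R)) =
      \prod_(i < s) (ratio n v (n + i) / ratio n v (n + s)) :> R.
    apply: eq_bigr => i _; rewrite !ratioE; field.
    by rewrite !gt_eqF // rho_gt0 // ?(ltW g0) // divr_ge0.
  apply: (le_trans h); rewrite /p -mulrA ler_pdivlMl //.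
  by rewrite [fine _ * _]mulrC.
Qed.

End MaximumBounds.

(** * Asymptotics of the bounds *)

Section Rate.
Context {R : realType}.
Implicit Types (g u x y t : R).

(** The primitive of ln(1+x) that vanishes at 0. *)
Definition psi x : R := (1 + x) * ln (1 + x) - x.
Definition phi g u : R := ln (1 + u) + ln (1 + g * u).
(* A primitive of [phi g]; at [g = 0], where x / 0 = 0, it is still the limit
   of [Phi g u] as g -> 0. *)
Definition Phi g u : R := psi u + psi (g * u) / g.

Lemma psi0 : psi 0 = 0.
Proof. by rewrite /psi addr0 ln1 mulr0 subr0. Qed.

Lemma phi0 g : phi g 0 = 0.
Proof. by rewrite /phi mulr0 addr0 ln1 addr0. Qed.

Lemma Phi0 g : Phi g 0 = 0.
Proof. by rewrite /Phi mulr0 psi0 mul0r addr0. Qed.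

Lemma ln_rho g u : 0 <= g -> 0 <= u -> ln (rho g u) = phi g u.
Proof.
move=> g0 u0; rewrite /rho /phi lnM ?posrE ?ltr_wpDr // mulr_ge0 //.
Qed.

(** The tangent at x lies below the graph; obtained from ln z <= z - 1 at z = (1+x)/(1+y). *)
Lemma psi_convex x y : 0 <= x -> 0 <= y ->
  (y - x) * ln (1 + x) <= psi y - psi x.
Proof.
move=> x0 y0; have x1 : 0 < 1 + x by rewrite ltr_wpDr.
have y1 : 0 < 1 + y by rewrite ltr_wpDr.
have E : (1 + x) / (1 + y) = 1 + (x - y) / (1 + y) by field; rewrite gt_eqF.
have h := @le_ln1Dx R ((x - y) / (1 + y)).
have {}h : ln (1 + x) - ln (1 + y) <= (x - y) / (1 + y).
  rewrite -ln_div ?posrE // E; apply: h.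
  by rewrite -subr_gt0 opprK addrC -E divr_gt0.
have {}h : (1 + y) * (ln (1 + x) - ln (1 + y)) <= x - y.
  by rewrite mulrC -ler_pdivlMr.
by rewrite /psi; move: (ln (1 + x)) (ln (1 + y)) h => a b; lra.
Qed.

Lemma Phi_convex g x y : 0 < g -> 0 <= x -> 0 <= y ->
  (y - x) * phi g x <= Phi g y - Phi g x.
Proof.
move=> g0 x0 y0; have h1 := psi_convex x0 y0.
have h2 := psi_convex (mulr_ge0 (ltW g0) x0) (mulr_ge0 (ltW g0) y0).
have h3 : (y - x) * ln (1 + g * x) <= (psi (g * y) - psi (g * x)) / g.
  rewrite ler_pdivlMr //; apply: le_trans h2.
  by rewrite (_ : _ * g = (g * y - g * x) * ln (1 + g * x)) //; ring.
rewrite /Phi /phi mulrDr; move: h3; rewrite mulrBl; lra.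
Qed.

(** A left Riemann sum of the derivative of [Phi g]: convexity at the left end of each step of
    length 1/n, then telescoping. *)
Lemma sum_phi_le g (n s : nat) : 0 < g -> (0 < n)%N ->
  \sum_(i < s) phi g (i%:R / n%:R) <= n%:R * Phi g (s%:R / n%:R).
Proof.
move=> g0 n0; have nr : 0 < n%:R :> R by rewrite ltr0n.
elim: s => [|s IH]; first by rewrite big_ord0 mul0r Phi0 mulr0.
rewrite big_ord_recr /=.
have h := @Phi_convex g (s%:R / n%:R) (s.+1%:R / n%:R) g0 (divr_ge0 (ler0n _ _) (ltW nr))
  (divr_ge0 (ler0n _ _) (ltW nr)).
have E : s.+1%:R / n%:R - s%:R / n%:R = n%:R^-1 :> R.
  by rewrite -natr1; field; rewrite gt_eqF.
rewrite E mulrC ler_pdivrMr // in h.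
by move: h; rewrite mulrBl; move: IH; rewrite !(mulrC n%:R); lra.
Qed.

(** Convexity at the right end of each step bounds the right Riemann sum from below; shifting it to
    the left one costs exactly one boundary term. *)
Lemma sum_phi_ge g (n s : nat) : 0 < g -> (0 < n)%N ->
  n%:R * Phi g (s%:R / n%:R) - phi g (s%:R / n%:R) <=
  \sum_(i < s) phi g (i%:R / n%:R).
Proof.
move=> g0 n0; have nr : 0 < n%:R :> R by rewrite ltr0n.
elim: s => [|s IH]; first by rewrite big_ord0 mul0r Phi0 mulr0 phi0 subr0.
rewrite big_ord_recr /=.
have h := @Phi_convex g (s.+1%:R / n%:R) (s%:R / n%:R) g0 (divr_ge0 (ler0n _ _) (ltW nr))
  (divr_ge0 (ler0n _ _) (ltW nr)).
have E : s%:R / n%:R - s.+1%:R / n%:R = - n%:R^-1 :> R.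
  by rewrite -natr1; field; rewrite gt_eqF.
rewrite E in h.
have {}h : Phi g (s.+1%:R / n%:R) - Phi g (s%:R / n%:R) <= phi g (s.+1%:R / n%:R) / n%:R.
  by move: h; rewrite mulNr [_^-1 * _]mulrC; lra.
rewrite ler_pdivlMr // in h.
by move: h; rewrite mulrBl; move: IH; rewrite !(mulrC n%:R); lra.
Qed.

Lemma ge0_of_derivative (h dh : R -> R) :
  (forall x, 0 <= x -> is_derive x 1 h (dh x)) ->
  (forall x, 0 <= x -> 0 <= dh x) -> h 0 = 0 -> forall x, 0 <= x -> 0 <= h x.
Proof.
move=> hd d0 h0 x; rewrite le_eqVlt => /orP[/eqP <-|x0]; first by rewrite h0.
have [||c] := @MVT _ h dh 0 x x0.
- by move=> y; rewrite in_itv /= => /andP[y0 _]; apply: hd; exact: ltW.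
- apply: continuous_in_subspaceT => y; rewrite inE /= in_itv /= => /andP[y0 _].
  apply: differentiable_continuous; apply/derivable1_diffP.
  have d := hd y y0; exact: ex_derive.
- rewrite in_itv /= h0 !subr0 => /andP[c0 _] ->.
  by rewrite mulr_ge0 ?d0 // ltW.
Qed.

(** Through x - x^2 <= x/(1+x). A quadratic error is precise enough for the regime d_n -> 0. *)
Lemma ln1D_ge x : 0 <= x -> x - x ^+ 2 <= ln (1 + x).
Proof.
move=> x0; have x1 : 0 < 1 + x by rewrite ltr_wpDr.
have h := @le_ln1Dx R (- (x / (1 + x))).
have E : 1 - x / (1 + x) = (1 + x)^-1 by field; rewrite gt_eqF.
rewrite E lnV ?posrE // in h.
have {}h : x / (1 + x) <= ln (1 + x).
  rewrite -lerN2; apply: h; rewrite ltrN2 ltr_pdivrMr // mul1r; lra.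
apply: le_trans h; rewrite ler_pdivlMr //.
have : 0 <= x ^+ 3 by rewrite exprn_ge0.
by rewrite !exprS expr0; lra.
Qed.

Lemma ln1D_le x : 0 <= x -> ln (1 + x) <= x.
Proof. by move=> x0; apply: le_ln1Dx; lra. Qed.

Lemma is_derive_psi x : 0 <= x -> is_derive x 1 psi (ln (1 + x)).
Proof.
move=> x0; have x1 : 0 < 1 + x by rewrite ltr_wpDr.
have d1 : is_derive x 1 (fun y => ln (1 + y)) (1 + x)^-1.
  have d : is_derive x 1 (fun y => 1 + y) 1.
    by apply: is_derive_eq; rewrite add0r mulr1.
  by rewrite -[X in is_derive _ _ _ X]mulr1; exact: (is_derive1_comp (is_derive1_ln x1) d).
rewrite /psi; apply: is_derive_eq; rewrite /GRing.scale /=.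
by field; rewrite gt_eqF.
Qed.

Lemma psi_le x : 0 <= x -> psi x <= x ^+ 2 / 2.
Proof.
move=> x0; rewrite -subr_ge0; move: x x0.
apply: (@ge0_of_derivative _ (fun x => x - ln (1 + x))).
- move=> x x0; have d := is_derive_psi x0.
  by apply: is_derive_eq; rewrite /GRing.scale /=; field.
- by move=> x x0; rewrite subr_ge0 ln1D_le.
- by rewrite psi0 expr0n /= mul0r subr0.
Qed.

Lemma psi_ge x : 0 <= x -> x ^+ 2 / 2 - x ^+ 3 <= psi x.
Proof.
move=> x0; rewrite -subr_ge0; move: x x0.
apply: (@ge0_of_derivative _ (fun x => ln (1 + x) - x + 3 * x ^+ 2)).
- move=> x x0; have d := is_derive_psi x0.
  by apply: is_derive_eq; rewrite /GRing.scale /=; field.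
- by move=> x x0; have := ln1D_ge x0; have := sqr_ge0 x; lra.
- by rewrite psi0 !expr0n /= mul0r !subr0.
Qed.

Lemma psi_ge0 x : 0 <= x -> 0 <= psi x.
Proof.
apply: (@ge0_of_derivative _ (fun x => ln (1 + x))); last exact: psi0.
- exact: is_derive_psi.
- by move=> y y0; rewrite ln_ge0 // lerDl.
Qed.

End Rate.

(** * Logarithms of the bounds *)

Section LogBounds.
Context {R : realType}.
Implicit Types (g u x y t : R).

Lemma ln_prod (s : nat) (f : nat -> R) : (forall i, 0 < f i) ->
  ln (\prod_(i < s) f i) = \sum_(i < s) ln (f i).
Proof.
move=> f0; elim: s => [|s IH]; first by rewrite !big_ord0 ln1.
by rewrite !big_ord_recr /= lnM ?posrE ?IH // prodr_gt0.
Qed.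

Lemma ln_upper g t p (n s : nat) : 0 < g -> 0 < t -> 0 < p -> (0 < n)%N ->
  p <= n%:R * \prod_(i < s) (rho g (i%:R / n%:R) / t ^+ 4) ->
  ln p <= ln n%:R + n%:R * Phi g (s%:R / n%:R) - s%:R * (4 * ln t).
Proof.
move=> g0 t0 p0 n0; have nr : 0 < n%:R :> R by rewrite ltr0n.
have r0 i : 0 < rho g (i%:R / n%:R) by rewrite rho_gt0 ?(ltW g0) // divr_ge0.
have t4 : 0 < t ^+ 4 by rewrite exprn_gt0.
have f0 i : 0 < rho g (i%:R / n%:R) / t ^+ 4 by rewrite divr_gt0.
have P0 : 0 < \prod_(i < s) (rho g (i%:R / n%:R) / t ^+ 4) by rewrite prodr_gt0.
move=> h; have {}h : ln p <= ln (n%:R * \prod_(i < s) (rho g (i%:R / n%:R) / t ^+ 4)).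
  by rewrite ler_ln ?posrE // mulr_gt0.
apply: (le_trans h); rewrite lnM ?posrE //.
rewrite (@ln_prod s (fun i => rho g (i%:R / n%:R) / t ^+ 4)) // -addrA lerD2l.
rewrite (eq_bigr (fun i : 'I_s => phi g (i%:R / n%:R) - 4 * ln t)); last first.
  move=> i _; rewrite ln_div ?posrE // ln_rho ?(ltW g0) ?divr_ge0 //.
  by rewrite lnXn // -[_ *+ 4]mulr_natl.
rewrite sumrB lerB //; first exact: sum_phi_le.
by rewrite sumr_const card_ord mulr_natl.
Qed.

Lemma ln_lower g dl p (n s : nat) : 0 < g -> 0 < dl -> (1 < n)%N ->
  n.+1%:R^-1 * (2^-1 * (1 + dl) ^- s *
    \prod_(i < s) (rho g (i%:R / n%:R) / rho g (s%:R / n%:R))) <= p ->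
  0 < p /\
  - (3 * ln n%:R) - s%:R * dl + n%:R * Phi g (s%:R / n%:R)
  - phi g (s%:R / n%:R) - s%:R * phi g (s%:R / n%:R) <= ln p.
Proof.
move=> g0 d0 n1; have n0 : (0 < n)%N by exact: ltnW.
have nr : 0 < n%:R :> R by rewrite ltr0n.
have r0 i : 0 < rho g (i%:R / n%:R) by rewrite rho_gt0 ?(ltW g0) // divr_ge0.
have f0 i : 0 < rho g (i%:R / n%:R) / rho g (s%:R / n%:R) by rewrite divr_gt0.
have d1 : 0 < 1 + dl by rewrite addr_gt0.
have P0 : 0 < \prod_(i < s) (rho g (i%:R / n%:R) / rho g (s%:R / n%:R)).
  by rewrite prodr_gt0.
have D0 : 0 < (1 + dl) ^- s by rewrite invr_gt0 exprn_gt0.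
have A0 : 0 < 2^-1 * (1 + dl) ^- s by rewrite mulr_gt0.
move=> h; have p0 : 0 < p.
  by apply: lt_le_trans h; rewrite mulr_gt0 ?invr_gt0 ?ltr0n // mulr_gt0.
split=> //; have Q0 := mulr_gt0 A0 P0.
have N0 : 0 < n.+1%:R^-1 :> R by rewrite invr_gt0 ltr0n.
move: h; rewrite -ler_ln ?posrE ?(mulr_gt0 N0 Q0) //.
apply: le_trans; rewrite lnM ?posrE ?invr_gt0 ?ltr0n ?(mulr_gt0 A0) //.
rewrite (lnM A0 P0) lnM ?posrE // !lnV ?posrE ?ltr0n ?exprn_gt0 //.
rewrite (lnXn _ d1) (@ln_prod s (fun i => rho g (i%:R / n%:R) / rho g (s%:R / n%:R))) //.
rewrite (eq_bigr (fun i : 'I_s => phi g (i%:R / n%:R) - phi g (s%:R / n%:R))); last first.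
  by move=> i _; rewrite ln_div ?posrE // !ln_rho ?(ltW g0) ?divr_ge0.
rewrite sumrB sumr_const card_ord -(mulr_natl (phi g (s%:R / n%:R)) s) -(mulr_natl (ln (1 + dl)) s).
have h1 := sum_phi_ge s g0 n0.
have h2 : s%:R * ln (1 + dl) <= s%:R * dl by rewrite ler_wpM2l // ln1D_le // ltW.
(* The prefactors 1/(n+1) and 1/2 together cost at most 3 ln n once n >= 2. *)
have h3 : ln n.+1%:R <= 2 * ln n%:R :> R.
  rewrite mulr_natl -lnXn // ler_ln ?posrE ?ltr0n ?exprn_gt0 //.
  by rewrite -natrX ler_nat -mulnn (leq_trans _ (leq_mul n1 (leqnn n))) // mul2n -addnn -addn1 leq_add2l.
have h4 : ln 2 <= ln n%:R :> R by rewrite ler_ln ?posrE ?ltr0n // ler_nat.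
by lra.
Qed.

Lemma ln_le_subr1 x : 0 < x -> ln x <= x - 1.
Proof.
move=> x0; have := @le_ln1Dx R (x - 1); rewrite [1 + _]addrC subrK; apply; lra.
Qed.

Lemma onem_cos_le x : 0 <= x -> 1 - cos x <= x.
Proof.
move=> x0; rewrite -subr_ge0; move: x x0.
apply: (@ge0_of_derivative _ _ (fun x => 1 - sin x)).
- move=> x x0; apply: is_derive_eq; rewrite /GRing.scale /=; ring.
- by move=> x _; rewrite subr_ge0 sin_le1.
- by rewrite cos0 subrr subr0.
Qed.

(** After taking logarithms two losses remain: -4 ln cos(pi/n) <= 32/n, from pi <= 4 and 1 - cos x
    <= x with n >= 8 giving cos(pi/n) >= 1/2, and -ln(1 - dl) <= 2 dl. *)
Lemma threshold (g t dl : R) (n s : nat) : 0 < g -> 0 < t -> 0 < dl <= 2^-1 ->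
  (8 <= n)%N ->
  4 * ln t + 32 / n%:R + 2 * dl <= phi g (s%:R / n%:R) ->
  0 < cos (pi / n%:R) :> R /\
  (t / cos (pi / n%:R)) ^+ 4 <= rho g (s%:R / n%:R) * (1 - dl).
Proof.
move=> g0 t0 /andP[d0 d1] n8; have nr : 0 < n%:R :> R by rewrite ltr0n (leq_trans _ n8).
have n8' : 8 <= n%:R :> R by rewrite (ler_nat R 8 n).
have pi4 : pi <= 4 :> R by have := pihalf_lt2 R; lra.
have a0 : 0 <= pi / n%:R :> R by rewrite divr_ge0 ?pi_ge0 // ltW.
have a4 : pi / n%:R <= 4 / n%:R :> R by rewrite ler_pM2r ?invr_gt0.
have a2 : 4 / n%:R <= 2^-1 :> R by rewrite ler_pdivrMr //; lra.
have hc := onem_cos_le a0.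
set c := cos (pi / n%:R) in hc *; have c0 : 2^-1 <= c by lra.
have cp : 0 < c by lra.
move=> h; split=> //.
have r0 : 0 < rho g (s%:R / n%:R) by rewrite rho_gt0 ?(ltW g0) // divr_ge0.
have d2 : 0 < 1 - dl by lra.
rewrite -ler_ln ?posrE ?exprn_gt0 ?divr_gt0 ?mulr_gt0 //.
rewrite lnXn ?divr_gt0 // ln_div ?posrE // lnM ?posrE // ln_rho ?(ltW g0) ?divr_ge0 //.
have h1 : - ln c <= 8 / n%:R.
  rewrite -lnV ?posrE //; apply: (@le_trans _ _ (c^-1 - 1)).
    by rewrite ln_le_subr1 // invr_gt0.
  have : c^-1 - 1 <= 2 * (1 - c).
    rewrite -subr_ge0 (_ : _ - _ = (1 - c) * (2 * c - 1) / c); last first.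
      by field; rewrite gt_eqF.
    by rewrite divr_ge0 ?mulr_ge0 ?(ltW cp) // ?subr_ge0 ?cos_le1 //; lra.
  by lra.
have h2 : - ln (1 - dl) <= 2 * dl.
  rewrite -lnV ?posrE //; apply: (@le_trans _ _ ((1 - dl)^-1 - 1)).
    by rewrite ln_le_subr1 // invr_gt0.
  rewrite -subr_ge0 (_ : _ - _ = dl * (1 - 2 * dl) / (1 - dl)); last first.
    by field; rewrite gt_eqF.
  by rewrite divr_ge0 ?mulr_ge0 ?(ltW d2) ?(ltW d0) //; lra.
rewrite -[_ *+ 4]mulr_natl; first lra.
by rewrite ltr_wpDr // mulr_ge0 ?divr_ge0 // ltW.
Qed.

End LogBounds.

(** * One limit theorem at scale d_n, covering both regimes *)

Section AbstractRate.
Context {R : realType}.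
Implicit Types (dl e eta u : R).
Variables (g d t p : nat -> R) (L us : R) (f F : R -> R).
Hypothesis g0 : forall n, (0 < n)%N -> 0 < g n.
Hypothesis d0 : forall n, (0 < n)%N -> 0 < d n.
Hypothesis t0 : forall n, (0 < n)%N -> 0 < t n.
Hypothesis d1 : \forall n \near \oo, d n <= 1.
Hypothesis d_lim : (fun n => ln n%:R / (n%:R * d n ^+ 2)) @ \oo --> (0 : R).
Hypothesis t_lim : (fun n => 4 * ln (t n) / d n) @ \oo --> L.
Hypothesis p_le : forall n, (0 < n)%N -> forall s,
  p n <= n%:R * \prod_(i < s) (rho (g n) (i%:R / n%:R) / t n ^+ 4).
Hypothesis p_ge : forall n, (0 < n)%N -> forall (s : nat) (dl : R),
  (1 < n)%N -> 0 < dl < 1 -> 6 <= n%:R * dl ^+ 2 -> 0 < cos (pi / n%:R) :> R ->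
  (t n / cos (pi / n%:R)) ^+ 4 <= rho (g n) (s%:R / n%:R) * (1 - dl) ->
  n.+1%:R^-1 * (2^-1 * (1 + dl) ^- s *
    \prod_(i < s) (rho (g n) (i%:R / n%:R) / rho (g n) (s%:R / n%:R))) <= p n.
Hypothesis f_lim : forall (u : R) (w : nat -> R), 0 < u -> w @ \oo --> u ->
  (fun n => phi (g n) (w n * d n) / d n) @ \oo --> f u.
Hypothesis F_lim : forall (u : R) (w : nat -> R), 0 < u -> w @ \oo --> u ->
  (fun n => Phi (g n) (w n * d n) / d n ^+ 2) @ \oo --> F u.
Hypothesis us0 : 0 < us.
Hypothesis f_us : f us = L.
Hypothesis f_gt : forall u, us < u -> L < f u.
Hypothesis f_continuous : f x @[x --> us] --> f us.
Hypothesis F_continuous : F x @[x --> us] --> F us.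

(** Dominated by the sequence of [d_lim], because ln n >= 1 as soon as n >= e. *)
Lemma inv_nd2_cvg : (fun n => (n%:R * d n ^+ 2)^-1) @ \oo --> (0 : R).
Proof.
apply: (@squeeze_cvgr _ _ _ _ (fun=> 0) (fun n => ln n%:R / (n%:R * d n ^+ 2)));
  last 2 first.
- exact: cvg_cst.
- exact: d_lim.
near=> n.
have n0 : (0 < n)%N by near: n; exact: nbhs_infty_gt.
have A0 : 0 < n%:R * d n ^+ 2 by rewrite mulr_gt0 ?exprn_gt0 ?d0 ?ltr0n.
rewrite invr_ge0 (ltW A0) /= -[leLHS]mul1r ler_pM2r ?invr_gt0 //.
rewrite -[leLHS](@expRK R) ler_ln ?posrE ?expR_gt0 ?ltr0n //.
by near: n; exact: nbhs_infty_ger.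
Unshelve. all: by end_near.
Qed.

Lemma inv_nd_cvg : (fun n => (n%:R * d n)^-1) @ \oo --> (0 : R).
Proof.
apply: (@squeeze_cvgr _ _ _ _ (fun=> 0) (fun n => (n%:R * d n ^+ 2)^-1));
  last 2 first.
- exact: cvg_cst.
- exact: inv_nd2_cvg.
near=> n.
have n0 : (0 < n)%N by near: n; exact: nbhs_infty_gt.
have nr : 0 < n%:R :> R by rewrite ltr0n.
have dn := d0 n0; have dn1 : d n <= 1 by near: n.
rewrite invr_ge0 (ltW (mulr_gt0 nr dn)) /= lef_pV2 ?posrE ?mulr_gt0 ?exprn_gt0 //.
by rewrite ler_pM2l // expr2 ler_piMl // (ltW dn).
Unshelve. all: by end_near.
Qed.

(** The number s of factors, for which s/n is approximately u d_n: u is the tilt measured in the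
    scale d_n, and [ulevel] is u after rounding. *)
Definition level u n : nat := Num.truncn (u * (n%:R * d n)).
Definition ulevel u n : R := (level u n)%:R / (n%:R * d n).

Lemma ulevel_mul u n : (0 < n)%N -> ulevel u n * d n = (level u n)%:R / n%:R.
Proof.
move=> n0; rewrite /ulevel; field.
by rewrite !gt_eqF ?d0 ?ltr0n.
Qed.

Lemma ulevel_cvg u : 0 < u -> ulevel u @ \oo --> u.
Proof.
move=> u0; apply: (@squeeze_cvgr _ _ _ _ (fun n => u - (n%:R * d n)^-1) (fun=> u));
  last 2 first.
- by rewrite -[X in _ --> X]subr0; apply: cvgB; [exact: cvg_cst|exact: inv_nd_cvg].
- exact: cvg_cst.
near=> n.
have n0 : (0 < n)%N by near: n; exact: nbhs_infty_gt.
have A0 : 0 < n%:R * d n by rewrite mulr_gt0 ?d0 ?ltr0n.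
have h := truncn_itv (mulr_ge0 (ltW u0) (ltW A0)).
rewrite /ulevel /level; case/andP: h => h1 h2.
rewrite ler_pdivrMr // h1 andbT ler_pdivlMr // mulrBl mulVf ?gt_eqF //.
by move: h2; rewrite -natr1; lra.
Unshelve. all: by end_near.
Qed.

(* Chernoff bound with the optimal number [level us n] of factors. *)
Lemma near_upper e : 0 < e -> \forall n \near \oo,
  0 < p n -> ln (p n) / (n%:R * d n ^+ 2) <= F us - us * L + e.
Proof.
move=> e0.
have lim : (fun n => ln n%:R / (n%:R * d n ^+ 2) +
    Phi (g n) (ulevel us n * d n) / d n ^+ 2 - ulevel us n * (4 * ln (t n) / d n))
    @ \oo --> 0 + F us - us * L.
  apply: cvgB; last by apply: cvgM; [exact: ulevel_cvg|exact: t_lim].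
  apply: cvgD; first exact: d_lim.
  by apply: F_lim => //; exact: ulevel_cvg.
near=> n => pn.
have n0 : (0 < n)%N by near: n; exact: nbhs_infty_gt.
have nr : 0 < n%:R :> R by rewrite ltr0n.
have dn := d0 n0.
have A0 : 0 < n%:R * d n ^+ 2 by rewrite mulr_gt0 ?exprn_gt0.
apply: (@le_trans _ _ (ln n%:R / (n%:R * d n ^+ 2) +
    Phi (g n) (ulevel us n * d n) / d n ^+ 2 - ulevel us n * (4 * ln (t n) / d n))).
  rewrite ler_pdivrMr //.
  apply: (le_trans (ln_upper (g0 n0) (t0 n0) pn n0 (p_le n0 (level us n)))).
  rewrite ulevel_mul // /ulevel le_eqVlt; apply/orP; left; apply/eqP.
  by field; rewrite !gt_eqF.
near: n; move/cvgrPdist_le : lim => /(_ e e0); apply: filterS => n.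
by rewrite ler_norml; lra.
Unshelve. all: by end_near.
Qed.

(** The Chebyshev bound with dl = eta d_n and a tilt u above the optimum. The excess f u - L pays
    for the losses in [threshold], and n d_n^2 -> oo secures 6 <= n dl^2. The parameter eta stays
    fixed here and costs u eta in the rate. *)
Lemma near_lower u eta e : us < u -> 0 < eta <= 2^-1 -> 2 * eta < f u - L -> 0 < e ->
  \forall n \near \oo,
  0 < p n /\ F u - u * f u - u * eta - e <= ln (p n) / (n%:R * d n ^+ 2).
Proof.
move=> usu /andP[eta0 eta1] etaf e0; have u0 : 0 < u by exact: lt_trans usu.
have wl := ulevel_cvg u0; have fl := f_lim u0 wl; have Fl := F_lim u0 wl.
have lim : (fun n => - (3 * (ln n%:R / (n%:R * d n ^+ 2))) - ulevel u n * eta +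
    Phi (g n) (ulevel u n * d n) / d n ^+ 2
    - (n%:R * d n)^-1 * (phi (g n) (ulevel u n * d n) / d n)
    - ulevel u n * (phi (g n) (ulevel u n * d n) / d n))
    @ \oo --> - (3 * 0) - u * eta + F u - 0 * f u - u * f u.
  apply: cvgB; last exact: cvgM.
  apply: cvgB; last by apply: cvgM => //; exact: inv_nd_cvg.
  apply: cvgD => //; apply: cvgB; last by apply: cvgM => //; exact: cvg_cst.
  by apply: cvgN; apply: cvgM => //; exact: cvg_cst.
have lim2 : (fun n => phi (g n) (ulevel u n * d n) / d n -
    (4 * ln (t n) / d n + 32 * (n%:R * d n)^-1 + 2 * eta)) @ \oo -->
    f u - (L + 32 * 0 + 2 * eta).
  apply: cvgB => //; apply: cvgD; last exact: cvg_cst.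
  by apply: cvgD => //; apply: cvgM; [exact: cvg_cst|exact: inv_nd_cvg].
near=> n.
have n8 : (8 <= n)%N by near: n; exact: nbhs_infty_ge.
have n0 : (0 < n)%N by rewrite (leq_trans _ n8).
have n1 : (1 < n)%N by rewrite (leq_trans _ n8).
have nr : 0 < n%:R :> R by rewrite ltr0n.
have dn := d0 n0; have dn1 : d n <= 1 by near: n.
have A0 : 0 < n%:R * d n ^+ 2 by rewrite mulr_gt0 ?exprn_gt0.
have de0 : 0 < eta * d n by rewrite mulr_gt0.
have de1 : eta * d n <= 2^-1 by rewrite (le_trans _ eta1) // ler_piMr // ltW.
have de : 0 < eta * d n <= 2^-1 by rewrite de0.
have h6 : 6 <= n%:R * (eta * d n) ^+ 2.
  have h : (n%:R * d n ^+ 2)^-1 <= eta ^+ 2 / 6.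
    near: n; move/cvgrPdist_le : inv_nd2_cvg => /(_ (eta ^+ 2 / 6)).
    have h : 0 < eta ^+ 2 / 6 by rewrite divr_gt0 // exprn_gt0.
    by move=> /(_ h); apply: filterS => n; rewrite ler_norml; lra.
  have := ler_wpM2r (ltW A0) h; rewrite mulVf ?gt_eqF // exprMn; lra.
have thr : 4 * ln (t n) + 32 / n%:R + 2 * (eta * d n) <=
    phi (g n) ((level u n)%:R / n%:R).
  have h : 0 <= phi (g n) (ulevel u n * d n) / d n -
      (4 * ln (t n) / d n + 32 * (n%:R * d n)^-1 + 2 * eta).
    near: n; move/cvgrPdist_le : lim2 => /(_ (f u - L - 2 * eta)).
    have h : 0 < f u - L - 2 * eta by lra.
    by move=> /(_ h); apply: filterS => n; rewrite ler_norml; lra.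
  move: h; rewrite subr_ge0 ler_pdivlMr // ulevel_mul //.
  apply: le_trans; rewrite le_eqVlt; apply/orP; left; apply/eqP.
  by field; rewrite !gt_eqF.
have [c0 tc] := threshold (g0 n0) (t0 n0) de n8 thr.
have de2 : 0 < eta * d n < 1 by rewrite de0 (le_lt_trans de1) // invf_lt1 // ltr1n.
have [p0 lp] := ln_lower (g0 n0) de0 n1 (p_ge n0 n1 de2 h6 c0 tc).
split=> //.
apply: (@le_trans _ _ (- (3 * (ln n%:R / (n%:R * d n ^+ 2))) - ulevel u n * eta +
    Phi (g n) (ulevel u n * d n) / d n ^+ 2
    - (n%:R * d n)^-1 * (phi (g n) (ulevel u n * d n) / d n)
    - ulevel u n * (phi (g n) (ulevel u n * d n) / d n))).
  near: n; move/cvgrPdist_le : lim => /(_ e e0); apply: filterS => n.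
  by rewrite ler_norml; lra.
rewrite ler_pdivlMr //; apply: le_trans lp.
rewrite ulevel_mul // /ulevel le_eqVlt; apply/orP; left; apply/eqP.
by field; rewrite !gt_eqF.
Unshelve. all: by end_near.
Qed.

(** At us itself there is no excess for [near_lower]; continuity makes the cost of moving to the
    right small. *)
Lemma near_us e : 0 < e -> exists2 u, us < u & F us - us * L - e <= F u - u * f u.
Proof.
move=> e0.
have lim : (fun u => F u - u * f u) @ us^'+ --> F us - us * f us.
  apply: cvg_at_right_filter; apply: cvgB; first exact: F_continuous.
  by apply: cvgM => //; exact: f_continuous.
have h1 : \forall u \near us^'+, F us - us * L - e <= F u - u * f u.
  move/cvgrPdist_le : lim => /(_ e e0); apply: filterS => u.
  by rewrite ler_norml -f_us; lra.
have h2 : \forall u \near us^'+, us < u by exact: nbhs_right_gt.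
have /filter_ex : \forall u \near us^'+, us < u /\ F us - us * L - e <= F u - u * f u.
  by apply: filterS2 h2 h1.
by move=> H; case: H => u [hu1 hu2]; exists u.
Qed.

Lemma near_value e : 0 < e -> \forall n \near \oo,
  0 < p n /\ F us - us * L - e <= ln (p n) / (n%:R * d n ^+ 2).
Proof.
move=> e0; have e3 : 0 < e / 3 by rewrite divr_gt0.
have [u usu hu] := near_us e3; have u0 : 0 < u by exact: lt_trans usu.
have fu := f_gt usu.
(* The three entries ensure eta <= 1/2, 2 eta < f u - L and u eta <= e/3. *)
pose eta := Num.min 2^-1 (Num.min ((f u - L) / 4) (e / (3 * u))).
have eta0 : 0 < eta.
  rewrite !lt_min invr_gt0 ltr0n /=; apply/andP; split.
    by rewrite divr_gt0 // subr_gt0.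
  by rewrite divr_gt0 // mulr_gt0.
have eta1 : eta <= 2^-1 by rewrite ge_min lexx.
have eta2 : eta <= (f u - L) / 4 by rewrite !ge_min lexx orbT.
have eta3 : eta <= e / (3 * u) by rewrite !ge_min lexx !orbT.
have ue : u * eta <= e / 3.
  rewrite (_ : e / 3 = u * (e / (3 * u))); first by rewrite ler_pM2l.
  by field; rewrite gt_eqF.
have h01 : 0 < eta <= 2^-1 by rewrite eta0.
have h2 : 2 * eta < f u - L by lra.
have := near_lower usu h01 h2 e3; apply: filterS => n [p0 hp]; split=> //; lra.
Qed.

Lemma rate_cvg : (\forall n \near \oo, 0 < p n) /\
  (fun n => ln (p n) / (n%:R * d n ^+ 2)) @ \oo --> F us - us * L.
Proof.
split.
  by have := near_value (@ltr01 R); apply: filterS => n [p0 _].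
apply/cvgrPdist_le => e e0.
apply: filterS2 (near_value e0) (near_upper e0) => n [p0 h1] /(_ p0) h2.
by rewrite ler_norml; lra.
Qed.

End AbstractRate.

(** * Limits of [phi] and [Phi] at fixed and at shrinking arguments *)

Section RateLimits.
Context {R : realType}.
Implicit Types (g u gam : R).

Section Fixed.
Context {T : Type} (FF : set_system T) {FFF : Filter FF}.
Variables (g u : T -> R) (gam u0 : R).
Hypotheses (g_ge0 : \forall x \near FF, 0 <= g x) (gam0 : 0 <= gam) (u0_gt0 : 0 < u0).
Hypotheses (g_lim : g @ FF --> gam) (u_lim : u @ FF --> u0).

Lemma cvg_ln1D (y : T -> R) (y0 : R) : 0 <= y0 -> y @ FF --> y0 ->
  (fun x => ln (1 + y x)) @ FF --> ln (1 + y0).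
Proof.
move=> h hy; have y1 : 0 < 1 + y0 by rewrite ltr_wpDr.
apply: (@cvg_comp _ _ _ (fun x => 1 + y x) (@ln R) FF (nbhs (1 + y0))).
  by apply: cvgD => //; exact: cvg_cst.
exact: continuous_ln.
Qed.

Lemma cvg_psi (y : T -> R) (y0 : R) : 0 <= y0 -> y @ FF --> y0 ->
  (fun x => psi (y x)) @ FF --> psi y0.
Proof.
move=> h hy; apply: cvgB => //; apply: cvgM; last exact: cvg_ln1D.
by apply: cvgD => //; exact: cvg_cst.
Qed.

Lemma cvg_phi : (fun x => phi (g x) (u x)) @ FF --> phi gam u0.
Proof.
apply: cvgD; apply: cvg_ln1D => //; first exact: ltW.
- by rewrite mulr_ge0 // ltW.
- exact: cvgM.
Qed.

(** The delicate case is gam = 0, where psi(gu)/g is squeezed between 0 and g u^2/2. The filter is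
    general because the lemma is used both for n -> oo and for alpha -> +oo. *)
Lemma cvg_Phi : (fun x => Phi (g x) (u x)) @ FF --> Phi gam u0.
Proof.
apply: cvgD; first by apply: cvg_psi => //; exact: ltW.
move: (gam0); rewrite le_eqVlt => /orP[/eqP gamE|gam_gt0]; last first.
  apply: cvgM; last by apply: cvgV => //; rewrite gt_eqF.
  by apply: cvg_psi; [rewrite mulr_ge0 // ltW|exact: cvgM].
rewrite -gamE invr0 mulr0.
apply: (@squeeze_cvgr _ _ _ _ (fun=> 0) (fun x => g x * (u x ^+ 2 / 2))); last 2 first.
- exact: cvg_cst.
- rewrite -[X in _ --> X](mul0r (u0 ^+ 2 / 2)) [X in X * _]gamE.
  apply: cvgM => //; apply: cvgM; last exact: cvg_cst.
  by under eq_fun do rewrite expr2; rewrite expr2; exact: cvgM.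
have u_ge0 : \forall x \near FF, 0 <= u x.
  move/cvgrPdist_le : u_lim => /(_ u0 u0_gt0); apply: filterS => x.
  by rewrite ler_norml; lra.
apply: filterS2 g_ge0 u_ge0 => x gx ux; have gu := mulr_ge0 gx ux.
rewrite divr_ge0 ?psi_ge0 //=.
move: gx; rewrite le_eqVlt => /orP[/eqP <-|gx]; first by rewrite invr0 mulr0 mul0r.
rewrite ler_pdivrMr //; apply: (le_trans (psi_le gu)).
by rewrite le_eqVlt; apply/orP; left; apply/eqP; field.
Qed.

End Fixed.

Section Shrinking.
Variables (g d : nat -> R) (gam : R).
Hypothesis g_gt0 : \forall n \near \oo, 0 < g n.
Hypothesis d_gt0 : \forall n \near \oo, 0 < d n.
Hypotheses (g_lim : g @ \oo --> gam) (d_lim : d @ \oo --> (0 : R)).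
Variables (w : nat -> R) (u0 : R).
Hypotheses (u0_gt0 : 0 < u0) (w_lim : w @ \oo --> u0).

Let w_gt0 : \forall n \near \oo, 0 < w n.
Proof.
have u2 : 0 < u0 / 2 by rewrite divr_gt0.
move/cvgrPdist_le : w_lim => /(_ _ u2); apply: filterS => x.
by rewrite ler_norml; lra.
Qed.

Let cvgX2 (y : nat -> R) (y0 : R) : y @ \oo --> y0 -> (fun n => y n ^+ 2) @ \oo --> y0 ^+ 2.
Proof. by move=> h; under eq_fun do rewrite expr2; rewrite expr2; exact: cvgM. Qed.

(** First-order expansion: phi(g, u) = (1+g) u + O(u^2). *)
Lemma cvg_phi_shrinking :
  (fun n => phi (g n) (w n * d n) / d n) @ \oo --> (1 + gam) * u0.
Proof.
have l1 : (fun n => (1 + g n) * w n) @ \oo --> (1 + gam) * u0.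
  by apply: cvgM => //; apply: cvgD => //; exact: cvg_cst.
apply: (@squeeze_cvgr _ _ _ _
  (fun n => (1 + g n) * w n - (1 + g n ^+ 2) * w n ^+ 2 * d n) (fun n => (1 + g n) * w n));
  last 2 first.
- rewrite -[X in _ --> X]subr0 -[X in _ - X](mulr0 ((1 + gam ^+ 2) * u0 ^+ 2)).
  apply: cvgB => //; apply: cvgM => //; apply: cvgM; last exact: cvgX2.
  by apply: cvgD; [exact: cvg_cst|exact: cvgX2].
- exact: l1.
near=> n.
have gn : 0 < g n by near: n.
have dn : 0 < d n by near: n.
have wn : 0 < w n by near: n.
have wd := ltW (mulr_gt0 wn dn); have gwd := mulr_ge0 (ltW gn) wd.
have := ln1D_ge wd; have := ln1D_le wd; have := ln1D_ge gwd; have := ln1D_le gwd.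
by rewrite ler_pdivrMr // ler_pdivlMr // /phi => h1 h2 h3 h4; apply/andP; split; lra.
Unshelve. all: by end_near.
Qed.

(** Second-order expansion: Phi(g, u) = (1+g) u^2/2 + O(u^3). The division by g is cleared before
    comparing, so the error stays bounded as g -> 0. *)
Lemma cvg_Phi_shrinking :
  (fun n => Phi (g n) (w n * d n) / d n ^+ 2) @ \oo --> (1 + gam) * (u0 ^+ 2 / 2).
Proof.
have l1 : (fun n => (1 + g n) * (w n ^+ 2 / 2)) @ \oo --> (1 + gam) * (u0 ^+ 2 / 2).
  apply: cvgM; first by apply: cvgD => //; exact: cvg_cst.
  by apply: cvgM; [exact: cvgX2|exact: cvg_cst].
apply: (@squeeze_cvgr _ _ _ _
  (fun n => (1 + g n) * (w n ^+ 2 / 2) - (1 + g n ^+ 2) * (w n * w n ^+ 2) * d n)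
  (fun n => (1 + g n) * (w n ^+ 2 / 2))); last 2 first.
- rewrite -[X in _ --> X]subr0 -[X in _ - X](mulr0 ((1 + gam ^+ 2) * (u0 * u0 ^+ 2))).
  apply: cvgB => //; apply: cvgM => //; apply: cvgM.
    by apply: cvgD; [exact: cvg_cst|exact: cvgX2].
  by apply: cvgM => //; exact: cvgX2.
- exact: l1.
near=> n.
have gn : 0 < g n by near: n.
have dn : 0 < d n by near: n.
have wn : 0 < w n by near: n.
have wd := ltW (mulr_gt0 wn dn); have gwd := mulr_ge0 (ltW gn) wd.
have d2 : 0 < d n ^+ 2 by rewrite exprn_gt0.
have h1 : psi (g n * (w n * d n)) / g n <= g n * (w n * d n) ^+ 2 / 2.
  rewrite ler_pdivrMr //; apply: (le_trans (psi_le gwd)).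
  by rewrite le_eqVlt; apply/orP; left; apply/eqP; field.
have h2 : g n * (w n * d n) ^+ 2 / 2 - g n ^+ 2 * (w n * d n) ^+ 3 <=
    psi (g n * (w n * d n)) / g n.
  rewrite ler_pdivlMr //; apply: le_trans (psi_ge gwd).
  by rewrite le_eqVlt; apply/orP; left; apply/eqP; field.
have h3 := psi_le wd; have h4 := psi_ge wd.
rewrite /Phi; apply/andP; split.
  rewrite ler_pdivlMr //; apply: le_trans (lerD h4 h2).
  by rewrite le_eqVlt; apply/orP; left; apply/eqP; field.
by rewrite -(ler_pM2r d2) divfK ?gt_eqF //; lra.
Unshelve. all: by end_near.
Qed.

End Shrinking.

End RateLimits.

(** * The large and moderate deviation regimes *)

Section Instances.
Context {R : realType}.

(** From ln n = 2 ln sqrt(n) <= 2 sqrt(n). *)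
Lemma cvg_ln_div_n : (fun n => ln n%:R / n%:R : R) @ \oo --> (0 : R).
Proof.
apply/cvgrPdist_le => e e0; near=> n.
have n0 : (0 < n)%N by near: n; exact: nbhs_infty_gt.
have nr : 0 < n%:R :> R by rewrite ltr0n.
have s0 : 0 < Num.sqrt n%:R :> R by rewrite sqrtr_gt0.
have nE : n%:R = Num.sqrt n%:R ^+ 2 :> R by rewrite sqr_sqrtr // ltW.
rewrite sub0r normrN ger0_norm; last first.
  by rewrite divr_ge0 ?(ltW nr) // ln_ge0 // ler1n.
have h : 2 / e <= Num.sqrt n%:R.
  have e2 : 0 <= 2 / e by rewrite divr_ge0 // ltW.
  have h : (2 / e) ^+ 2 <= n%:R by near: n; exact: nbhs_infty_ger.
  by have := ler_wsqrtr h; rewrite sqrtr_sqr ger0_norm.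
rewrite ler_pdivrMr //; apply: (@le_trans _ _ (2 * Num.sqrt n%:R)).
  rewrite [in leLHS]nE lnXn // -[leLHS]mulr_natl ler_pM2l //.
  by have := ln_le_subr1 s0; lra.
rewrite [in leRHS]nE expr2 mulrA ler_pM2r //.
by move: h; rewrite ler_pdivrMr // mulrC.
Unshelve. all: by end_near.
Qed.

Variables (g p : nat -> R) (gam : R).
Hypothesis g_gt0 : forall n, (0 < n)%N -> 0 < g n.
Hypotheses (gam0 : 0 <= gam) (g_lim : g @ \oo --> gam).

Definition satisfies_bounds (t : nat -> R) := forall n, (0 < n)%N ->
  (forall s, p n <= n%:R * \prod_(i < s) (rho (g n) (i%:R / n%:R) / t n ^+ 4)) /\
  (forall (s : nat) (dl : R), (1 < n)%N -> 0 < dl < 1 -> 6 <= n%:R * dl ^+ 2 ->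
     0 < cos (pi / n%:R) :> R ->
     (t n / cos (pi / n%:R)) ^+ 4 <= rho (g n) (s%:R / n%:R) * (1 - dl) ->
     n.+1%:R^-1 * (2^-1 * (1 + dl) ^- s *
       \prod_(i < s) (rho (g n) (i%:R / n%:R) / rho (g n) (s%:R / n%:R))) <= p n).

Let near_g_gt0 : \forall n \near \oo, 0 < g n.
Proof.
near=> n; apply: g_gt0.
by near: n; exact: nbhs_infty_gt.
Unshelve. all: by end_near.
Qed.

(** The instance d_n = 1 of [rate_cvg]; the factor [1 ^+ 2] keeps the shape expected by
    [deviation_cvg]. *)
Lemma large_deviation (t us : R) : 1 < t -> satisfies_bounds (fun=> t) ->
  0 < us -> phi gam us = 4 * ln t ->
  (\forall n \near \oo, 0 < p n) /\
  (fun n => ln (p n) / (n%:R * 1 ^+ 2)) @ \oo --> Phi gam us - us * (4 * ln t).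
Proof.
move=> t1 hp us0 hus; have t0 : 0 < t by exact: lt_trans t1.
have near_g_ge0 : \forall n \near \oo, 0 <= g n.
  by apply: filterS near_g_gt0 => n /ltW.
apply: (@rate_cvg _ g (fun=> 1) (fun=> t) p (4 * ln t) us (phi gam) (Phi gam)) => //.
- exact: nearW.
- by under eq_fun do rewrite expr1n mulr1; exact: cvg_ln_div_n.
- by under eq_fun do rewrite divr1; exact: cvg_cst.
- by move=> n /hp[].
- by move=> n /hp[].
- move=> u w u0 wu; under eq_fun do rewrite mulr1 divr1.
  exact: cvg_phi.
- move=> u w u0 wu; under eq_fun do rewrite mulr1 expr1n divr1.
  exact: cvg_Phi.
- move=> u usu; have u0 := lt_trans us0 usu; rewrite -hus /phi.
  apply: ltr_leD; first by rewrite ltr_ln ?posrE ?ltrD2l // addr_gt0.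
  rewrite ler_ln ?posrE ?lerD2l ?ler_wpM2l ?(ltW usu) // ltr_wpDr // mulr_ge0 // ltW //.
- apply: cvg_phi => //; exact: cvg_cst.
- apply: cvg_Phi => //; [exact: nearW|exact: cvg_cst].
Qed.

Lemma moderate_deviation (t : R) (d : nat -> R) : 0 < t ->
  (forall n, (0 < n)%N -> 0 < d n) -> d @ \oo --> (0 : R) ->
  (fun n => ln n%:R / (n%:R * d n ^+ 2)) @ \oo --> (0 : R) ->
  satisfies_bounds (fun n => 1 + t * d n) ->
  (\forall n \near \oo, 0 < p n) /\
  (fun n => ln (p n) / (n%:R * d n ^+ 2)) @ \oo --> - (8 / (1 + gam) * t ^+ 2).
Proof.
move=> t0 d0 d_lim ln_lim hp; have g1 : 0 < 1 + gam by rewrite ltr_wpDr.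
have near_d : \forall n \near \oo, 0 < d n.
  near=> n; apply: d0; near: n; exact: nbhs_infty_gt.
(* The minimiser of (1 + gam) u^2/2 - 4tu, where 4t is the limit of 4 ln(1 + t d_n)/d_n. *)
pose us := 4 * t / (1 + gam).
have us0 : 0 < us by rewrite divr_gt0 // mulr_gt0.
have -> : - (8 / (1 + gam) * t ^+ 2) = (1 + gam) * (us ^+ 2 / 2) - us * (4 * t).
  by rewrite /us; field; rewrite gt_eqF.
apply: (@rate_cvg _ g d (fun n => 1 + t * d n) p (4 * t) us
  (fun u => (1 + gam) * u) (fun u => (1 + gam) * (u ^+ 2 / 2))) => //.
- by move=> n n0; rewrite addr_gt0 // mulr_gt0 ?d0.
- move/cvgrPdist_le : d_lim => /(_ 1 ltr01); apply: filterS => n.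
  by rewrite ler_norml; lra.
- apply: (@squeeze_cvgr _ _ _ _ (fun n => 4 * t - 4 * t ^+ 2 * d n) (fun=> 4 * t));
    last 2 first.
  + rewrite -[X in _ --> X]subr0 -[X in _ - X](mulr0 (4 * t ^+ 2)).
    by apply: cvgB; [exact: cvg_cst|apply: cvgM => //; exact: cvg_cst].
  + exact: cvg_cst.
  near=> n; have dn : 0 < d n by near: n.
  have td := ltW (mulr_gt0 t0 dn); have h1 := ln1D_le td; have h2 := ln1D_ge td.
  apply/andP; split; first by rewrite ler_pdivlMr //; lra.
  by rewrite -(ler_pM2r dn) divfK ?gt_eqF //; lra.
- by move=> n /hp[].
- by move=> n /hp[].
- by move=> u w u0 wu; exact: cvg_phi_shrinking.
- by move=> u w u0 wu; exact: cvg_Phi_shrinking.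
- by rewrite /us; field; rewrite gt_eqF.
- by move=> u; rewrite /us ltr_pdivrMr // [u * _]mulrC.
- by apply: cvgM => //; exact: cvg_cst.
- apply: cvgM; first exact: cvg_cst.
  apply: cvgM; last exact: cvg_cst.
  by rewrite expr2; under eq_fun do rewrite expr2; exact: cvgM.
Unshelve. all: by end_near.
Qed.

End Instances.

(** * Identification of the rate functions *)

Section RateIdentification.
Context {R : realType}.
Implicit Types (a t : R).

(* The positive root u of (1 + u) (1 + u / (1 + a)) = t^4. *)
Definition tilt t a : R := (Num.sqrt (a ^+ 2 + 4 * (1 + a) * t ^+ 4) - a) / 2 - 1.

(** [J_fin] is the Legendre transform of [Phi] at 4 ln t, evaluated at the root. Rationalising
    4(1+a)t^4/(a+r) = r - a and writing ln t^2 as half of [phi] leaves an identity linear in two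
    logarithms. *)
Lemma tilt_spec t a : 1 < t -> 0 <= a ->
  [/\ 0 < tilt t a,
      (1 + tilt t a) * (1 + (1 + a)^-1 * tilt t a) = t ^+ 4,
      phi (1 + a)^-1 (tilt t a) = 4 * ln t
    & J_fin t a = tilt t a * (4 * ln t) - Phi (1 + a)^-1 (tilt t a)].
Proof.
move=> t1 a0; rewrite /J_fin /tilt; have t0 : 0 < t by exact: lt_trans t1.
set r := Num.sqrt _; set u := (r - a) / 2 - 1.
have a1 : 0 < 1 + a by rewrite ltr_wpDr.
have t4 : 1 < t ^+ 4 by rewrite exprn_egt1.
have r2 : r ^+ 2 = a ^+ 2 + 4 * (1 + a) * t ^+ 4.
  by rewrite sqr_sqrtr // addr_ge0 ?sqr_ge0 // !mulr_ge0 ?exprn_ge0 // ltW.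
have ra : a + 2 < r.
  rewrite -(@ltr_pXn2r _ 2) ?nnegrE ?sqrtr_ge0 ?addr_ge0 // r2.
  have : 4 * (1 + a) < 4 * (1 + a) * t ^+ 4 by rewrite ltr_pMr // mulr_gt0.
  by lra.
have u0 : 0 < u by rewrite /u; lra.
have uE : 1 + u = (r - a) / 2 by rewrite /u; ring.
have guE : 1 + (1 + a)^-1 * u = (a + r) / (2 * (1 + a)).
  by rewrite /u; field; rewrite gt_eqF.
have prod : (1 + u) * (1 + (1 + a)^-1 * u) = t ^+ 4.
  rewrite uE guE (_ : _ * _ = (r ^+ 2 - a ^+ 2) / (4 * (1 + a))); last first.
    by field; rewrite gt_eqF.
  by rewrite r2; field; rewrite gt_eqF.
have phiE : phi (1 + a)^-1 u = 4 * ln t.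
  rewrite -ln_rho ?invr_ge0 ?(ltW a1) ?(ltW u0) // /rho prod lnXn //.
  by rewrite mulr_natl.
split=> //; rewrite /Phi /psi -phiE /phi.
have -> : 4 * (1 + a) * t ^+ 4 / (a + r) = r - a.
  have -> : 4 * (1 + a) * t ^+ 4 = (r - a) * (a + r).
    have -> : (r - a) * (a + r) = r ^+ 2 - a ^+ 2 by ring.
    by rewrite r2; ring.
  by rewrite mulfK // gt_eqF //; lra.
have -> : ln (t ^+ 2) = (ln (1 + u) + ln (1 + (1 + a)^-1 * u)) / 2.
  by move: phiE; rewrite /phi => ->; rewrite lnXn // -mulr_natl; field.
rewrite -guE; move: (ln (1 + u)) (ln (1 + _)) => A B.
by rewrite guE uE /u; field; rewrite gt_eqF.
Qed.

Lemma cvg_inv1D : (1 + a)^-1 @[a --> +oo] --> (0 : R).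
Proof.
apply/cvgrPdist_le => e e0; near=> a.
have a0 : 0 <= a by near: a; apply: nbhs_pinfty_ge; exact: num_real.
have a1 : 0 < 1 + a by rewrite ltr_wpDr.
rewrite sub0r normrN ger0_norm ?invr_ge0 ?(ltW a1) //.
rewrite -[leRHS]invrK lef_pV2 ?posrE ?invr_gt0 //.
have : e^-1 <= a by near: a; apply: nbhs_pinfty_ge; exact: num_real.
by lra.
Unshelve. all: by end_near.
Qed.

(** The equation of the root reads t^4 - 1 - u = g u(1+u) with g = 1/(1+a), and the right side lies
    between 0 and g t^8; the square root need not be expanded. *)
Lemma tilt_cvg t : 1 < t -> tilt t a @[a --> +oo] --> t ^+ 4 - 1.
Proof.
move=> t1.
apply: (@squeeze_cvgr _ _ _ _ (fun a => t ^+ 4 - 1 - (1 + a)^-1 * t ^+ 4 ^+ 2)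
  (fun=> t ^+ 4 - 1)); last 2 first.
- have -> : nbhs (t ^+ 4 - 1) = nbhs (t ^+ 4 - 1 - 0 * t ^+ 4 ^+ 2).
    by rewrite mul0r subr0.
  apply: cvgB; first exact: cvg_cst.
  by apply: cvgM; [exact: cvg_inv1D|exact: cvg_cst].
- exact: cvg_cst.
near=> a.
have a0 : 0 <= a by near: a; apply: nbhs_pinfty_ge; exact: num_real.
have a1 : 0 < (1 + a)^-1 by rewrite invr_gt0 ltr_wpDr.
have [u0 hp _ _] := tilt_spec t1 a0.
move: (tilt t a) u0 hp => u u0 hp; set g := (1 + a)^-1 in a1 hp *.
have gu : 0 <= (1 + u) * (g * u) by rewrite !mulr_ge0 ?addr_ge0 // ltW.
have h1 : 1 + u <= t ^+ 4 by rewrite -hp mulrDr mulr1 lerDl.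
rewrite (_ : u <= _); last by lra.
rewrite andbT.
have h2 : u * (1 + u) <= t ^+ 4 ^+ 2.
  by rewrite expr2 ler_pM // ?addr_ge0 // ?(ltW u0) //; lra.
have h3 : g * (u * (1 + u)) <= g * t ^+ 4 ^+ 2 by rewrite ler_pM2l.
have : (1 + u) * (1 + g * u) = 1 + u + g * (u * (1 + u)) by ring.
by rewrite hp; lra.
Unshelve. all: by end_near.
Qed.

(** [J] at +oo is a [lim], so convergence has to be established; it is done on the Legendre form, as
    g -> 0. *)
Lemma rate_infinity t : 1 < t ->
  [/\ 0 < t ^+ 4 - 1, phi 0 (t ^+ 4 - 1) = 4 * ln t &
  J +oo%E t = (t ^+ 4 - 1) * (4 * ln t) - Phi 0 (t ^+ 4 - 1)].
Proof.
move=> t1; have t0 : 0 < t by exact: lt_trans t1.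
have t4 : 1 < t ^+ 4 by rewrite exprn_egt1.
have u0 : 0 < t ^+ 4 - 1 by rewrite subr_gt0.
split=> //.
  rewrite /phi mul0r addr0 ln1 addr0 addrC subrK lnXn // mulr_natl //.
apply: cvg_lim; first exact: Rhausdorff.
have near_ge0 : \forall a \near +oo, 0 <= a :> R by apply: nbhs_pinfty_ge; exact: num_real.
apply: (@cvg_trans _ (tilt t a * (4 * ln t) - Phi (1 + a)^-1 (tilt t a) @[a --> +oo])).
  apply: near_eq_cvg; apply: filterS near_ge0 => a a0.
  by have [_ _ _ ->] := tilt_spec t1 a0.
apply: cvgB; first by apply: cvgM; [exact: tilt_cvg|exact: cvg_cst].
apply: cvg_Phi => //; [|exact: cvg_inv1D|exact: tilt_cvg].
by apply: filterS near_ge0 => a a0; rewrite invr_ge0 addr_ge0.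
Qed.

Lemma moderate_rate_fin a : 0 <= a -> moderate_rate a%:E = 8 / (1 + (1 + a)^-1).
Proof.
move=> a0; have a1 : 0 < 1 + a by rewrite ltr_wpDr.
have a2 : 0 < 2 + a by rewrite ltr_wpDr.
by rewrite /moderate_rate /=; field; rewrite !gt_eqF //; lra.
Qed.

Lemma moderate_rate_infinity : moderate_rate (+oo%E : \bar R) = 8 / (1 + 0).
Proof.
apply: cvg_lim; first exact: Rhausdorff.
apply: (@cvg_trans _ (8 / (1 + (1 + a)^-1) @[a --> +oo])).
  apply: near_eq_cvg; apply: filterS (nbhs_pinfty_ge (@real0 R)) => a a0.
  by rewrite -moderate_rate_fin.
apply: cvgM; first exact: cvg_cst.
apply: cvgV; first by rewrite addr0 oner_eq0.
by apply: cvgD; [exact: cvg_cst|exact: cvg_inv1D].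
Qed.

(** The parameter gam = 1/(1+alpha), with gam = 0 for alpha = +oo, treats finite and infinite alpha
    alike from here on. *)
Lemma ratio_cvg (v : nat -> nat) (alpha : \bar R) : (0 <= alpha)%E ->
  (fun n => ((v n)%:R / n%:R : R)%:E) @ \oo --> alpha ->
  exists gam : R,
  [/\ 0 <= gam, (fun n => n%:R / (n + v n)%:R : R) @ \oo --> gam,
      forall t, 1 < t -> exists us, [/\ 0 < us, phi gam us = 4 * ln t
        & J alpha t = us * (4 * ln t) - Phi gam us]
    & moderate_rate alpha = 8 / (1 + gam)].
Proof.
have near_eq : \forall n \near \oo, (1 + (v n)%:R / n%:R)^-1 = n%:R / (n + v n)%:R :> R.
  near=> n; have n0 : (0 < n)%N by near: n; exact: nbhs_infty_gt.
  have nr : 0 < n%:R :> R by rewrite ltr0n.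
  have vr : 0 <= (v n)%:R :> R by [].
  by rewrite natrD; field; rewrite !gt_eqF //; lra.
case: alpha => [a||] //= a0 lim.
- exists (1 + a)^-1; have a1 : 0 < 1 + a by rewrite ltr_wpDr.
  split.
  + by rewrite invr_ge0 ltW.
  + apply: cvg_trans (near_eq_cvg near_eq) _.
    apply: cvgV; first by rewrite gt_eqF.
    by apply: cvgD; [exact: cvg_cst|exact: (fine_cvg lim)].
  + by move=> t t1; have [] := tilt_spec t1 a0; exists (tilt t a).
  + exact: moderate_rate_fin.
- exists 0; split=> //.
  + apply: cvg_trans (near_eq_cvg near_eq) _.
    apply: (@cvg_comp _ _ _ (fun n => (v n)%:R / n%:R) (fun a => (1 + a)^-1) \oo +oo);
      last exact: cvg_inv1D.
    exact/cvgeryP.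
  + by move=> t t1; have [] := rate_infinity t1; exists (t ^+ 4 - 1).
  + exact: moderate_rate_infinity.
Unshelve. all: by end_near.
Qed.

End RateIdentification.

(** Passes from the real logarithm to the extended one, which agree once the probability is
    positive. *)
Lemma deviation_cvg (R : realType) (d : nat -> R) (p : nat -> R) (x : nat -> \bar R) (l : R) :
  (forall n, (0 < n)%N -> x n = (p n)%:E) -> (\forall n \near \oo, 0 < p n) ->
  (fun n => ln (p n) / (n%:R * d n ^+ 2)) @ \oo --> l ->
  (fun n => ((n%:R * d n ^+ 2)^-1)%:E * lne (x n))%E @ \oo --> l%:E.
Proof.
move=> xp p0 lim; apply: (@cvg_trans _
  ((fun n => (ln (p n) / (n%:R * d n ^+ 2))%:E) @ \oo)); last first.
  by apply: cvg_EFin => //; exact: nearW.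
apply: near_eq_cvg; near=> n.
have n0 : (0 < n)%N by near: n; exact: nbhs_infty_gt.
have pn : 0 < p n by near: n.
by rewrite (xp n n0) lne_EFin // -EFinM mulrC.
Unshelve. all: by end_near.
Qed.

Theorem theorem2 (R : realType) (v : nat -> nat) (alpha : \bar R)
  (disp : nat -> measure_display) (T : forall n, measurableType (disp n))
  (Pr : forall n, probability (T n) R)
  (P Q : forall n, T n -> 'M[R[i]]_(n + v n, n))
  (sigma : forall n, T n -> 'I_n -> R[i])
  (alpha_ge0 : (0 <= alpha)%E)
  (v_lim : (fun n => ((v n)%:R / n%:R : R)%:E) @ \oo --> alpha)
  (model : forall n, (0 < n)%N ->
     chiral_dirac_model (Pr n) (P n) (Q n) (sigma n)) :
  (forall t : R, 1 < t ->
     (fun n => (n%:R^-1)%:E *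
        lne (Pr n [set w | (t <= scaled_max (v n) (sigma n w))%R]))%E @ \oo
       --> (- J alpha t)%:E)
  /\
  (forall (d : nat -> R) (t : R),
     (forall n, (0 < n)%N -> 0 < d n) ->
     much_less (fun n => Num.sqrt (ln n%:R / n%:R)) d ->
     much_less d (fun=> 1) ->
     0 < t ->
     (fun n => ((n%:R * d n ^+ 2)^-1)%:E *
        lne (Pr n [set w | (1 + t * d n <= scaled_max (v n) (sigma n w))%R]))%E
       @ \oo --> (- (moderate_rate alpha * t ^+ 2))%:E).
Proof.
have [gam [gam0 g_lim J_spec mE]] := ratio_cvg alpha_ge0 v_lim.
pose g n : R := n%:R / (n + v n)%:R.
have g0 n : (0 < n)%N -> 0 < g n.
  by move=> n0; rewrite divr_gt0 // ltr0n ?addn_gt0 n0.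
pose prob (t : nat -> R) n := Pr n [set w | (t n <= scaled_max (v n) (sigma n w))%R].
have bounds (t : nat -> R) : (forall n, (0 < n)%N -> 0 < t n) ->
    (forall n, (0 < n)%N -> prob t n = (fine (prob t n))%:E) /\
    satisfies_bounds g (fun n => fine (prob t n)) t.
  move=> t0; split=> n n0; have [_ _ _ hd] := model n n0;
    have [p [pE h1 h2]] := max_Re_bounds n0 hd (t0 n n0); rewrite /prob pE //=.
split.
- move=> t t1; have [|pE pb] := bounds (fun=> t).
    by move=> n _; exact: lt_trans t1.
  have [us [us0 phiE ->]] := J_spec t t1.
  have [p0 lim] := large_deviation g0 gam0 g_lim t1 pb us0 phiE.
  rewrite opprB; have := deviation_cvg pE p0 lim.
  by under eq_fun do rewrite expr1n mulr1.
- move=> d t d0 hln hd t0; rewrite mE.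
  have d_lim : d @ \oo --> (0 : R).
    by move: hd; rewrite /much_less; under eq_fun do rewrite divr1.
  have [|pE pb] := bounds (fun n => 1 + t * d n).
    by move=> n n0; rewrite addr_gt0 // mulr_gt0 // d0.
  (* This is the square of the hypothesis that sqrt(ln n / n) is much less than d_n. *)
  have ln_lim : (fun n => ln n%:R / (n%:R * d n ^+ 2)) @ \oo --> (0 : R).
    have hh : (fun n => Num.sqrt (ln n%:R / n%:R) / d n * (Num.sqrt (ln n%:R / n%:R) / d n))
        @ \oo --> (0 : R) by rewrite -[X in _ --> X](mulr0 0); exact: cvgM.
    apply: cvg_trans (near_eq_cvg _) hh.
    near=> n; have n0 : (0 < n)%N by near: n; exact: nbhs_infty_gt.
    have nr : 0 < n%:R :> R by rewrite ltr0n.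
    have l0 : 0 <= ln n%:R / n%:R :> R by rewrite divr_ge0 ?ln_ge0 ?ler1n // ltW.
    rewrite /= mulrACA -expr2 sqr_sqrtr // -invfM.
    by field; rewrite !gt_eqF // d0.
  have [p0 lim] := moderate_deviation g0 gam0 g_lim t0 d0 d_lim ln_lim pb.
  exact: deviation_cvg pE p0 lim.
Unshelve. all: by end_near.
Qed.
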